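(* Let $\varepsilon>0$ and $u\in W^{P+1,2}(\Omega_\sigma)$. The solution $u_\sigma\in V_\sigma^P(\Omega_\sigma)$ of the variational problem $$A(u_\sigma,v_\sigma)=\int_\Omega u\,v_\sigma\,\mathrm{d}x\qquad\forall v_\sigma\in V_\sigma^P(\Omega_\sigma),$$ where $A(w,v)=\int_\Omega wv\,\mathrm{d}x+\varepsilon j(w,v)$, satisfies $$\|u_\sigma-u\|_{L^2(\Omega_\sigma)}\leq C(\varepsilon)\sigma^{P+1}\|u\|_{W^{P+1,2}(\Omega_\sigma)},$$ where the constant $C(\varepsilon)$ is independent of $\sigma$, $u$, and how the boundary $\partial\Omega$ intersects the Cartesian grid.
   Context: Grid. Let $d\in\mathbb{N}$, $P\in\mathbb{N}_0$, $\sigma>0$. For $i\in\mathbb{Z}^d$ let $x_i:=(i_1\sigma,\ldots,i_d\sigma)$ be the Cartesian grid points (nodes), $\Omega_i:=\prod_{l=1}^d((i_l-1)\sigma,(i_l+1)\sigma)$ the patches, $\omega_i:=\prod_{l=1}^d((i_l-\tfrac12)\sigma,(i_l+\tfrac12)\sigma)$ the patch-cores, and $Q_i:=\prod_{l=1}^d(i_l\sigma,(i_l+1)\sigma)$ the elements. Partition of unity. Let $\zeta:\mathbb{R}\to\mathbb{R}$, $\zeta(x)=K^{-1}\exp(-1/(1-4x^2))$ for $|x|<\tfrac12$ and $\zeta(x)=0$ otherwise, with $K>0$ such that $\|\zeta\|_{L^1(\mathbb{R})}=1$; on $\mathbb{R}^d$ put $\zeta(x)=\prod_{l=1}^d\zeta(x_l)$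 and $\zeta_\sigma(x)=\sigma^{-d}\zeta(x/\sigma)$. Set $\varphi_i:=\chi_{\omega_i}\star\zeta_\sigma$ (convolution with the characteristic function of $\omega_i$). The $\varphi_i$ are $C^\infty$, have support $\operatorname{clos}\Omega_i$, and sum to $1$. Domains. $\Omega\subset\mathbb{R}^d$ is a bounded domain for which Stein's extension theorem holds (there is a bounded linear extension operator $W^{k,2}(\Omega)\to W^{k,2}(\mathbb{R}^d)$ for every $k\in\mathbb{N}$). The fictitious domain is $\Omega_\sigma:=\operatorname{int}\bigcup\lbrace\operatorname{clos}Q_i\mid\operatorname{meas}_d(Q_i\cap\Omega)>0\rbrace$; the cut part is $\Omega_\sigma^\Gamma:=\operatorname{int}\bigcup\lbrace\operatorname{clos}Q_i\mid Q_i\subset\Omega_\sigma,\ Q_i\not\subset\Omega\rbrace$; the uncut part is $\Omega_\sigma^\circ:=\operatorname{int}\bigcup\lbrace\operatorname{clos}Q_i\mid Q_i\subset\Omega_\sigma,\ Q_i\subset\Omega\rbrace$. One writes $Q_i\in\Omega_\sigma^\Gamma$ for $Q_i\subset\Omega_\sigma^\Gamma$, and similarly for the other domains. Two elements are neighbors if they share at least one grid node. Standing assumption: for every $Q_i\in\Omega_\sigma^\Gamma$ there is a finite sequence $(Q_i=Q_{i,1},\ldots,Q_{i,K})$ of elements in $\Omega_\sigma^\Gamma$ with $K$ bounded independently of $\sigma$, any two subsequent elements being neighbors, and $Q_{i,K}$ having a neighbor in $\Omega_\sigma^\circ$ (if necessary, this is enforced by moving additional elements from $\Omega_\sigma^\circ$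 to $\Omega_\sigma^\Gamma$). Space and forms. $V_\sigma^P(\Omega_\sigma)$ is the span of the functions $\varphi_i x^\alpha$, $|\alpha|\leq P$, $i\in\mathbb{Z}^d$, restricted to $\Omega_\sigma$. The stabilization form is $$j(u,v):=\sigma^{2(P+1)}\sum_{Q_i\in\Omega_\sigma^\Gamma}\sum_{|\alpha|=P+1}\int_{Q_i}(\partial^\alpha u)(\partial^\alpha v)\,\mathrm{d}x.$$ Local approximation (Bramble--Hilbert) assumption. For all $i$ with $\Omega_i\cap\Omega_\sigma\neq\emptyset$ and all $w\in W^{P+1,2}(\Omega_\sigma\cap\Omega_i)$ there is a polynomial $v_i$ of total degree at most $P$ with $|w-v_i|_{W^{k,2}(\Omega_\sigma\cap\Omega_i)}\leq C\sigma^{P+1-k}|w|_{W^{P+1,2}(\Omega_\sigma\cap\Omega_i)}$ for all $k\in\mathbb{N}_0$, $k\leq P+1$, with $C$ independent of $\sigma$ and $w$ (and of how $\partial\Omega$ intersects the grid). Here $|w|_{W^{k,2}}^2=\sum_{|\alpha|=k}\|\partial^\alpha w\|_{L^2}^2$. *)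

(* Defs.v *)
From HB Require Import structures.
From mathcomp Require Import all_boot all_order all_algebra.
From mathcomp Require Import all_classical all_reals all_analysis.

Set Implicit Arguments.
Unset Strict Implicit.
Unset Printing Implicit Defensive.
Import Order.TTheory GRing.Theory Num.Theory.
Import numFieldNormedType.Exports.

Local Open Scope classical_set_scope.
Local Open Scope ring_scope.

(** * Lebesgue measure on [R^d], realised as ['rV[R]_d]

    The sigma-algebra on ['rV[R]_d] is the one generated by the coordinates
    (i.e. the Borel sets). *)

Section measurable_rV.
Variables (R : realType) (n : nat).

Let coors : 'I_n -> 'rV[R]_n -> measurableTypeR R := fun i x => x ord0 i.

Let rV_set0 : g_sigma_preimage coors set0.
Proof. exact: sigma_algebra0. Qed.

Let rV_setC A : g_sigma_preimage coors A -> g_sigma_preimage coors (~` A).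
Proof. exact: sigma_algebraC. Qed.

Let rV_bigcup (F : _^nat) : (forall i, g_sigma_preimage coors (F i)) ->
  g_sigma_preimage coors (\bigcup_i (F i)).
Proof. exact: sigma_algebra_bigcup. Qed.

HB.instance Definition _ := @isMeasurable.Build
  (measure_tuple_display default_measure_display) 'rV[R]_n
  (g_sigma_preimage coors) rV_set0 rV_setC rV_bigcup.

Lemma measurable_coord (i : 'I_n) :
  measurable_fun [set: 'rV[R]_n] (fun x => x ord0 i : measurableTypeR R).
Proof.
move=> _ Y mY; rewrite setTI; apply: sub_sigma_algebra => /=.
rewrite -bigcup_seq/=; exists i => /=; first by rewrite mem_index_enum.
by exists Y => //; rewrite setTI.
Qed.

Lemma measurable_fun_rV d (T : measurableType d) (f : T -> 'rV[R]_n) :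
  (forall i, measurable_fun [set: T] (fun t => f t ord0 i : measurableTypeR R)) ->
  measurable_fun [set: T] f.
Proof.
move=> mf _ A mA; rewrite setTI.
suff : g_sigma_preimage coors `<=` [set B | measurable (f @^-1` B)] by apply.
apply: smallest_sub => [|B].
  split => /=.
  - by rewrite preimage_set0.
  - by move=> B mB; rewrite setTD preimage_setC; exact: measurableC.
  - by move=> F mF; rewrite preimage_bigcup; exact: bigcupT_measurable.
rewrite -bigcup_seq/= => -[i _ [C mC <-]].
rewrite setTI /=; have := mf i measurableT C mC.
by rewrite setTI.
Qed.

End measurable_rV.

Section lebesgue_rV.
Variable R : realType.

Definition rV_cons n (p : measurableTypeR R * 'rV[R]_n) : 'rV[R]_n.+1 :=
  \row_k (if unlift ord0 k is Some l then p.2 ord0 l else p.1).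

Definition rV_uncons n (x : 'rV[R]_n.+1) : measurableTypeR R * 'rV[R]_n :=
  (x ord0 ord0, \row_l x ord0 (lift ord0 l)).

Lemma rV_consK n : cancel (@rV_cons n) (@rV_uncons n).
Proof.
move=> [a x]; rewrite /rV_uncons /rV_cons mxE unlift_none /=; congr pair.
by apply/rowP => l; rewrite !mxE liftK.
Qed.

Lemma rV_unconsK n : cancel (@rV_uncons n) (@rV_cons n).
Proof.
move=> x; apply/rowP => k; rewrite !mxE.
by case: unliftP => [l ->|->] //=; rewrite mxE.
Qed.

Lemma measurable_rV_cons n : measurable_fun setT (@rV_cons n).
Proof.
apply: measurable_fun_rV => k.
have [l ->|->] := unliftP ord0 k.
  rewrite (_ : (fun _ => _) = (fun x : 'rV[R]_n => x ord0 l : measurableTypeR R) \o snd); last first.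
    by apply/funext => p; rewrite mxE liftK.
  exact: measurableT_comp (@measurable_coord R n l) measurable_snd.
rewrite (_ : (fun _ => _) = fst); first exact: measurable_fst.
by apply/funext => p; rewrite mxE unlift_none.
Qed.

Lemma measurable_rV_uncons n : measurable_fun setT (@rV_uncons n).
Proof.
apply: (@measurable_fun_pair _ _ _ _ _ _ (fun x : 'rV[R]_n.+1 => x ord0 ord0 : measurableTypeR R)
  (fun x : 'rV[R]_n.+1 => \row_l x ord0 (lift ord0 l))).
  exact: measurable_coord.
apply: measurable_fun_rV => l.
rewrite (_ : (fun _ => _) = (fun x : 'rV[R]_n.+1 => x ord0 (lift ord0 l) : measurableTypeR R)).
  exact: measurable_coord.
by apply/funext => x; rewrite mxE.
Qed.

Section step.
Variables (n : nat) (m : {sigma_finite_measure set 'rV[R]_n -> \bar R}).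

Definition lebesgue_step : set 'rV[R]_n.+1 -> \bar R :=
  pushforward (@lebesgue_measure R \x m)%E (@rV_cons n).

Let step0 : lebesgue_step set0 = 0%E.
Proof. by rewrite /lebesgue_step /pushforward preimage_set0 measure0. Qed.

Let step_ge0 A : (0 <= lebesgue_step A)%E.
Proof. exact: (measure_ge0 (@lebesgue_measure R \x m)%E). Qed.

Let step_sigma_additive : semi_sigma_additive lebesgue_step.
Proof.
move=> F mF tF mUF; rewrite /lebesgue_step /pushforward preimage_bigcup.
apply: measure_semi_sigma_additive.
- by move=> k; rewrite -[X in measurable X]setTI; exact: measurable_rV_cons.
- apply/trivIsetP => /= i j _ _ ij; rewrite -preimage_setI.
  by move/trivIsetP : tF => /(_ _ _ _ _ ij) ->//; rewrite preimage_set0.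
- rewrite -preimage_bigcup -[X in measurable X]setTI.
  exact: measurable_rV_cons.
Qed.

HB.instance Definition _ := isMeasure.Build _ _ _ lebesgue_step
  step0 step_ge0 step_sigma_additive.

Let step_sigma_finite : sigma_finite setT lebesgue_step.
Proof.
have /sigma_finiteP[F [FT ndF Foo]] := sigma_finiteT (@lebesgue_measure R).
have /sigma_finiteP[G [GT ndG Goo]] := sigma_finiteT m.
exists (fun k => @rV_uncons n @^-1` (F k `*` G k)).
  rewrite -preimage_bigcup (_ : \bigcup_k (F k `*` G k) = setT).
    by rewrite preimage_setT.
  rewrite -subTset => -[a x] _.
  have [k _ Fk] : (\bigcup_i F i) a by rewrite -FT.
  have [l _ Gl] : (\bigcup_i G i) x by rewrite -GT.
  exists (maxn k l) => //; split => /=.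
    by move: a Fk; exact/subsetPset/ndF/leq_maxl.
  by move: x Gl; exact/subsetPset/ndG/leq_maxr.
move=> k; have [mF Fk] := Foo k; have [mG Gk] := Goo k; split.
  rewrite -[X in measurable X]setTI.
  by apply: measurable_rV_uncons => //; exact: measurableX.
rewrite /lebesgue_step /pushforward -comp_preimage.
rewrite (_ : _ \o _ = id); last by apply/funext => p /=; rewrite rV_consK.
by rewrite preimage_id product_measure1E// lte_mul_pinfty// ge0_fin_numE.
Qed.

HB.instance Definition _ := Measure_isSigmaFinite.Build _ _ _ lebesgue_step
  step_sigma_finite.

End step.

Fixpoint lebesgue_rV n : {sigma_finite_measure set 'rV[R]_n -> \bar R} :=
  if n is k.+1 then lebesgue_step (lebesgue_rV k) else \d_(0 : 'rV[R]_0).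

Lemma measurable_box n (A : 'I_n -> set R) :
  (forall l, measurable (A l)) ->
  measurable [set x : 'rV[R]_n | forall l, A l (x ord0 l)].
Proof.
move=> mA; rewrite (_ : [set x | _] =
  \bigcap_(l in [set: 'I_n]) ((fun x : 'rV[R]_n => x ord0 l) @^-1` A l)).
  apply: fin_bigcap_measurable => [|l _]; first exact: finite_finset.
  have := @measurable_coord R n l measurableT (A l) (mA l).
  by rewrite setTI.
by apply/seteqP; split => x /= Ax => [l _|l]; exact: Ax.
Qed.

Lemma lebesgue_rV_box n (A : 'I_n -> set R) : (forall l, measurable (A l)) ->
  lebesgue_rV n [set x | forall l, A l (x ord0 l)] =
  (\prod_(l < n) lebesgue_measure (A l : set (measurableTypeR R)))%E.
Proof.
elim: n A => [|n IH] A mA.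
  by rewrite big_ord0 /= diracE mem_set//= => -[].
rewrite big_ord_recl -IH//= /lebesgue_step /pushforward.
rewrite -(@product_measure1E _ _ _ _ _ (@lebesgue_measure R) (lebesgue_rV n)
  (A ord0)); [|exact: mA|exact: (@measurable_box n (fun l => A (lift ord0 l)))].
congr (_ _); apply/seteqP; split => -[a x] /=.
  move=> Aax; split => [|l]; first by have := Aax ord0; rewrite mxE unlift_none.
  by have := Aax (lift ord0 l); rewrite mxE liftK.
by move=> [Aa Ax] l; rewrite mxE; case: unliftP => [k ->|->].
Qed.

End lebesgue_rV.

(** * Calculus and Sobolev spaces *)

Section calculus.
Variables (R : realType) (d : nat).
Local Notation rV := 'rV[R]_d.
Local Notation leb := (lebesgue_rV R d).

(** Multi-indices are functions ['I_d -> nat]; the components of one of order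
    [k] are at most [k], so that those of order [k] (or at most [k]) can be
    enumerated inside the finite type ['I_d -> 'I_k.+1]. *)
Definition mindex k : finType := {ffun 'I_d -> 'I_k.+1}.
Definition mval k (a : mindex k) : 'I_d -> nat := fun l => a l.
Definition morder (a : 'I_d -> nat) : nat := (\sum_l a l)%N.

Definition monom (a : 'I_d -> nat) : rV -> R :=
  fun x => \prod_l x ord0 l ^+ a l.

Definition polyfun P : set (rV -> R) := [set p | exists c : mindex P -> R,
  p = fun x => \sum_(a | (morder (mval a) <= P)%N) c a * monom (mval a) x].

Definition pderiv (l : 'I_d) (f : rV -> R) : rV -> R :=
  fun x => 'D_(delta_mx ord0 l) f x.

Definition mderiv (a : 'I_d -> nat) (f : rV -> R) : rV -> R :=
  foldr (fun l => iter (a l) (pderiv l)) f (enum 'I_d).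

Definition smooth (f : rV -> R) : Prop :=
  forall (s : seq 'I_d) x, differentiable (foldr pderiv f s) x.

Definition test_function (O : set rV) (psi : rV -> R) : Prop :=
  smooth psi /\
  exists K : set rV, [/\ compact K, K `<=` O & forall x, ~ K x -> psi x = 0].

Definition L2norm (O : set rV) (f : rV -> R) : \bar R :=
  'N[leb]_2%:E [EFin \o (f \_ O)]%E.

Definition L2 (O : set rV) (f : rV -> R) : Prop :=
  f \_ O \in Lfun leb 2%:E.

Definition is_wderiv (O : set rV) (a : 'I_d -> nat) (f g : rV -> R) : Prop :=
  L2 O g /\ forall psi, test_function O psi ->
    \int[leb]_(x in O) (f x * mderiv a psi x) =
    (-1) ^+ morder a * \int[leb]_(x in O) (g x * psi x).

(** A representative of the weak derivative, which is unique up to a null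
    set. *)
Definition wderiv (O : set rV) (a : 'I_d -> nat) (f : rV -> R) : rV -> R :=
  xget (fun=> 0) [set g | is_wderiv O a f g].

Definition sobolev (O : set rV) (k : nat) (f : rV -> R) : Prop :=
  L2 O f /\ forall a, (morder a <= k)%N -> exists g, is_wderiv O a f g.

Definition sobolev_seminorm (O : set rV) (k : nat) (f : rV -> R) : \bar R :=
  ((\sum_(a : mindex k | morder (mval a) == k)
     L2norm O (wderiv O (mval a) f) ^+ 2) `^ 2^-1)%E.

Definition sobolev_norm (O : set rV) (k : nat) (f : rV -> R) : \bar R :=
  ((\sum_(j < k.+1) sobolev_seminorm O j f ^+ 2) `^ 2^-1)%E.

(** Linearity is stated almost everywhere, as befits an operator between spaces
    of classes of functions. *)
Definition extension_operator (O : set rV) (k : nat)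
    (E : (rV -> R) -> rV -> R) : Prop :=
  [/\ forall f, sobolev O k f ->
        sobolev setT k (E f) /\ {ae leb, forall x, O x -> E f x = f x},
      forall (c : R) f g, sobolev O k f -> sobolev O k g ->
        {ae leb, forall x, E (fun y => c * f y + g y) x = c * E f x + E g x} &
      exists B : R, forall f, sobolev O k f ->
        (sobolev_norm setT k (E f) <= B%:E * sobolev_norm O k f)%E].

Definition bounded_domain (O : set rV) : Prop :=
  [/\ open O, connected O, O !=set0 & bounded_set O].

Definition stein_extension (O : set rV) : Prop :=
  forall k : nat, exists E, extension_operator O k E.

End calculus.

(** * Cartesian grid, partition of unity and the discrete problem *)

Section grid.
Variables (R : realType) (d : nat) (sigma : R).
Local Notation rV := 'rV[R]_d.
Local Notation idx := 'rV[int]_d.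
Local Notation leb := (lebesgue_rV R d).

Definition node (i : idx) : rV := \row_l ((i ord0 l)%:~R * sigma).

Definition patch (i : idx) : set rV := [set x | forall l,
  ((i ord0 l)%:~R - 1) * sigma < x ord0 l < ((i ord0 l)%:~R + 1) * sigma].

Definition core (i : idx) : set rV := [set x | forall l,
  ((i ord0 l)%:~R - 2^-1) * sigma < x ord0 l < ((i ord0 l)%:~R + 2^-1) * sigma].

Definition element (i : idx) : set rV := [set x | forall l,
  (i ord0 l)%:~R * sigma < x ord0 l < ((i ord0 l)%:~R + 1) * sigma].

Definition neighbors (i j : idx) : Prop := exists n,
  closure (element i) (node n) /\ closure (element j) (node n).

(** The unnormalised kernel; dividing by its mass makes [zeta] of unit
    [L^1]-norm. *)
Definition zeta_profile (x : R) : R :=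
  if `|x| < 2^-1 then expR (- (1 - 4 * x ^+ 2)^-1) else 0.

Definition zeta_mass : R := \int[lebesgue_measure]_x zeta_profile x.

Definition zeta (x : R) : R := zeta_mass^-1 * zeta_profile x.

Definition zeta_sigma (x : rV) : R :=
  sigma ^- d * \prod_l zeta (x ord0 l / sigma).

Definition phi (i : idx) (x : rV) : R :=
  \int[leb]_y (\1_(core i) y * zeta_sigma (x - y)).

(** [V_sigma^P (O)]; only the values on [O] of its members are significant. *)
Definition Vspace (P : nat) (O : set rV) : set (rV -> R) :=
  [set v | exists (s : seq idx) (c : idx -> mindex d P -> R), forall x, O x ->
    v x = \sum_(i <- s) \sum_(a | (morder (mval a) <= P)%N)
            c i a * (phi i x * monom (mval a) x)].

Section domains.
Variable Omega : set rV.

Definition elements_domain (I : set idx) : set rV :=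
  (\bigcup_(i in I) closure (element i))°.

Definition fictitious : set rV :=
  elements_domain [set i | (0 < leb (element i `&` Omega))%E].

(** The cut and uncut parts, the elements indexed by [M] having been moved from
    the latter to the former. *)
Definition cut_part (M : set idx) : set rV := elements_domain
  [set i | element i `<=` fictitious /\ (~ (element i `<=` Omega) \/ M i)].

Definition uncut_part (M : set idx) : set rV := elements_domain
  [set i | [/\ element i `<=` fictitious, element i `<=` Omega & ~ M i]].

Definition movable (M : set idx) : Prop :=
  forall i, M i -> element i `<=` fictitious /\ element i `<=` Omega.

Definition chain_condition (K : nat) (M : set idx) : Prop :=
  forall i, element i `<=` cut_part M -> exists s : seq idx,
    [/\ (size (i :: s) <= K)%N,
        forall j, j \in i :: s -> element j `<=` cut_part M,
        path (fun j k => `[< neighbors j k >]) i s &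
        exists2 m, element m `<=` uncut_part M & neighbors (last i s) m].

Definition local_approximation (P : nat) (C : R) : Prop :=
  forall i, patch i `&` fictitious !=set0 ->
  forall w, sobolev (fictitious `&` patch i) P.+1 w ->
  exists2 v, polyfun P v & forall k, (k <= P.+1)%N ->
    (sobolev_seminorm (fictitious `&` patch i) k (w \- v)%R <=
     (C * sigma ^+ (P.+1 - k))%:E *
       sobolev_seminorm (fictitious `&` patch i) P.+1 w)%E.

(** Classical derivatives suffice here: the forms are only evaluated on
    [Vspace P fictitious], whose members are smooth on each element. *)
Definition stab_form (P : nat) (M : set idx) (u v : rV -> R) : R :=
  sigma ^+ (2 * P.+1) *
  \sum_(i \in [set i | element i `<=` cut_part M])
    \sum_(a : mindex d P.+1 | morder (mval a) == P.+1)
      \int[leb]_(x in element i) (mderiv (mval a) u x * mderiv (mval a) v x).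

Definition form_A (P : nat) (M : set idx) (eps : R) (w v : rV -> R) : R :=
  \int[leb]_(x in Omega) (w x * v x) + eps * stab_form P M w v.

End domains.
End grid.

(* Main.v *)
From HB Require Import structures.
Require Import Defs.
From mathcomp Require Import all_boot all_order all_algebra.
From mathcomp Require Import all_classical all_reals all_analysis.
From mathcomp Require Import measurable_realfun ring lra zify.
Import Order.TTheory GRing.Theory Num.Theory.
Import numFieldNormedType.Exports.
Local Open Scope classical_set_scope.
Local Open Scope ring_scope.

Set Implicit Arguments.
Unset Strict Implicit.
Unset Printing Implicit Defensive.

(** Let [wh = \sum_k phi_k q_k] be the quasi-interpolant of [u] built from the
    local polynomials [q_k], and [e = us - wh]. Testing the variational problem
    with [e] bounds [|e|_{L2(Omega)}^2 + eps j(e,e)] by the errors of [wh], which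
    are of order [sigma^(2(P+1))]: for [j(wh,wh)] because the derivatives of
    order [P+1] of [wh] on an element only see the differences of the [q_k].
    To pass from [Omega] to the fictitious domain one compares [e] on two
    neighboring elements [Q], [Q']:
      [|e|_{L2(Q)}^2 <= C (|e|_{L2(Q')}^2 + sigma^(2(P+1)) |e|_{P+1,Q}^2)].
    After rescaling, [e] ranges over the restrictions of one finite-dimensional
    space, whatever the position of the boundary, so it suffices that [e]
    vanishes on [Q] when the right-hand side does: it is then a polynomial on
    [Q] that vanishes to infinite order, like [e] on [Q'], at a common node of
    [Q] and [Q']. Iterating along the chains of cut elements
    gives the bound. *)

(** * The kernel and its primitive *)

(** The constant must not see [sigma] or the cut, so the comparisons of discrete functions take
    place on whole elements, cut or not, where such a function is given by finitely many
    coefficients with respect to functions on the unit grid. These coefficients are not unique (many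
    [phi] vanish on a given element), so both sides are only semidefinite and equivalence of norms
    does not apply; inclusion of kernels replaces it. The functions [phi] are smooth but not
    analytic: vanishing on one element alone says nothing about its neighbor, and it is the
    derivatives of order [P + 1] in the stabilization that leave only a polynomial there.

    Since [u] has only weak derivatives, it is never inserted in the stabilization form. The
    inconsistency of the method appears instead as [j(wh, wh)], through completed squares, so the
    energy estimate needs no constant of its own. Dividing by [eps] then bounds [j(e, e)] alone,
    which is why the final constant involves both [eps] and its inverse. *)

Section smooth_real_functions.
Variable R : realType.
Implicit Types f g : R -> R.

(** Smoothness is graded by order: the derivative of a product or of a composition involves the
    functions themselves again, so the closure lemmas go by induction on a finite order. *)
Fixpoint ndiff n f : Prop :=
  if n is m.+1 then (forall x : R, derivable f x 1) /\ ndiff m (derive1 f) else True.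

Definition smooth1 f := forall n, ndiff n f.

Lemma ndiffW n f : ndiff n.+1 f -> ndiff n f.
Proof. by elim: n f => [//|n IH] f [df /IH]. Qed.

Lemma ndiffS n f f' : (forall x : R, is_derive x 1 f (f' x)) -> ndiff n f' ->
  ndiff n.+1 f.
Proof.
move=> df nf'; split=> [x|]; first exact: ex_derive.
by rewrite (_ : derive1 f = f')//; apply/funext => x; rewrite derive1E derive_val.
Qed.

Lemma smooth1_derivable f (x : R) : smooth1 f -> derivable f x 1.
Proof. by move=> /(_ 1%N)[]. Qed.

Lemma smooth1_is_derive f (x : R) : smooth1 f -> is_derive x 1 f (derive1 f x).
Proof. by move=> sf; rewrite derive1E; exact/derivableP/smooth1_derivable. Qed.

Lemma smooth1_derive1 f : smooth1 f -> smooth1 (derive1 f).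
Proof. by move=> sf n; have [] := sf n.+1. Qed.

Lemma smooth1_derive1n n f : smooth1 f -> smooth1 (derive1n n f).
Proof. by move=> sf; elim: n => // n IH; exact: smooth1_derive1. Qed.

Lemma smooth1_continuous f : smooth1 f -> continuous f.
Proof.
move=> sf x; apply: differentiable_continuous.
exact/derivable1_diffP/smooth1_derivable.
Qed.

Lemma ndiff_cst n (c : R) : ndiff n (fun=> c).
Proof.
elim: n c => [//|n IH] c; exact: ndiffS (IH 0).
Qed.

Lemma ndiffD n f g : ndiff n f -> ndiff n g -> ndiff n (fun x => f x + g x).
Proof.
elim: n f g => [//|n IH] f g [df nf] [dg ng].
apply: ndiffS (IH _ _ nf ng) => x; apply: is_deriveD.
  by rewrite derive1E; exact/derivableP.
by rewrite derive1E; exact/derivableP.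
Qed.

Lemma ndiffM n f g : ndiff n f -> ndiff n g -> ndiff n (fun x => f x * g x).
Proof.
elim: n f g => [//|n IH] f g nf ng.
have [df nf'] := nf; have [dg ng'] := ng.
apply: (@ndiffS n (fun x => f x * g x)
  (fun x => f x * derive1 g x + g x * derive1 f x)).
  move=> x; apply: is_deriveM.
    by rewrite derive1E; exact/derivableP.
  by rewrite derive1E; exact/derivableP.
by apply: ndiffD; apply: IH => //; exact: ndiffW.
Qed.

Lemma ndiff_comp n f g : ndiff n f -> ndiff n g -> ndiff n (fun x => f (g x)).
Proof.
elim: n f g => [//|n IH] f g nf ng.
have [df nf'] := nf; have [dg ng'] := ng.
apply: (@ndiffS n (fun x => f (g x)) (fun x => derive1 f (g x) * derive1 g x)).
  move=> x; apply: (@is_derive1_comp _ f g x); rewrite derive1E; exact/derivableP.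
by apply: ndiffM => //; apply: IH => //; exact: ndiffW.
Qed.

Lemma smooth1_cst (c : R) : smooth1 (fun=> c).
Proof. by move=> n; exact: ndiff_cst. Qed.

Lemma smooth1D f g : smooth1 f -> smooth1 g -> smooth1 (fun x => f x + g x).
Proof. by move=> sf sg n; exact: ndiffD. Qed.

Lemma smooth1M f g : smooth1 f -> smooth1 g -> smooth1 (fun x => f x * g x).
Proof. by move=> sf sg n; exact: ndiffM. Qed.

Lemma smooth1_comp f g : smooth1 f -> smooth1 g -> smooth1 (fun x => f (g x)).
Proof. by move=> sf sg n; exact: ndiff_comp. Qed.

Lemma smooth1_id : smooth1 (fun x => x).
Proof.
case=> // n; apply: (@ndiffS _ _ (fun=> 1)); exact: ndiff_cst.
Qed.

Lemma smooth1B f g : smooth1 f -> smooth1 g -> smooth1 (fun x => f x - g x).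
Proof.
move=> sf sg; have := smooth1D sf (smooth1M (smooth1_cst (-1)) sg).
by congr smooth1; apply/funext => x; rewrite mulN1r.
Qed.

Lemma smooth1X n : smooth1 (fun x => x ^+ n).
Proof.
elim: n => [|n IH]; first exact: smooth1_cst.
have := smooth1M smooth1_id IH.
by congr smooth1; apply/funext => x; rewrite exprS.
Qed.

Lemma smooth1_affine (a b : R) : smooth1 (fun x => x * a + b).
Proof.
apply: smooth1D (smooth1_cst _); apply: smooth1M (smooth1_cst _).
exact: smooth1_id.
Qed.

(** The one-sided flat functions [q(1/t) exp(-1/t)], a family closed under
    differentiation. *)
Definition flat (q : {poly R}) (t : R) : R :=
  if 0 < t then q.[t^-1] * expR (- t^-1) else 0.

Lemma horner_ler_pow (q : {poly R}) : exists A : R, 0 <= A /\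
  forall s, 1 <= s -> `|q.[s]| <= A * s ^+ size q.
Proof.
exists (\sum_(i < size q) `|q`_i|); split; first exact: sumr_ge0.
move=> s s1; rewrite horner_coef (le_trans (ler_norm_sum _ _ _))//.
rewrite mulr_suml ler_sum// => i _; rewrite normrM ler_wpM2l//.
have s0 : 0 <= s by apply: le_trans s1.
by rewrite ger0_norm ?exprn_ge0// ler_weXn2l// ltnW.
Qed.

(** For [n > 0] this is the [n]-th power of [s / n <= expR (s / n)]. *)
Lemma pow_expRN_le n (s : R) : 0 <= s -> s ^+ n * expR (- s) <= n%:R ^+ n.
Proof.
move=> s0; case: n => [|n].
  by rewrite !expr0 mul1r -expR0 ler_expR oppr_le0.
have n0 : (0 : R) < n.+1%:R by rewrite ltr0n.
rewrite expRN ler_pdivrMr ?expR_gt0//.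
have -> : expR s = expR (s / n.+1%:R) ^+ n.+1.
  by rewrite -expRM_natl mulrC divfK// gt_eqF.
rewrite -exprMn; apply: lerXn2r.
- by rewrite nnegrE.
- by rewrite nnegrE mulr_ge0 ?expR_ge0// ltW.
rewrite -ler_pdivrMl// mulrC (le_trans _ (expR_ge1Dx _))//.
by rewrite lerDr.
Qed.

(** The exponential absorbs one power of [t^-1] beyond those in the bound on [q]; this spare power
    becomes the factor [|t|]. *)
Lemma flat_le (q : {poly R}) : exists A : R, 0 <= A /\
  forall t, t <= 1 -> `|flat q t| <= A * `|t|.
Proof.
have [A [A0 qA]] := horner_ler_pow q.
exists (A * (size q).+1%:R ^+ (size q).+1); split.
  by rewrite mulr_ge0// exprn_ge0.
move=> t t1; rewrite /flat; case: ifPn => [t0|_]; last first.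
  by rewrite normr0 mulr_ge0 // mulr_ge0// exprn_ge0.
rewrite normrM (ger0_norm (expR_ge0 _)) (gtr0_norm t0).
have s1 : 1 <= t^-1 by rewrite invf_ge1.
have s0 : 0 <= t^-1 by rewrite invr_ge0 ltW.
have := pow_expRN_le (size q).+1 s0.
rewrite exprS -mulrA ler_pdivrMl// => h.
apply: (@le_trans _ _ (A * t^-1 ^+ size q * expR (- t^-1))).
  by rewrite ler_wpM2r ?expR_ge0// qA.
by rewrite -!mulrA ler_wpM2l// [leRHS]mulrC.
Qed.

(** With [s = t^-1], the chain rule gives [s^2 (q(s) - q'(s)) exp(-s)] for [t > 0]. *)
Lemma is_derive_flat (q : {poly R}) (t : R) :
  is_derive t 1 (flat q) (flat ('X ^+ 2 * (q - deriv q)) t).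
Proof.
have [t0|t0|->] := ltgtP t 0.
- have : \forall x \near t, (fun=> 0 : R) x = flat q x.
    near=> x; rewrite /flat ifF//; apply/negbTE; rewrite -leNgt ltW//.
    by near: x; exact: lt_nbhsl.
  move=> /near_eq_is_derive; apply; rewrite /flat ltNge (ltW t0)/=.
  exact: is_derive_cst.
- have : \forall x \near t, (fun x => q.[x^-1] * expR (- x^-1)) x = flat q x.
    near=> x; rewrite /flat ifT//.
    by near: x; exact: lt_nbhsr.
  move=> /near_eq_is_derive; apply; rewrite /flat t0.
  have dV : is_derive t 1 (fun x : R => x^-1) (- t^-2).
    have tn0 : t != 0 by rewrite gt_eqF.
    have := @is_deriveV R id t 1 1 tn0 (is_derive_id _ _).
    move=> /is_derive_eq; apply.
    by rewrite /= [LHS]mulr1.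
  have dq : is_derive t 1 (fun x => q.[x^-1]) ((deriv q).[t^-1] * - t^-2).
    exact: (is_derive1_comp (is_derive_poly q _) dV).
  have de : is_derive t 1 (fun x => expR (- x^-1)) (expR (- t^-1) * t^-2).
    have dN : is_derive t 1 (fun x : R => - x^-1) (t^-2).
      by have := is_deriveN dV; rewrite opprK.
    exact: (is_derive1_comp (is_derive_expR _) dN).
  apply: is_derive_eq (is_deriveM dq de) _.
  rewrite !(hornerE,hornerXn) /GRing.scale/=.
  by rewrite !exprVn; ring.
(* The difference quotient of [flat q] at 0 is [flat ('X * q)], which tends to 0 by [flat_le]. *)
- have [A [A0 hA]] := flat_le ('X * q).
  have -> : flat ('X ^+ 2 * (q - deriv q)) 0 = 0 by rewrite /flat ltxx.
  have h0 : h^-1 *: ((flat q \o shift 0) (h *: (1 : R)) - flat q 0)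
      @[h --> (0:R)^'] --> (0 : R).
    have qE (h : R) : h^-1 *: ((flat q \o shift 0) (h *: (1 : R)) - flat q 0) =
        flat ('X * q) h.
      rewrite /= {2}/flat ltxx subr0 addr0 [h *: _]mulr1 /flat.
      case: ifPn => _; last by rewrite scaler0.
      by rewrite hornerM hornerX [LHS]mulrA.
    under eq_cvg do rewrite qE.
    apply/cvgr0Pnorm_lt => e e0.
    near=> h.
    have : `|flat ('X * q) h| <= A * `|h|.
      apply: hA; apply: ltW; near: h; apply: nbhs_dnbhs; exact: lt_nbhsl.
    move=> /le_lt_trans; apply.
    have : `|h| < e / (A + 1).
      near: h; apply: dnbhs0_lt; rewrite divr_gt0//; lra.
    rewrite ltr_pdivlMr; last lra.
    move=> /(le_lt_trans _); apply; rewrite mulrC ler_wpM2l//; lra.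
  apply: DeriveDef; first by apply/cvg_ex; exists 0.
  by apply/cvg_lim.
Unshelve. all: by end_near. Qed.

Lemma smooth1_flat q : smooth1 (flat q).
Proof.
move=> n; elim: n q => [//|n IH] q.
exact: ndiffS (is_derive_flat q) (IH _).
Qed.

(** As a flat function of a polynomial, the kernel is smooth across [|x| = 1/2] by composition. *)
Lemma zeta_profileE (x : R) : zeta_profile x = flat 1 (1 - 4 * x ^+ 2).
Proof.
rewrite /zeta_profile /flat.
have -> : (0 < 1 - 4 * x ^+ 2) = (`|x| < 2^-1).
  rewrite subr_gt0 -[in LHS]real_normK ?num_real//.
  have x0 := normr_ge0 x; apply/idP/idP => h; nra.
by case: ifPn => // _; rewrite hornerC mul1r.
Qed.

Lemma smooth1_zeta_profile : smooth1 (@zeta_profile R).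
Proof.
rewrite (_ : @zeta_profile R = fun x => flat 1 (1 - 4 * x ^+ 2)); last first.
  by apply/funext => x; exact: zeta_profileE.
apply: (@smooth1_comp (flat 1) (fun x => 1 - 4 * x ^+ 2)).
  exact: smooth1_flat.
apply: smooth1B; first exact: smooth1_cst.
by apply: smooth1M; [exact: smooth1_cst|exact: smooth1X].
Qed.

Lemma smooth1_zeta : smooth1 (@zeta R).
Proof. by apply: smooth1M; [exact: smooth1_cst|exact: smooth1_zeta_profile]. Qed.

End smooth_real_functions.

(** * The mollified indicator of an interval *)

Section mollifier_primitive.
Variable R : realType.
Local Notation mu := (@lebesgue_measure R).
Local Notation prof := (@zeta_profile R).

Lemma continuous_measurableT (f : R -> R) : continuous f ->
  measurable_fun [set: measurableTypeR R] (f : measurableTypeR R -> measurableTypeR R).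
Proof. exact: continuous_measurable_fun. Qed.

Lemma zeta_profile_ge0 x : 0 <= prof x.
Proof. by rewrite /zeta_profile; case: ifP => // _; exact: expR_ge0. Qed.

Lemma zeta_profile_out x : 2^-1 <= `|x| -> prof x = 0.
Proof. by move=> x2; rewrite /zeta_profile ltNge x2. Qed.

Lemma integrable_zeta_profile : mu.-integrable setT (EFin \o prof).
Proof.
have -> : EFin \o prof = (EFin \o prof) \_ `[- 2^-1, 2^-1].
  apply/funext => x; rewrite patchE; case: ifPn => // /negP xn.
  rewrite /= zeta_profile_out//; rewrite leNgt; apply/negP => x2; apply: xn.
  by rewrite inE/= in_itv/= -ler_norml ltW.
apply/(integrable_mkcond _ _).1 => //.
apply: continuous_compact_integrable; first exact: segment_compact.
apply: continuous_subspaceT.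
exact/smooth1_continuous/smooth1_zeta_profile.
Qed.

(** Mollifying the indicator of an interval gives, up to normalisation, a difference of two values
    of this primitive. *)
Definition zprim (x : R) : R := (\int[mu]_(t in `]-oo, x]) prof t)%R.

Lemma is_derive_zprim (x : R) : is_derive x 1 zprim (prof x).
Proof.
have [|||d e] := @continuous_FTC1 R prof -oo%O x (x + 1) _ _ _
    (@smooth1_continuous _ _ (@smooth1_zeta_profile R) x).
- by rewrite ltrDl.
- by apply: integrableS integrable_zeta_profile.
- by rewrite ltNyr.
by rewrite -e derive1E; exact/derivableP.
Qed.

Lemma zprim_le (x : R) : x <= - 2^-1 -> zprim x = 0.
Proof.
move=> x2; rewrite /zprim /Rintegral integral0_eq// => t /=.
rewrite in_itv/= => tx; rewrite zeta_profile_out//.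
by rewrite ler_normr; apply/orP; right; lra.
Qed.

Lemma zprim_ge (x : R) : 2^-1 <= x -> zprim x = @zeta_mass R.
Proof.
move=> x2; rewrite /zprim /zeta_mass Rintegral_mkcond.
congr Rintegral; apply/funext => t; rewrite patchE; case: ifPn => // /negP tx.
rewrite zeta_profile_out// ler_normr; apply/orP; left.
rewrite leNgt; apply/negP => t2; apply: tx; rewrite inE/= in_itv/=; lra.
Qed.

(** The mean value theorem yields a point inside []-1/2, 1/2[], where the kernel is an
    exponential. *)
Lemma zeta_mass_gt0 : 0 < @zeta_mass R.
Proof.
have -> : @zeta_mass R = zprim 2^-1 - zprim (- 2^-1).
  by rewrite zprim_ge// zprim_le// subr0.
have [|||c c2 ->] := @MVT R zprim prof (- 2^-1) 2^-1.
- by lra.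
- by move=> x _; exact: is_derive_zprim.
- apply: continuous_subspaceT => x; apply/differentiable_continuous.
  by apply/derivable1_diffP; have := is_derive_zprim x; case.
apply: (@mulr_gt0 R); last lra.
move: c2; rewrite in_itv/= /zeta_profile -ltr_norml => ->; exact: expR_gt0.
Qed.

Lemma smooth1_zprim : smooth1 zprim.
Proof.
case=> // n; apply: ndiffS is_derive_zprim _; exact: smooth1_zeta_profile.
Qed.

(** The one-dimensional factor of the functions [phi], on the unit grid. *)
Definition hat (x : R) : R :=
  (@zeta_mass R)^-1 * (zprim (x + 2^-1) - zprim (x - 2^-1)).

Lemma smooth1_hat : smooth1 hat.
Proof.
have smooth_shift c : smooth1 (fun x => zprim (x + c)).
  apply: (@smooth1_comp _ zprim (fun x => x + c)); first exact: smooth1_zprim.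
  by apply: smooth1D (smooth1_cst _); exact: smooth1_id.
apply: smooth1M (smooth1_cst _) _; apply: smooth1B; exact: smooth_shift.
Qed.

Lemma hat_out x : 1 <= `|x| -> hat x = 0.
Proof.
rewrite ler_normr /hat => /orP[x1|x1].
  by rewrite !zprim_ge; [rewrite subrr mulr0|lra..].
by rewrite !zprim_le; [rewrite subrr mulr0|lra..].
Qed.

(** Two consecutive translates telescope: the inner values of [zprim] cancel, and the outer ones are
    [zeta_mass] and 0. *)
Lemma hat_sum x : 0 <= x <= 1 -> hat x + hat (x - 1) = 1.
Proof.
move=> /andP[x0 x1]; rewrite /hat -mulrDr (@zprim_ge (x + 2^-1)); last lra.
rewrite (@zprim_le (x - 1 - 2^-1)); last lra.
rewrite (_ : x - 1 + 2^-1 = x - 2^-1); last lra.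
rewrite subr0 subrK mulVf// gt_eqF//; exact: zeta_mass_gt0.
Qed.

Lemma zprimB (x y : R) : x < y -> exists2 c, zprim y - zprim x = prof c * (y - x) & 0 <= prof c.
Proof.
move=> xy; have [||c _ ->] := @MVT R zprim prof x y xy.
- by move=> z _; exact: is_derive_zprim.
- apply: continuous_subspaceT => z; exact/smooth1_continuous/smooth1_zprim.
by exists c => //; exact: zeta_profile_ge0.
Qed.

Lemma hat_ge0 x : 0 <= hat x.
Proof.
rewrite /hat mulr_ge0//; first by rewrite invr_ge0 ltW// zeta_mass_gt0.
have [|c -> c0] := @zprimB (x - 2^-1) (x + 2^-1); first lra.
by rewrite mulr_ge0//; lra.
Qed.

Lemma hat_le1 x : hat x <= 1.
Proof.
have [x1|x1] := leP 1 `|x|; first by rewrite hat_out.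
have [x0|x0] := leP 0 x.
  rewrite -(@hat_sum x); first by rewrite lerDl hat_ge0.
  by rewrite x0/= ltW// (le_lt_trans (ler_norm _) x1).
rewrite -(@hat_sum (x + 1)) ?addrK; first by rewrite lerDr hat_ge0.
by move: x1; rewrite ltr_norml => /andP[x1 _]; apply/andP; split; lra.
Qed.

(** Fundamental theorem of calculus: the two values of [zprim] in [hat] come from the two ends of
    the core. *)
Lemma integral_zeta_core (s c x : R) : 0 < s ->
  (\int[mu]_y (\1_(`](c - 2^-1) * s, (c + 2^-1) * s[%classic) y *
     (s^-1 * zeta ((x - y) / s)))%:E = (hat (x / s - c))%:E)%E.
Proof.
move=> s0; set a := (c - 2^-1) * s; set b := (c + 2^-1) * s.
have ab : a < b by rewrite ltr_pM2r//; lra.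
pose f (y : R) : R := s^-1 * zeta ((x - y) / s).
(* The kernel is evaluated at [(x - y) / s], decreasing in [y]; hence the minus sign, while the
   chain rule supplies the factor [s^-1]. *)
pose F (y : R) : R := - (@zeta_mass R)^-1 * zprim (y * (- s^-1) + x / s).
have dF (y : R) : is_derive y 1 F (f y).
  have d1 : is_derive y 1 (fun y : R => y * (- s^-1) + x / s) (- s^-1).
    have h := is_deriveD (is_deriveM (is_derive_id y (1 : R)) (is_derive_cst (- s^-1) y 1))
      (is_derive_cst (x / s) y 1).
    apply: is_derive_eq h _.
    by rewrite scaler0 add0r addr0 [_ *: _]mulr1.
  have d2 := @is_derive1_comp _ zprim (fun y : R => y * (- s^-1) + x / s) y _ _ (is_derive_zprim (y * (- s^-1) + x / s)) d1.
  have d3 := is_deriveM (is_derive_cst (- (@zeta_mass R)^-1) y (1:R)) d2.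
  apply: is_derive_eq d3 _.
  rewrite scaler0 addr0 /f /zeta /GRing.scale/=.
  have -> : (x - y) / s = y * - s^-1 + x / s by ring.
  by ring.
have cf : continuous f.
  apply: smooth1_continuous; apply: smooth1M; first exact: smooth1_cst.
  have := smooth1_comp (@smooth1_zeta R) (smooth1_affine (- s^-1) (x / s)).
  by congr smooth1; apply/funext => y; congr zeta; ring.
have -> : (\int[mu]_y (\1_(`]a, b[%classic) y * f y)%:E =
    \int[mu]_(y in `[a, b]) (f y)%:E)%E.
  rewrite [RHS]integral_itv_bndoo; last first.
    apply/measurable_EFinP.
    apply: measurable_funS (continuous_measurableT cf) => //.
  rewrite [RHS]integral_mkcond; apply: eq_integral => y _.
  rewrite patchE indicE /=; case: ifPn => _; first by rewrite mul1r.
  by rewrite mul0r.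
have cF : continuous F.
  move=> y; apply/differentiable_continuous/derivable1_diffP.
  by have := dF y; case.
rewrite (@continuous_FTC2 _ f F)//.
- rewrite -EFinB /F /hat; congr EFin.
  have -> : b * - s^-1 + x / s = x / s - c - 2^-1.
    by rewrite /b mulrN -mulrA divff ?gt_eqF// mulr1; ring.
  have -> : a * - s^-1 + x / s = x / s - c + 2^-1.
    by rewrite /a mulrN -mulrA divff ?gt_eqF// mulr1; ring.
  by ring.
- exact: continuous_subspaceT.
- split => [y _||]; first by have := dF y; case.
    by apply: cvg_at_right_filter; exact: cF.
  by apply: cvg_at_left_filter; exact: cF.
- by move=> y _; rewrite derive1E derive_val.
Qed.

End mollifier_primitive.

(** * Lebesgue measure of boxes *)

Section rV_measure.
Variables (R : realType) (n : nat).
Local Notation rV := 'rV[R]_n.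
Local Notation leb := (lebesgue_rV R n).

Definition obox (a b : 'I_n -> R) : set rV :=
  [set x | forall l, a l < x ord0 l < b l].

Lemma measurable_obox a b : measurable (obox a b).
Proof.
have := @measurable_box R n (fun l => `]a l, b l[%classic).
rewrite (_ : obox a b = [set x : rV | forall l, `]a l, b l[%classic (x ord0 l)]).
  by apply => l; exact: measurable_itv.
by apply/seteqP; split => x /= h l; have := h l; rewrite in_itv.
Qed.

Lemma leb_obox a b : (forall l, a l <= b l) ->
  leb (obox a b) = (\prod_l (b l - a l))%:E.
Proof.
move=> ab.
rewrite (_ : obox a b = [set x : rV | forall l, `]a l, b l[%classic (x ord0 l)]); last first.
  by apply/seteqP; split => x /= h l; have := h l; rewrite in_itv.
rewrite (@lebesgue_rV_box R n (fun l => `]a l, b l[%classic)) => [|l]; last exact: measurable_itv.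
rewrite -prodEFin; apply: eq_bigr => l _.
rewrite lebesgue_measure_itv/= lte_fin; case: ltP => // ba.
by rewrite (_ : b l = a l) ?subrr//; apply/le_anti; rewrite ba ab.
Qed.

Lemma obox_empty a b l : b l <= a l -> obox a b = set0.
Proof.
move=> ba; apply/seteqP; split => // x /(_ l) /andP[ax xb].
by have := lt_trans ax xb; rewrite ltNge ba.
Qed.

Lemma leb_obox_fin a b : (leb (obox a b) < +oo)%E.
Proof.
have [ab|] := pselect (forall l, a l <= b l); first by rewrite leb_obox ?ltry.
move/existsNP => [l /negP]; rewrite -ltNge => ba.
by rewrite (@obox_empty a b l) ?measure0 ?ltry// ltW.
Qed.

Lemma setI_obox a b a' b' : obox a b `&` obox a' b' =
  obox (fun l => Num.max (a l) (a' l)) (fun l => Num.min (b l) (b' l)).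
Proof.
apply/seteqP; split => x /=.
  move=> [h h'] l; have := h l; have := h' l.
  by rewrite gt_max lt_min => /andP[-> ->] /andP[-> ->].
move=> h; split => l; have := h l; rewrite gt_max lt_min.
  by move=> /andP[/andP[-> _] /andP[-> _]].
by move=> /andP[/andP[_ ->] /andP[_ ->]].
Qed.

Lemma bigcup_obox : \bigcup_k obox (fun=> - k%:R) (fun=> k%:R) = setT.
Proof.
rewrite -subTset => x _.
pose M := \sum_l `|x ord0 l|.
exists (Num.truncn M).+1 => // l; rewrite -ltr_norml.
apply: (@le_lt_trans _ _ M); last exact: truncnS_gt.
by rewrite /M (bigD1 l)//= lerDl sumr_ge0.
Qed.

Definition oboxes : set (set rV) := [set A | exists a b, A = obox a b].

(** Boxes are stable under intersection and generate the sigma-algebra, as the uniqueness theorem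
    for measures asks. *)
Lemma measurable_rVE : @measurable _ rV = <<s oboxes >>.
Proof.
apply/seteqP; split => A.
  apply: smallest_sub A; first exact: smallest_sigma_algebra.
  move=> A; rewrite -bigcup_seq/= => -[i _ [C mC <-]]; rewrite setTI.
  have mCo : (@RGenOpens.G R).-sigma.-measurable C.
    by rewrite -RGenOpens.measurableE.
  suff : <<s @RGenOpens.G R >> `<=`
      [set B | <<s oboxes >> ((fun x : rV => x ord0 i) @^-1` B)] by exact.
  apply: smallest_sub => [|B [x [y ->]]].
    split => /=.
    - by rewrite preimage_set0; exact: sigma_algebra0.
    - move=> B mB; rewrite setTD preimage_setC -setTD; exact: sigma_algebraCD.
    - by move=> F mF; rewrite preimage_bigcup; exact: sigma_algebra_bigcup.
  (* The cylinder over []x, y[] is exhausted by boxes bounded by [k] in the other directions. *)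
  rewrite /= (_ : _ @^-1` _ = \bigcup_k
     obox (fun l => if l == i then x else - k%:R) (fun l => if l == i then y else k%:R)).
    by apply: sigma_algebra_bigcup => k; apply: sub_sigma_algebra; eexists; eexists.
  apply/seteqP; split => z /=.
    rewrite in_itv/= => xzy.
    have [k _ hk] : (\bigcup_k obox (fun=> - k%:R) (fun=> k%:R)) z by rewrite bigcup_obox.
    by exists k => // l /=; case: eqP => [->//|_]; exact: hk.
  by move=> [k _ /(_ i)]; rewrite eqxx in_itv.
apply: smallest_sub A; first exact: sigma_algebra_measurable.
by move=> _ [a [b ->]]; exact: measurable_obox.
Qed.

Lemma rV_measure_unique (m1 m2 : {measure set rV -> \bar R}) :
  (forall a b, m1 (obox a b) = m2 (obox a b)) ->
  (forall a b, (m1 (obox a b) < +oo)%E) ->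
  forall A, measurable A -> m1 A = m2 A.
Proof.
move=> m12 m1oo; apply: (measure_unique oboxes
  (fun k => obox (fun=> - k%:R) (fun=> k%:R))).
- exact: measurable_rVE.
- by move=> _ _ [a [b ->]] [a' [b' ->]]; rewrite setI_obox; eexists; eexists.
- by move=> k; eexists; eexists.
- exact: bigcup_obox.
- by move=> _ [a [b ->]].
- by move=> k; exact: m1oo.
Qed.

(** The norm on row vectors is the maximum norm. *)
Lemma ball_obox (x : rV) e : 0 < e ->
  ball x e = obox (fun l => x ord0 l - e) (fun l => x ord0 l + e).
Proof.
move=> e0; apply/seteqP; split => y /=.
  move=> [_ h] l; have := h ord0 l; rewrite /ball/=.
  by rewrite ltr_norml => /andP[h1 h2]; apply/andP; split; lra.
move=> h; split => // i l; have /andP[h1 h2] := h l; rewrite /ball/= ord1.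
by rewrite ltr_norml; apply/andP; split; lra.
Qed.

Lemma open_obox_nbhs (O : set rV) x : open O -> O x ->
  exists2 e : R, 0 < e & obox (fun l => x ord0 l - e) (fun l => x ord0 l + e) `<=` O.
Proof.
move=> oO Ox; have : nbhs x O by apply: open_nbhs_nbhs.
move=> /nbhs_ballP[e /= e0 xeO]; exists e => //.
by rewrite -ball_obox.
Qed.

Lemma obox_open a b : open (obox a b).
Proof.
rewrite openE => x xab.
pose e := \big[Num.min/1]_l (Num.min (x ord0 l - a l) (b l - x ord0 l)).
have e0 : 0 < e.
  rewrite /e; elim/big_ind : _ => // [u v u0 v0|l _].
    by rewrite lt_min u0.
  by have /andP[h1 h2] := xab l; rewrite lt_min !subr_gt0 h1.
have el l : e <= Num.min (x ord0 l - a l) (b l - x ord0 l).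
  by rewrite /e (bigD1 l)//= ge_min lexx.
apply/nbhs_ballP; exists e => //=; rewrite ball_obox// => y /= h l.
have := el l; rewrite le_min => /andP[h1 h2].
by have /andP[h3 h4] := h l; apply/andP; split; lra.
Qed.

(** Boxes with rational center and radius suffice. Their closed hulls are kept inside [O] so that
    smooth bumps supported there are test functions on [O]. *)
Lemma open_bigcup_obox (O : set rV) : open O ->
  exists (D : set nat) (a b : nat -> 'I_n -> R),
    (forall k, D k -> [set x : rV | forall l, a k l <= x ord0 l <= b k l] `<=` O) /\
    O = \bigcup_(k in D) obox (a k) (b k).
Proof.
move=> oO.
pose q k := odflt (0, 0) (unpickle k : option ('rV[rat]_n * rat)).
pose a k l : R := ratr ((q k).1 ord0 l) - ratr (q k).2.
pose b k l : R := ratr ((q k).1 ord0 l) + ratr (q k).2.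
exists [set k | [set x : rV | forall l, a k l <= x ord0 l <= b k l] `<=` O], a, b.
split => //; apply/seteqP; split; last first.
  by move=> x [k /= kO xk]; apply: kO => l; have /andP[/ltW -> /ltW ->] := xk l.
move=> x Ox; have [e e0 eO] := open_obox_nbhs oO Ox.
(* A radius between [e/4] and [e/2] and a center within [e/4] of [x] give a box that contains [x]
   and whose hull stays within [e] of it. *)
have [r re] : exists r : rat, e / 4 < ratr r < e / 2.
  by apply/rat_in_itvoo; lra.
have /andP[r1 r2] := re.
have hc l : exists p : rat, x ord0 l - e / 4 < ratr p < x ord0 l + e / 4.
  by apply/rat_in_itvoo; lra.
pose c : 'rV[rat]_n := \row_l xchoose (hc l).
have cP l : x ord0 l - e / 4 < ratr (c ord0 l) < x ord0 l + e / 4.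
  by rewrite mxE; exact: (xchooseP (hc l)).
exists (pickle (c, r)); rewrite /= /a /b /q pickleK/=.
  move=> y yh; apply: eO => l; have /andP[c1 c2] := cP l.
  by have /andP[y1 y2] := yh l; apply/andP; split; lra.
by move=> l; have /andP[c1 c2] := cP l; apply/andP; split; lra.
Qed.

Lemma open_measurable_rV (O : set rV) : open O -> measurable O.
Proof.
move=> /open_bigcup_obox[D [a [b [_ ->]]]].
by apply: bigcup_measurable => k _; exact: measurable_obox.
Qed.

Definition rescale (s : R) (t : rV) (x : rV) : rV := s *: (x + t).

Lemma rescale_obox s t a b : 0 < s -> rescale s t @^-1` obox a b =
  obox (fun l => a l / s - t ord0 l) (fun l => b l / s - t ord0 l).
Proof.
move=> s0; apply/seteqP; split => x /= h l; have := h l; rewrite /rescale !mxE.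
  by rewrite ltrBlDr ltrBrDr ltr_pdivrMr// ltr_pdivlMr// mulrC.
by rewrite ltrBlDr ltrBrDr ltr_pdivrMr// ltr_pdivlMr// mulrC.
Qed.

Lemma measurable_rescale s t : measurable_fun setT (rescale s t).
Proof.
apply: measurable_fun_rV => l.
rewrite (_ : (fun _ => _) = (fun r : measurableTypeR R => (s * (r + t ord0 l) : measurableTypeR R))
  \o (fun x : rV => x ord0 l : measurableTypeR R)).
  apply: measurableT_comp (@measurable_coord R n l).
  apply: continuous_measurableT => r.
  apply: (@cvgM R); first exact: cvg_cst.
  by apply: cvgD; [exact: cvg_id|exact: cvg_cst].
by apply/funext => x; rewrite /rescale !mxE.
Qed.

(** Affine change of variables by uniqueness of measures: [leb] and [s ^+ n] times its image under
    [rescale s t] agree on boxes. *)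
Lemma ge0_integral_rescale s t A (f : rV -> \bar R) : 0 < s ->
  measurable A -> measurable_fun A f -> (forall x, A x -> 0 <= f x)%E ->
  (\int[leb]_(x in A) f x =
   (s ^+ n)%:E * \int[leb]_(x in rescale s t @^-1` A) f (rescale s t x))%E.
Proof.
move=> s0 mA mf f0.
have sn0 : 0 <= s ^+ n by rewrite exprn_ge0// ltW.
pose k : {nonneg R} := NngNum sn0.
unshelve epose (m := pushforward leb (rescale s t) : {measure set rV -> \bar R}).
  exact: measurable_rescale.
have lebE B : measurable B -> leb B = mscale k m B.
  apply: rV_measure_unique => a b; last exact: leb_obox_fin.
  change (leb (obox a b) = (s ^+ n)%:E * leb (rescale s t @^-1` obox a b))%E.
  rewrite rescale_obox//.
  have [ab|] := pselect (forall l, a l <= b l); last first.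
    move/existsNP => [l /negP]; rewrite -ltNge => ba.
    rewrite (@obox_empty a b l); last exact: ltW.
    rewrite (@obox_empty _ _ l) ?measure0 ?mule0//.
    by rewrite lerD2r ler_pM2r ?invr_gt0// ltW.
  rewrite !leb_obox// => [|l]; last by rewrite lerD2r ler_pM2r ?invr_gt0.
  rewrite -EFinM -[X in s ^+ X]card_ord -prodr_const -big_split/=.
  congr EFin; apply: eq_bigr => l _; field; exact: lt0r_neq0.
transitivity (\int[mscale k m]_(x in A) f x)%E.
  by apply: eq_measure_integral => B mB _; exact: lebE.
rewrite ge0_integral_mscale//= ge0_integral_pushforward//.
  exact: measurable_rescale.
by move=> x /[!inE]; exact: f0.
Qed.

End rV_measure.

Section tensor_integral.
Variable R : realType.
Local Notation mu := (@lebesgue_measure R).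

(** Tonelli's theorem, by induction along the recursive construction of the measure. *)
Lemma integral_tensor n (f : 'I_n -> R -> R) :
  (forall l, measurable_fun [set: measurableTypeR R] (f l : measurableTypeR R -> measurableTypeR R)) -> (forall l t, 0 <= f l t) ->
  (\int[lebesgue_rV R n]_x (\prod_l f l (x ord0 l))%:E =
   \prod_(l < n) \int[mu]_t (f l t)%:E)%E.
Proof.
move=> mf f0.
have mprod k (g : 'I_k -> R -> R) :
    (forall l, measurable_fun [set: measurableTypeR R] (g l : measurableTypeR R -> measurableTypeR R)) ->
    measurable_fun [set: 'rV[R]_k] (fun x : 'rV[R]_k => \prod_l g l (x ord0 l)).
  move=> mg; apply: measurable_prod => l _.
  exact: measurableT_comp (mg l) (@measurable_coord R k l).
elim: n f mf f0 => [|n IH] f mf f0.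
  rewrite [RHS]big_ord0 /= integral_dirac//; last first.
    by apply/measurable_EFinP; exact: mprod.
  by rewrite diracT mul1e big_ord0.
pose F (x : 'rV[R]_n.+1) := (\prod_(l < n.+1) f l (x ord0 l))%:E.
have mF : measurable_fun setT F by apply/measurable_EFinP; exact: mprod.
have F0 x : (0 <= F x)%E by rewrite lee_fin prodr_ge0.
have FE a x : F (rV_cons (a, x)) =
    ((f ord0 a)%:E * (\prod_(l < n) f (lift ord0 l) (x ord0 l))%:E)%E.
  rewrite /F big_ord_recl EFinM; congr (_%:E * _%:E)%E.
    by rewrite mxE unlift_none.
  by apply: eq_bigr => l _; rewrite mxE liftK.
unshelve epose (m := pushforward (mu \x lebesgue_rV R n)%E (@rV_cons R n)
  : {measure set 'rV[R]_n.+1 -> \bar R}); first exact: measurable_rV_cons.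
transitivity (\int[m]_x F x)%E; first exact: eq_measure_integral.
rewrite ge0_integral_pushforward//; last exact: measurable_rV_cons.
rewrite preimage_setT fubini_tonelli1//; last first.
- by move=> x; exact: F0.
- by apply: measurableT_comp mF _; exact: measurable_rV_cons.
rewrite /fubini_F big_ord_recl -IH//.
pose G := (\int[lebesgue_rV R n]_x (\prod_(l < n) f (lift ord0 l) (x ord0 l))%:E)%E.
have inner a : (\int[lebesgue_rV R n]_x F (rV_cons (a, x)) = (f ord0 a)%:E * G)%E.
  under eq_integral do rewrite FE.
  apply: ge0_integralZl => //.
  - apply/measurable_EFinP; apply: (mprod _ (fun l => f (lift ord0 l))) => l.
    exact: mf.
  - by move=> x _; rewrite lee_fin prodr_ge0.
  - by rewrite lee_fin.
under eq_integral do rewrite /= inner.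
rewrite /= ge0_integralZr//.
- by apply/measurable_EFinP; exact: mf.
- by move=> x _; rewrite lee_fin.
- by apply: integral_ge0 => x _; rewrite lee_fin prodr_ge0.
Qed.

End tensor_integral.

(** * The partition of unity as a product over coordinates *)

Section phi_product.
Variables (R : realType) (d : nat) (sigma : R).
Hypothesis sigma_gt0 : 0 < sigma.

(** The indicator of the core and the kernel are both products over coordinates, so the convolution
    factors into one-dimensional ones. *)
Lemma phiE (i : 'rV[int]_d) (x : 'rV[R]_d) :
  phi sigma i x = \prod_l hat (x ord0 l / sigma - (i ord0 l)%:~R).
Proof.
pose c l : R := (i ord0 l)%:~R.
pose f l (y : R) : R := \1_(`](c l - 2^-1) * sigma, (c l + 2^-1) * sigma[%classic) y *
     (sigma^-1 * zeta ((x ord0 l - y) / sigma)).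
have mf l : measurable_fun [set: measurableTypeR R] (f l : measurableTypeR R -> measurableTypeR R).
  apply: measurable_funM; first exact: measurable_indic.
  apply: continuous_measurableT; apply: smooth1_continuous.
  apply: smooth1M; first exact: smooth1_cst.
  have := smooth1_comp (@smooth1_zeta R) (smooth1_affine (- sigma^-1) (x ord0 l / sigma)).
  by congr smooth1; apply/funext => y; congr zeta; ring.
have f0 l t : 0 <= f l t.
  rewrite /f mulr_ge0// mulr_ge0 ?invr_ge0 ?(ltW sigma_gt0)//.
  by rewrite /zeta mulr_ge0 ?zeta_profile_ge0// invr_ge0 ltW ?zeta_mass_gt0.
rewrite /phi /Rintegral.
under eq_integral => y _.
  rewrite (_ : _ * _ = \prod_l f l (y ord0 l)); last first.
    rewrite /f big_split/= big_split/= prodr_const card_ord exprVn.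
    congr (_ * (_ * _)); last by apply: eq_bigr => l _; rewrite !mxE.
    rewrite indicE; case: (boolP (y \in core sigma i)) => [|/negP yi].
      rewrite inE => yi; rewrite big1// => l _.
      by rewrite indicE mem_set//= in_itv/=; exact: yi.
    have [l yl] : exists l, ~ ((i ord0 l)%:~R - 2^-1) * sigma < y ord0 l < ((i ord0 l)%:~R + 2^-1) * sigma.
      by apply/existsNP => h; apply: yi; rewrite inE.
    by rewrite (bigD1 l)//= indicE memNset ?mul0r//= in_itv.
  over.
rewrite integral_tensor//.
rewrite (eq_bigr (fun l => (hat (x ord0 l / sigma - c l))%:E)) => [|l _]; last first.
  exact: integral_zeta_core.
by rewrite prodEFin.
Qed.

End phi_product.

Section grid_ae.
Variables (R : realType) (d : nat) (sigma : R).
Hypothesis sigma_gt0 : 0 < sigma.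
Local Notation leb := (lebesgue_rV R d).

Lemma hyperplane_negligible (l : 'I_d) (c : R) :
  leb.-negligible [set x : 'rV[R]_d | x ord0 l = c].
Proof.
have mA k : measurable (if k == l then [set c] else setT : set (measurableTypeR R)).
  by case: ifP => _ //; exact: measurable_set1.
have E : [set x : 'rV[R]_d | x ord0 l = c] =
    [set x | forall k, (if k == l then [set c] else setT) (x ord0 k)].
  apply/seteqP; split => x /=; last by move=> /(_ l); rewrite eqxx.
  by move=> xl k; case: ifPn => [/eqP ->|].
exists [set x : 'rV[R]_d | x ord0 l = c]; split => //.
  by rewrite E; exact: (@measurable_box R d (fun k => if k == l then [set c] else setT)).
rewrite E (@lebesgue_rV_box R d (fun k => if k == l then [set c] else setT))//.
by rewrite (bigD1 l)//= eqxx lebesgue_measure_set1 mul0e.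
Qed.

(** The exceptional points lie on countably many hyperplanes; elsewhere the floor of [x / sigma] is
    the index. *)
Lemma ae_element : {ae leb, forall x, exists i, element sigma i x}.
Proof.
pose H n : set 'rV[R]_d := if unpickle n is Some (l, k) then
  [set x : 'rV[R]_d | x ord0 (l : 'I_d) = (k : int)%:~R * sigma] else set0.
have : leb.-negligible (\bigcup_n H n).
  apply: negligible_bigcup => n; rewrite /H.
  case: unpickle => [[l k]|]; last exact: negligible_set0.
  exact: hyperplane_negligible.
apply: negligibleS => x /= nx; apply: contrapT => nH; apply: nx.
exists (\row_l Num.floor (x ord0 l / sigma)) => l; rewrite mxE.
have /andP[h1 h2] := floor_itv (x ord0 l / sigma).
rewrite ler_pdivlMr// in h1; rewrite ltr_pdivrMr// intrD in h2.
rewrite h2 andbT lt_neqAle h1 andbT; apply/eqP => h3; apply: nH.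
by exists (pickle (l, Num.floor (x ord0 l / sigma))) => //; rewrite /H pickleK/=.
Qed.

End grid_ae.

(** * Sums of tensor products *)

Section derive1n_affine.
Variable R : realType.

Lemma derive1n_affine (n : nat) (f : R -> R) (a c : R) : smooth1 f ->
  derive1n n (fun t => f (t * a + c)) =
  fun t => a ^+ n * derive1n n f (t * a + c).
Proof.
move=> sf; elim: n => [|n IH]; first by apply/funext => t; rewrite expr0 mul1r.
rewrite /derive1n iterS -/(derive1n n _) IH; apply/funext => t.
rewrite derive1E; have d1 : is_derive t 1 (fun t : R => t * a + c) a.
  have h := is_deriveD (is_deriveM (is_derive_id t (1 : R)) (is_derive_cst a t 1))
    (is_derive_cst c t 1).
  by apply: is_derive_eq h _; rewrite scaler0 add0r addr0 [_ *: _]mulr1.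
have d2 := @is_derive1_comp _ (derive1n n f) (fun t : R => t * a + c) t _ _
  (smooth1_is_derive _ (smooth1_derive1n n sf)) d1.
have d3 := is_deriveM (is_derive_cst (a ^+ n) t (1 : R)) d2.
rewrite (@derive_val _ _ _ _ _ _ _ d3) scaler0 addr0 exprS /GRing.scale/=.
by ring.
Qed.

End derive1n_affine.

Section tensor_sums.
Variables (R : realType) (d : nat).
Local Notation rV := 'rV[R]_d.
Local Notation leb := (lebesgue_rV R d).

Definition tens (h : 'I_d -> R -> R) (x : rV) : R := \prod_l h l (x ord0 l).

(** All discrete functions have this form with smooth factors. The class is stable under partial
    derivatives, which act on the factors, so that [mderiv] becomes explicit. *)
Definition tsum (X : finType) (c : X -> R) (h : X -> 'I_d -> R -> R) (x : rV) : R :=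
  \sum_s c s * tens (h s) x.

Lemma is_derive_line (f : rV -> R) (a v : rV) (g : R -> R) (df : R) :
  (forall t, f (t *: v + a) = g t) -> is_derive (0 : R) 1 g df -> is_derive a v f df.
Proof.
move=> fg [dg gE].
have E : (fun h : R => h^-1 *: ((f \o shift a) (h *: v) - f a)) =
         (fun h : R => h^-1 *: ((g \o shift 0) (h *: (1 : R)) - g 0)).
  apply/funext => h; congr (_ *: (_ - _)).
    by rewrite /= fg addr0 [h *: _]mulr1.
  by rewrite -fg scale0r add0r.
by split; [rewrite /derivable E|rewrite /derive E].
Qed.

Lemma is_derive_tens (h : 'I_d -> R -> R) l x : (forall k, smooth1 (h k)) ->
  is_derive x (delta_mx ord0 l) (tens h)
    (tens (fun k => if k == l then derive1 (h k) else h k) x).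
Proof.
move=> sh; pose C := \prod_(k | k != l) h k (x ord0 k).
apply: (@is_derive_line _ _ _ (fun t => C * h l (t * 1 + x ord0 l))).
  move=> t; rewrite /tens (bigD1 l)//= mulrC; congr (_ * _).
    apply: eq_bigr => k kl; rewrite !mxE eqxx/=.
    by rewrite (negbTE kl) mulr0 add0r.
  by rewrite !mxE !eqxx.
have sg : smooth1 (fun t => h l (t * 1 + x ord0 l)).
  by apply: smooth1_comp (smooth1_affine _ _).
have := is_deriveM (is_derive_cst C (0 : R) 1) (smooth1_is_derive 0 sg).
move=> /is_derive_eq; apply.
have -> : derive1 (fun t => h l (t * 1 + x ord0 l)) 0 = derive1 (h l) (x ord0 l).
  have := derive1n_affine 1 1 (x ord0 l) (sh l).
  move=> /(congr1 (fun f => f 0)); rewrite /derive1n/= => ->.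
  by rewrite expr1n mul1r mul0r add0r.
rewrite scaler0 addr0 /tens (bigD1 l)//= eqxx mulrC [RHS]mulrC /GRing.scale/= mulrC.
by congr (_ * _); apply: eq_bigr => k /negbTE ->.
Qed.

Lemma pderiv_tsum (X : finType) c (h : X -> 'I_d -> R -> R) l :
  (forall s k, smooth1 (h s k)) ->
  pderiv l (tsum c h) =
  tsum c (fun s k => if k == l then derive1 (h s k) else h s k).
Proof.
move=> sh; apply/funext => x; rewrite /pderiv.
have E : tsum c h = \sum_(i < #|X|) (fun y => c (enum_val i) * tens (h (enum_val i)) y).
  apply/funext => y; rewrite fct_sumE /tsum (reindex_omap enum_val (fun s => Some (enum_rank s)))/=.
    by apply: eq_bigl => i; rewrite enum_valK eqxx.
  by move=> s _; rewrite enum_rankK.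
have dE (i : 'I_#|X|) : is_derive x (delta_mx ord0 l) (fun y => c (enum_val i) * tens (h (enum_val i)) y)
   (c (enum_val i) * tens (fun k => if k == l then derive1 (h (enum_val i) k) else h (enum_val i) k) x).
  have := is_deriveM (is_derive_cst (c (enum_val i)) x (delta_mx ord0 l))
    (is_derive_tens l x (sh (enum_val i))).
  by move=> /is_derive_eq; apply; rewrite scaler0 addr0.
rewrite E (@derive_val _ _ _ _ _ _ _ (is_derive_sum dE)).
rewrite /tsum [RHS](reindex_omap enum_val (fun s => Some (enum_rank s)))/=.
  by apply: eq_bigl => i; rewrite enum_valK eqxx.
by move=> s _; rewrite enum_rankK.
Qed.

Lemma iter_pderiv_tsum (X : finType) c (h : X -> 'I_d -> R -> R) l n :
  (forall s k, smooth1 (h s k)) ->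
  iter n (pderiv l) (tsum c h) =
  tsum c (fun s k => if k == l then derive1n n (h s k) else h s k).
Proof.
move=> sh; elim: n => [|n IH].
  by congr tsum; apply/funext => s; apply/funext => k; case: (k == l).
rewrite iterS IH pderiv_tsum => [|s k].
  by congr tsum; apply/funext => s; apply/funext => k; case: (k == l).
by case: ifP => // _; exact: smooth1_derive1n.
Qed.

Lemma mderiv_tsum (X : finType) c (h : X -> 'I_d -> R -> R) (a : 'I_d -> nat) :
  (forall s k, smooth1 (h s k)) ->
  mderiv a (tsum c h) = tsum c (fun s k => derive1n (a k) (h s k)).
Proof.
move=> sh.
have : uniq (enum 'I_d) by exact: enum_uniq.
rewrite /mderiv; have -> : tsum c (fun s k => derive1n (a k) (h s k)) =
    tsum c (fun s k => if k \in enum 'I_d then derive1n (a k) (h s k) else h s k).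
  by congr tsum; apply/funext => s; apply/funext => k; rewrite mem_enum.
elim: (enum 'I_d) => [|l t IH] //= /andP[lt ut].
rewrite IH// iter_pderiv_tsum => [|s k]; last first.
  by case: ifP => // _; exact: smooth1_derive1n.
congr tsum; apply/funext => s; apply/funext => k; rewrite in_cons.
by case: eqP => [->|//]; rewrite (negbTE lt).
Qed.

Lemma differentiable_tens (h : 'I_d -> R -> R) x : (forall k, smooth1 (h k)) ->
  differentiable (tens h) x.
Proof.
move=> sh; rewrite (_ : tens h = \prod_l (fun x : rV => h l (x ord0 l))); last first.
  by apply/funext => y; rewrite fct_prodE.
elim/big_ind : _ => [|f g df dg|l _]; first exact: differentiable_cst.
  exact: differentiableM.
apply: (@differentiable_comp _ _ _ _ (fun x : rV => x ord0 l) (h l)).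
  exact: differentiable_coord.
exact/derivable1_diffP/smooth1_derivable.
Qed.

Lemma smooth_tsum (X : finType) c (h : X -> 'I_d -> R -> R) :
  (forall s k, smooth1 (h s k)) -> smooth (tsum c h).
Proof.
move=> sh s x.
have [h' sh' ->] : exists2 h' : X -> 'I_d -> R -> R, (forall s k, smooth1 (h' s k)) &
    foldr (@pderiv R d) (tsum c h) s = tsum c h'.
  elim: s => [|l s [h' sh' IH]]; first by exists h.
  rewrite /= IH pderiv_tsum//; eexists; last reflexivity.
  by move=> t k /=; case: ifP => // _; exact: smooth1_derive1.
rewrite (_ : tsum c h' = \sum_s (fun x => c s * tens (h' s) x)); last first.
  by apply/funext => y; rewrite fct_sumE.
elim/big_ind : _ => [|f g df dg|l _]; first exact: differentiable_cst.
  exact: differentiableD.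
by apply: differentiableM; [exact: differentiable_cst|exact: differentiable_tens].
Qed.

Lemma pderiv_local (O : set rV) l (f g : rV -> R) : open O ->
  (forall x, O x -> f x = g x) -> forall x, O x -> pderiv l f x = pderiv l g x.
Proof.
move=> oO fg x Ox; apply: near_eq_derive.
by near=> y; apply: fg; near: y; apply: open_nbhs_nbhs.
Unshelve. all: by end_near. Qed.

Lemma mderiv_local (O : set rV) a (f g : rV -> R) : open O ->
  (forall x, O x -> f x = g x) -> forall x, O x -> mderiv a f x = mderiv a g x.
Proof.
move=> oO; rewrite /mderiv; elim: (enum 'I_d) => [//|l s IH] fg /=.
elim: (a l) => [|n IHn]; first exact: IH.
by rewrite !iterS; apply: pderiv_local.
Qed.

Lemma mderiv0 (a : 'I_d -> nat) (f : rV -> R) : (forall l, a l = 0%N) -> mderiv a f = f.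
Proof.
by move=> a0; rewrite /mderiv; elim: (enum 'I_d) => [//|l s IH] /=; rewrite IH a0.
Qed.

(** Unlike integrability this is stable under products, and it implies integrability on sets of
    finite measure. *)
Definition bmeas (S : set rV) (f : rV -> R) :=
  measurable_fun S f /\ exists B, forall x, S x -> `|f x| <= B.

Lemma bmeas_cst S c : bmeas S (fun=> c).
Proof. by split; [exact: measurable_cst|exists `|c|]. Qed.

Lemma bmeasD S f g : bmeas S f -> bmeas S g -> bmeas S (fun x => f x + g x).
Proof.
move=> [mf [B fB]] [mg [C gC]]; split; first exact: measurable_funD.
by exists (B + C) => x Sx; rewrite (le_trans (ler_normD _ _))// lerD ?fB ?gC.
Qed.

Lemma bmeasM S f g : bmeas S f -> bmeas S g -> bmeas S (fun x => f x * g x).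
Proof.
move=> [mf [B fB]] [mg [C gC]]; split; first exact: measurable_funM.
by exists (B * C) => x Sx; rewrite normrM ler_pM ?fB ?gC.
Qed.

Lemma bmeas_sum S (I : Type) (r : seq I) (P : pred I) (f : I -> rV -> R) :
  (forall i, bmeas S (f i)) -> bmeas S (fun x => \sum_(i <- r | P i) f i x).
Proof.
move=> bf; rewrite (_ : (fun x => _) = \sum_(i <- r | P i) f i); last first.
  by apply/funext => x; rewrite fct_sumE.
by elim/big_ind : _ => // [|u v]; [exact: bmeas_cst|exact: bmeasD].
Qed.

Lemma bmeas_prod S (I : Type) (r : seq I) (P : pred I) (f : I -> rV -> R) :
  (forall i, bmeas S (f i)) -> bmeas S (fun x => \prod_(i <- r | P i) f i x).
Proof.
move=> bf; rewrite (_ : (fun x => _) = \prod_(i <- r | P i) f i); last first.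
  by apply/funext => x; rewrite fct_prodE.
by elim/big_ind : _ => // [|u v]; [exact: bmeas_cst|exact: bmeasM].
Qed.

Lemma bmeas_eq S f g : (forall x, S x -> f x = g x) -> bmeas S f -> bmeas S g.
Proof.
move=> fg [mf [B fB]]; split.
  by apply: eq_measurable_fun mf => x /[!inE]; exact: fg.
by exists B => x Sx; rewrite -fg// fB.
Qed.

Lemma continuous_bounded (f : R -> R) (r : R) : continuous f ->
  exists B, forall t, `|t| <= r -> `|f t| <= B.
Proof.
move=> cf; have [r0|r0] := leP 0 r; last first.
  by exists 0 => t tr; have := lt_le_trans r0 (normr_ge0 t); rewrite ltNge tr.
have [|c _ fc] := @EVT_max R (fun t => `|f t|) (- r) r ltac:(lra).
  apply: continuous_subspaceT => t.
  by apply: cvg_norm; exact: cf.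
by exists `|f c| => t tr; apply: fc; rewrite in_itv/= -ler_norml.
Qed.

Lemma bmeas_tens (S : set rV) (r : R) (h : 'I_d -> R -> R) : (forall l, continuous (h l)) ->
  (forall x, S x -> forall l, `|x ord0 l| <= r) -> bmeas S (tens h).
Proof.
move=> ch Sr; apply: bmeas_prod => l; split.
  have mh := continuous_measurableT (ch l).
  apply: (@measurable_funS _ _ _ _ setT) => //.
  exact: measurableT_comp mh (@measurable_coord R d l).
have [B hB] := continuous_bounded r (ch l).
by exists B => x Sx; apply: hB; exact: Sr.
Qed.

Lemma bmeas_tsum (S : set rV) (r : R) (X : finType) c (h : X -> 'I_d -> R -> R) :
  (forall s l, smooth1 (h s l)) ->
  (forall x, S x -> forall l, `|x ord0 l| <= r) -> bmeas S (tsum c h).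
Proof.
move=> sh Sr; apply: bmeas_sum => s; apply: bmeasM; first exact: bmeas_cst.
by apply: bmeas_tens Sr => l; exact: smooth1_continuous.
Qed.

Lemma bmeas_integrable S f : measurable S -> (leb S < +oo)%E -> bmeas S f ->
  leb.-integrable S (EFin \o f).
Proof.
move=> mS Soo [mf [B fB]]; apply: measurable_bounded_integrable => //.
exists B; split; first exact: num_real.
by move=> M BM x Sx /=; rewrite (le_trans (fB _ Sx))// ltW.
Qed.

End tensor_sums.

(** * Comparison of quadratic forms *)

Section psd_forms.
Variables (R : realType) (V : lmodType R).
Implicit Types B : V -> V -> R.

Definition psd_form B := [/\ forall u v, B u v = B v u,
  forall a u v w, B (a *: u + v) w = a * B u w + B v w &
  forall v, 0 <= B v v].

Lemma psd_null B u v : psd_form B -> B u u = 0 -> B v u = 0.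
Proof.
move=> [sB lB pB] u0; apply/eqP; apply: contrapT => /negP vu.
(* Chosen so that the form takes the value -1. *)
pose t := - (B v v + 1) / (2 * B v u).
have := pB (t *: u + v).
rewrite lB (sB u (_ + _)) lB (sB v (_ + _)) lB u0 (sB u v).
have -> : t * (t * 0 + B v u) + (t * B v u + B v v) = -1.
  rewrite /t; field; exact: vu.
by rewrite ler0N1.
Qed.

Fixpoint in_span (s : seq V) (v : V) : Prop :=
  if s is w :: s' then exists u t, in_span s' u /\ v = t *: w + u else v = 0.

(** By induction along a Gram-Schmidt process for [B1]. *)
Lemma psd_form_le B1 B2 (s : seq V) : psd_form B1 -> psd_form B2 ->
  (forall v, B1 v v = 0 -> B2 v v = 0) ->
  (exists2 C, 0 <= C & forall u, in_span s u -> B2 u u <= C * B1 u u) /\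
  (forall v, exists2 p, in_span s p & forall u, in_span s u -> B1 (v - p) u = 0).
Proof.
move=> psd1 psd2 ker; have [sB1 lB1 pB1] := psd1; have [sB2 lB2 pB2] := psd2.
have D1 u v w : B1 (u + v) w = B1 u w + B1 v w by rewrite -{1}[u]scale1r lB1 mul1r.
have D2 u v w : B2 (u + v) w = B2 u w + B2 v w by rewrite -{1}[u]scale1r lB2 mul1r.
have z1 w : B1 0 w = 0 by have := D1 0 0 w; rewrite addr0; lra.
have z2 w : B2 0 w = 0 by have := D2 0 0 w; rewrite addr0; lra.
have Z1 a u w : B1 (a *: u) w = a * B1 u w by rewrite -[a *: u]addr0 lB1 z1 addr0.
have Z2 a u w : B2 (a *: u) w = a * B2 u w by rewrite -[a *: u]addr0 lB2 z2 addr0.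
have N1 u w : B1 (- u) w = - B1 u w by rewrite -scaleN1r Z1 mulN1r.
have N2 u w : B2 (- u) w = - B2 u w by rewrite -scaleN1r Z2 mulN1r.
elim: s => [|w s [[C C0 hC] proj]].
  split; first by exists 0 => // u ->; rewrite z2 mul0r.
  by move=> v; exists 0 => // u ->; rewrite sB1 z1.
have spanD u v t : in_span s u -> in_span s v -> in_span s (t *: u + v).
  clear; elim: s u v => [|x s IH] u v /=; first by move=> -> ->; rewrite scaler0 addr0.
  move=> [u' [a [su ->]]] [v' [b [sv ->]]].
  exists (t *: u' + v'), (t * a + b); split; first exact: IH.
  by rewrite scalerDr scalerDl scalerA addrACA.
have span0 : in_span s 0.
  clear; elim: s => //= x s IH; exists 0, 0; split => //; by rewrite scale0r addr0.
(* The difference [g] is the part of [w] orthogonal to the span of [s]; this is why projections are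
   constructed in the same induction as the bound. *)
have [p sp orth] := proj w.
pose g := w - p.
have gorth u : in_span s u -> B1 u g = 0 by move=> su; rewrite sB1 orth.
have spanE u : in_span (w :: s) u <-> exists v t, in_span s v /\ u = t *: g + v.
  split => /= -[v [t [sv ->]]].
    exists (t *: p + v), t; split; first exact: spanD.
    by rewrite scalerBr addrA subrK.
  exists (- t *: p + v), t; split; first exact: spanD.
  by rewrite scalerBr scaleNr addrA.
split.
  (* On the line of [g] the ratio of the forms is a constant, unless [B1 g g = 0]; then [B2 g g = 0]
     as well and 0 does. The factors 2 pay for splitting [t *: g + v] into its two parts. *)
  pose D := if B1 g g == 0 then 0 else 2 * B2 g g / B1 g g.
  have D0 : 0 <= D.
    by rewrite /D; case: ifP => // _; rewrite divr_ge0 ?mulr_ge0.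
  exists (2 * C + D); first lra.
  move=> u /spanE[v [t [sv ->]]].
  have -> : B1 (t *: g + v) (t *: g + v) = t ^+ 2 * B1 g g + B1 v v.
    rewrite D1 Z1 (sB1 g) D1 Z1 (gorth _ sv) addr0 (sB1 v (_ + _)) D1 Z1.
    by rewrite (sB1 g v) (gorth _ sv) mulr0 add0r; ring.
  have h1 : B2 (t *: g + v) (t *: g + v) <= 2 * (t ^+ 2 * B2 g g) + 2 * B2 v v.
    have L b w' : B2 (t *: g + b *: v) w' = t * B2 g w' + b * B2 v w' by rewrite D2 !Z2.
    have Q b : B2 (t *: g + b *: v) (t *: g + b *: v) =
        t ^+ 2 * B2 g g + 2 * t * b * B2 g v + b ^+ 2 * B2 v v.
      by rewrite L (sB2 g (_ + _)) (sB2 v (_ + _)) !L (sB2 v g); ring.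
    (* Nonnegativity of [B2] at [t *: g - v] bounds the mixed term. *)
    have := pB2 (t *: g + (-1) *: v); have := Q (-1); have := Q 1.
    rewrite !scale1r !expr1n; lra.
  have h2 : t ^+ 2 * B2 g g * 2 <= D * (t ^+ 2 * B1 g g).
    rewrite /D; case: ifPn => [/eqP g0|g0]; first by rewrite (ker _ g0) g0 !(mulr0, mul0r).
    by rewrite (_ : _ * (t ^+ 2 * _) = t ^+ 2 * B2 g g * 2)//; field.
  have h3 := hC _ sv; have h4 : 0 <= D * B1 v v by rewrite mulr_ge0.
  have h5 : 0 <= C * (t ^+ 2 * B1 g g) by apply: mulr_ge0 => //; apply: mulr_ge0 => //; exact: sqr_ge0.
  nra.
move=> v; have [q sq qorth] := proj v.
(* If [g] is null, it is orthogonal to everything by [psd_null], and the projection on the smaller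
   span still works. *)
have [g0|g0] := eqVneq (B1 g g) 0.
  exists q; first by apply/spanE; exists q, 0; rewrite scale0r add0r.
  move=> u /spanE[x [t [sx ->]]]; rewrite sB1 D1 Z1 (sB1 x) qorth// addr0.
  by rewrite sB1 (psd_null _ psd1 g0) mulr0.
have [w' w'E] : exists w', w' = v - q by exists (v - q).
rewrite -w'E in qorth.
pose t := B1 w' g / B1 g g.
exists (t *: g + q); first by apply/spanE; exists q, t.
move=> u /spanE[x [r [sx ->]]]; rewrite sB1 D1 Z1.
have -> : v - (t *: g + q) = w' - t *: g by rewrite w'E opprD addrCA addrC.
have L y : B1 (w' - t *: g) y = B1 w' y - t * B1 g y by rewrite D1 N1 Z1.
rewrite (sB1 g (w' - _)) (sB1 x (w' - _)) !L (qorth x sx) (sB1 g x) (gorth x sx).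
by rewrite /t divfK//; ring.
Qed.

End psd_forms.

(** * Gram forms of finite families of functions *)

Section gram.
Variables (R : realType) (d : nat).
Local Notation rV := 'rV[R]_d.
Local Notation leb := (lebesgue_rV R d).

Definition lincomb (X : finType) (g : X -> rV -> R) (c : X -> R) (y : rV) : R :=
  \sum_x c x * g x y.

Definition sqint (S : set rV) (f : rV -> R) : R :=
  \int[leb]_(y in S) (f y ^+ 2).

Lemma sqint_ge0 S f : 0 <= sqint S f.
Proof. by apply: Rintegral_ge0 => y _; exact: sqr_ge0. Qed.

Lemma bmeas_lincomb (X : finType) S (g : X -> rV -> R) c :
  (forall x, bmeas S (g x)) -> bmeas S (lincomb g c).
Proof. by move=> bg; apply: bmeas_sum => x; apply: bmeasM (bg x); exact: bmeas_cst. Qed.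

Lemma gram_psd (X I : finType) (S : I -> set rV) (g : I -> X -> rV -> R) :
  (forall i, measurable (S i)) -> (forall i, leb (S i) < +oo)%E ->
  (forall i x, bmeas (S i) (g i x)) ->
  psd_form (fun c c' : X -> R^o => \sum_i \int[leb]_(y in S i) (lincomb (g i) c y * lincomb (g i) c' y)).
Proof.
move=> mS Soo bg; split.
- move=> u v; apply: eq_bigr => i _; congr Rintegral; apply/funext => y; exact: mulrC.
- move=> a u v w; rewrite mulr_sumr -big_split/=; apply: eq_bigr => i _.
  have bi c c' : leb.-integrable (S i) (EFin \o (fun y => lincomb (g i) c y * lincomb (g i) c' y)).
    by apply: bmeas_integrable => //; apply: bmeasM; exact: bmeas_lincomb.
  rewrite -RintegralZl// -RintegralD//; last first.
    have := bi u w => /integrableZl => /(_ (mS i) a); exact: eq_integrable.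
  apply: eq_Rintegral => y _; rewrite mulrA -mulrDl; congr (_ * _).
  rewrite /lincomb mulr_sumr -big_split/=; apply: eq_bigr => x _.
  by rewrite mulrDl mulrA.
- by move=> v; apply: sumr_ge0 => i _; apply: Rintegral_ge0 => y _; rewrite -expr2 sqr_ge0.
Qed.

Lemma in_span_delta (X : finType) (s : seq X) (f : X -> R^o) :
  (forall x, x \notin s -> f x = 0) ->
  in_span [seq (fun y => (y == x)%:R) : X -> R^o | x <- s] f.
Proof.
elim: s f => [|x s IH] f fs /=; first by apply/funext => x; exact: fs.
exists (fun y => if y == x then 0 else f y), (f x); split.
  by apply: IH => y ys; case: eqP => // /eqP yx; apply: fs; rewrite in_cons negb_or yx.
apply/funext => y.
change (f y = f x * (y == x)%:R + (if y == x then 0 else f y)).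
by case: eqP => [->|_]; rewrite ?mulr1 ?addr0// mulr0 add0r.
Qed.

(** Both sums are semidefinite forms in the coefficient vector [c], possibly degenerate because the
    functions may be dependent on the given sets. Vectors on a finite type are spanned by a finite
    list, so inclusion of kernels yields a constant. *)
Lemma gram_bound (X I J : finType) (S1 : I -> set rV) (g1 : I -> X -> rV -> R)
    (S2 : J -> set rV) (g2 : J -> X -> rV -> R) :
  (forall i, measurable (S1 i)) -> (forall i, leb (S1 i) < +oo)%E ->
  (forall i x, bmeas (S1 i) (g1 i x)) ->
  (forall i, measurable (S2 i)) -> (forall i, leb (S2 i) < +oo)%E ->
  (forall i x, bmeas (S2 i) (g2 i x)) ->
  (forall c, (forall i, sqint (S1 i) (lincomb (g1 i) c) = 0) ->
             forall j, sqint (S2 j) (lincomb (g2 j) c) = 0) ->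
  exists2 C, 0 <= C & forall c,
    \sum_j sqint (S2 j) (lincomb (g2 j) c) <=
    C * \sum_i sqint (S1 i) (lincomb (g1 i) c).
Proof.
move=> mS1 S1oo bg1 mS2 S2oo bg2 ker.
have psd1 := gram_psd mS1 S1oo bg1; have psd2 := gram_psd mS2 S2oo bg2.
have E (I' : finType) (S : I' -> set rV) g (c : X -> R) :
    \sum_i \int[leb]_(y in S i) (lincomb (g i) c y * lincomb (g i) c y) =
    \sum_i sqint (S i) (lincomb (g i) c).
  by apply: eq_bigr => i _; apply: eq_Rintegral => y _; rewrite expr2.
have [|[C C0 hC] _] := psd_form_le
    [seq (fun y => (y == x)%:R) : X -> R^o | x <- enum X] psd1 psd2.
  move=> c; rewrite !E => /eqP; rewrite psumr_eq0 => [/allP h|i _]; last exact: sqint_ge0.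
  apply: big1 => j _; apply: ker => i.
  by apply/eqP; have := h i; rewrite mem_index_enum; exact.
exists C => // c; rewrite -!E; apply: hC; apply: in_span_delta => x.
by rewrite mem_enum.
Qed.

Lemma leb_obox_gt0 (a b : 'I_d -> R) : (forall l, a l < b l) -> (0 < leb (obox a b))%E.
Proof.
move=> ab; rewrite leb_obox => [|l]; last exact: ltW.
by rewrite lte_fin prodr_gt0// => l _; rewrite subr_gt0.
Qed.

Lemma sqint_EFin S f : measurable S -> (leb S < +oo)%E -> bmeas S f ->
  (sqint S f)%:E = (\int[leb]_(y in S) (f y ^+ 2)%:E)%E.
Proof.
move=> mS Soo bf; rewrite /sqint /Rintegral fineK//; apply: integrable_fin_num => //.
apply: bmeas_integrable => //.
by have := bmeasM bf bf; under eq_fun do rewrite -expr2.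
Qed.

(** If [f x] were nonzero, [f ^+ 2] would exceed half its value at [x] on a small box, which has
    positive measure. *)
Lemma sqint_eq0 (O : set rV) f : open O -> (leb O < +oo)%E -> bmeas O f ->
  continuous f -> sqint O f = 0 -> forall x, O x -> f x = 0.
Proof.
move=> oO Ooo bf cf f0 x Ox; apply: contrapT => /eqP fx0.
have mO := open_measurable_rV oO.
have := sqint_EFin mO Ooo bf; rewrite f0.
pose e := f x ^+ 2 / 2.
have e0 : 0 < e by rewrite divr_gt0// exprn_even_gt0.
have oO' : open (O `&` [set y | e < f y * f y]).
  apply: openI => //.
  apply: (@open_comp _ _ (fun y => f y * f y) [set z | e < z]); last exact: open_gt.
  by move=> y _; exact: (cvgM (cf y) (cf y)).
have [|r r0 rO] := @open_obox_nbhs R d _ x oO'.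
  by split => //=; rewrite -expr2 /e ltr_pdivrMr// ltr_pMr ?ltr1n// exprn_even_gt0.
set B := obox _ _ in rO.
have Bpos : (0 < leb B)%E by apply: leb_obox_gt0 => l; lra.
have mB : measurable B by exact: measurable_obox.
have mf2 : measurable_fun O (fun y => (f y ^+ 2)%:E).
  apply/measurable_EFinP; have [mf _] := bmeasM bf bf.
  by under eq_fun do rewrite expr2.
have h1 : (\int[leb]_(y in B) e%:E <= \int[leb]_(y in O) (f y ^+ 2)%:E)%E.
  apply: (@le_trans _ _ (\int[leb]_(y in B) (f y ^+ 2)%:E)%E).
    apply: ge0_le_integral => //.
    - by move=> y _; rewrite lee_fin ltW.
    - by apply: measurable_funS mf2 => // y /rO[].
    - by move=> y /rO[_ /= /ltW]; rewrite lee_fin expr2.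
  apply: ge0_subset_integral => //.
  - by move=> y _; rewrite lee_fin sqr_ge0.
  - by move=> y /rO[].
move=> h2; move: h1; rewrite -h2 integral_cst// => h1.
have : (0 < e%:E * leb B)%E by rewrite mule_gt0// lte_fin.
by rewrite ltNge h1.
Qed.

End gram.

(** * Discrete functions near an element *)

Section polynomials.
Variables (R : realType) (d P : nat).
Local Notation rV := 'rV[R]_d.
Local Notation mindex := (mindex d P).

(** A type of exponents rather than a filtered sum, so that coefficient vectors are all functions on
    a finite type. *)
Definition pidx : finType := {a : mindex | (morder (mval a) <= P)%N}.

Lemma sum_pidx (F : mindex -> R) :
  \sum_(a | (morder (mval a) <= P)%N) F a = \sum_(a : pidx) F (val a).
Proof.
rewrite (reindex_omap (val : pidx -> mindex) insub)/=; last first.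
  by move=> a ha; rewrite insubT.
by apply: eq_bigl => a; rewrite valK eqxx (valP a).
Qed.

Lemma polyfunP (p : rV -> R) : polyfun P p <->
  exists c : pidx -> R, p = fun x => \sum_a c a * monom (mval (val a)) x.
Proof.
split => [[c ->]|[c ->]].
  by exists (fun a => c (val a)); apply/funext => x; rewrite sum_pidx.
exists (fun a => if insub a is Some b then c b else 0); apply/funext => x.
by rewrite sum_pidx; apply: eq_bigr => a _; rewrite valK.
Qed.

Lemma polyfun_sum (I : Type) (r : seq I) (Q : pred I) (p : I -> rV -> R) :
  (forall i, polyfun P (p i)) -> polyfun P (fun x => \sum_(i <- r | Q i) p i x).
Proof.
move=> pp; have /choice[c cE] := fun i => (polyfunP (p i)).1 (pp i).
apply/polyfunP; exists (fun a => \sum_(i <- r | Q i) c i a); apply/funext => x.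
under eq_bigr do rewrite cE.
by rewrite exchange_big/=; apply: eq_bigr => a _; rewrite mulr_suml.
Qed.

Lemma polyfun0 : @polyfun R d P (fun=> 0).
Proof.
have := @polyfun_sum nat [::] xpredT (fun=> fun=> 0); rewrite (_ : (fun _ => _) = fun=> 0).
  by apply=> _; exists (fun=> 0); apply/funext => x; rewrite big1// => a _; rewrite mul0r.
by apply/funext => x; rewrite big_nil.
Qed.

(** Binomial theorem in each coordinate. An exponent [b] of order above [P] exceeds every admissible
    [a] in some direction, where the binomial coefficient vanishes; so the degree does not grow. *)
Lemma polyfun_rescale (p : rV -> R) (s : R) (t : rV) : polyfun P p ->
  exists c : pidx -> R, forall y, p (rescale s t y) = \sum_a c a * monom (mval (val a)) y.
Proof.
move=> /polyfunP[c ->].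
pose k (l : 'I_d) (a b : nat) : R := s ^+ a * (t ord0 l ^+ (a - b) *+ 'C(a, b)).
have kE l (a : nat) (z : R) : (a <= P)%N ->
    (s * (z + t ord0 l)) ^+ a = \sum_(b < P.+1) k l a b * z ^+ b.
  move=> aP; rewrite exprMn addrC exprDn mulr_sumr.
  rewrite (big_ord_widen P.+1 (fun b => s ^+ a * (t ord0 l ^+ (a - b) * z ^+ b *+ 'C(a, b))))//.
  rewrite big_mkcond/=; apply: eq_bigr => b _; rewrite /k.
  case: ifPn => [_|]; first by rewrite -mulrnAl mulrA.
  by rewrite -leqNgt => ab; rewrite bin_small// mulr0n mulr0 mul0r.
pose c' (b : mindex) := \sum_a c a * \prod_l k l (mval (val a) l) (b l).
have c'0 b : (P < morder (mval b))%N -> c' b = 0.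
  move=> Pb; apply: big1 => a _.
  have [l lb] : exists l, (mval (val a) l < b l)%N.
    apply: contrapT => /forallNP nb; have := leq_ltn_trans (valP a) Pb.
    rewrite ltnNge leq_sum// => l _; rewrite leqNgt; apply/negP; exact: nb.
  by rewrite (bigD1 l)//= /k bin_small// mulr0n mulr0 mul0r mulr0.
exists (fun b => c' (val b)) => y.
rewrite -(sum_pidx (fun b => c' b * monom (mval b) y)).
transitivity (\sum_(b : mindex) c' b * monom (mval b) y); last first.
  rewrite [RHS]big_mkcond; apply: eq_bigr => b _.
  by case: leqP => // /c'0 ->; rewrite mul0r.
rewrite /c'; under [RHS]eq_bigr do rewrite mulr_suml.
rewrite exchange_big/=; apply: eq_bigr => a _.
under [RHS]eq_bigr do rewrite -mulrA.
rewrite -mulr_sumr; congr (_ * _).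
rewrite /monom; under eq_bigr => l _.
  rewrite /rescale !mxE kE; last by rewrite -ltnS ltn_ord.
  over.
rewrite bigA_distr_bigA/=; apply: eq_bigr => b _.
by rewrite big_split.
Qed.

End polynomials.

Section reference.
Variables (R : realType) (d P : nat).
Local Notation rV := 'rV[R]_d.
Local Notation idx := 'rV[int]_d.
Local Notation pidx := (pidx d P).

(** Offsets [n - 1] ranging over [-1, .., 2] in every direction: the nodes
    whose [phi] may be nonzero on an element or on one of its neighbors. *)
Definition win : finType := {ffun 'I_d -> 'I_4}.

Definition node_shift (i : idx) (n : win) : idx := \row_l (i ord0 l + (n l : nat)%:Z - 1).

Definition realrow (i : idx) : rV := \row_l (i ord0 l)%:~R.

(** The block made of the element [i] and the elements around it, where the offsets in [win] catch
    every nonzero [phi]. *)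
Definition window (sigma : R) (i : idx) : set rV :=
  obox (fun l => ((i ord0 l)%:~R - 1) * sigma) (fun l => ((i ord0 l)%:~R + 2) * sigma).

(** One-dimensional factors of [phi] times a monomial, in coordinates of the unit grid centered at
    the node [i]. The same finite family serves every element. *)
Definition bref (x : win * pidx) (l : 'I_d) (t : R) : R :=
  hat (t - ((x.1 l : nat)%:R - 1)) * t ^+ mval (val x.2) l.

Lemma smooth1_bref x l : smooth1 (bref x l).
Proof.
have sh : smooth1 (fun t : R => hat (t - ((x.1 l : nat)%:R - 1))).
  apply: smooth1_comp (@smooth1_hat R) _.
  exact: smooth1B (@smooth1_id R) (smooth1_cst _).
exact: smooth1M sh (smooth1X _ _).
Qed.

(** The polynomial [p k] belongs to the node [k] and is the same in all windows that see this
    node. *)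
Definition local_form sigma (O : set rV) (p : idx -> rV -> R) (v : rV -> R) :=
  forall i x, O x -> window sigma i x ->
    v x = \sum_n phi sigma (node_shift i n) x * p (node_shift i n) x.

Lemma elementE sigma i : element sigma i =
  obox (fun l => (i ord0 l)%:~R * sigma) (fun l => ((i ord0 l)%:~R + 1) * sigma) :> set rV.
Proof. by []. Qed.

Section scaled.
Variable sigma : R.
Hypothesis sigma_gt0 : 0 < sigma.

Lemma phi_out (k : idx) (x : rV) l : 1 <= `|x ord0 l / sigma - (k ord0 l)%:~R| -> @phi R d sigma k x = 0.
Proof. by move=> h; rewrite phiE// (bigD1 l)//= hat_out// mul0r. Qed.

Lemma node_shift_inj i : injective (node_shift i).
Proof.
move=> n m /rowP h; apply/ffunP => l; apply/val_inj.
by have := h l; rewrite !mxE /=; clear; lia.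
Qed.

Lemma phi_window i k x : window sigma i x -> phi sigma k x != 0 ->
  exists n, k = node_shift i n.
Proof.
move=> wx phi0.
have kl l : 0 <= k ord0 l - i ord0 l + 1 < 4.
  have : `|x ord0 l / sigma - (k ord0 l)%:~R| < 1.
    by rewrite ltNge; apply/negP => /phi_out h; rewrite h eqxx in phi0.
  have := wx l; rewrite -(ltr_pdivlMr _ _ sigma_gt0) -(ltr_pdivrMr _ _ sigma_gt0).
  rewrite ltr_norml => /andP[h1 h2] /andP[h3 h4].
  have h5 : ((k ord0 l)%:~R : R) < (i ord0 l + 3)%:~R by rewrite intrD (_ : 3%:~R = 3 :> R)//; lra.
  have h6 : ((i ord0 l - 2)%:~R : R) < (k ord0 l)%:~R by rewrite intrB (_ : 2%:~R = 2 :> R)//; lra.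
  rewrite !ltr_int in h5 h6; lia.
pose n : win := [ffun l => inord (absz (k ord0 l - i ord0 l + 1))].
exists n; apply/rowP => l; have /andP[k0 k4] := kl l; rewrite !mxE ffunE.
rewrite inordK; last by rewrite -ltz_nat gez0_abs.
by rewrite gez0_abs//; ring.
Qed.

(** The list representing a discrete function may repeat a node, so the polynomial at a node
    collects all its occurrences. *)
Lemma Vspace_local (O : set rV) v : Vspace sigma P O v ->
  exists2 p, (forall k, polyfun P (p k)) & local_form sigma O p v.
Proof.
move=> [s [c vE]].
pose q k (x : rV) := \sum_(a | (morder (mval a) <= P)%N) c k a * monom (mval a) x.
exists (fun k x => \sum_(k' <- s | k' == k) q k' x).
  by move=> k; apply: polyfun_sum => k'; exists (c k').
move=> i x Ox wx; rewrite vE//.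
transitivity (\sum_(k <- s) phi sigma k x * q k x).
  apply: eq_bigr => k _; rewrite mulr_sumr; apply: eq_bigr => a _.
  by rewrite mulrCA.
under [RHS]eq_bigr do rewrite mulr_sumr.
rewrite (exchange_big_dep xpredT)//=; apply: eq_bigr => k _.
have [phi0|phi0] := eqVneq (phi sigma k x) 0.
  by rewrite phi0 mul0r big1// => n /eqP <-; rewrite phi0 mul0r.
have [n kE] := phi_window wx phi0.
rewrite (big_pred1 n) ?kE// => m; rewrite pred1E /=.
by apply/eqP/eqP => [/node_shift_inj ->|->].
Qed.

Lemma phi_node_shift i n y : phi sigma (node_shift i n) (rescale sigma (realrow i) y) =
  \prod_l hat (y ord0 l - ((n l : nat)%:R - 1)).
Proof.
rewrite phiE//; apply: eq_bigr => l _; congr hat.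
rewrite !mxE rmorphB rmorphD/= mulrAC divff ?gt_eqF// mul1r; ring.
Qed.

Lemma local_form_rescale (O : set rV) p v i : (forall k, polyfun P (p k)) ->
  local_form sigma O p v ->
  exists c : win * pidx -> R,
    (forall n y, p (node_shift i n) (rescale sigma (realrow i) y) =
       \sum_a c (n, a) * monom (mval (val a)) y) /\
    forall x, O x -> window sigma i x ->
      v x = tsum c bref (\row_l (x ord0 l * sigma^-1 - (i ord0 l)%:~R)).
Proof.
move=> pp pv.
have /choice[c cE] := fun n => polyfun_rescale sigma (realrow i) (pp (node_shift i n)).
exists (fun x => c x.1 x.2); split; first exact: cE.
move=> x Ox wx; rewrite (pv i)//; set y := \row__ _.
have xE : x = rescale sigma (realrow i) y.
  by apply/rowP => l; rewrite !mxE subrK mulrCA divff ?mulr1// gt_eqF.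
rewrite {1 2}xE; under eq_bigr do rewrite phi_node_shift cE mulr_sumr.
rewrite pair_bigA/=; apply: eq_bigr => -[n a] _ /=.
rewrite mulrCA /tens /bref/=; congr (_ * _).
by rewrite [RHS](big_split _ _ _ (fun l => hat (y ord0 l - ((n l : nat)%:R - 1)))).
Qed.

End scaled.

End reference.

(** * Propagation of zeros across a common node *)

Section segments.
Variables (R : realType) (d : nat).
Local Notation rV := 'rV[R]_d.

Lemma is_derive_along (f : rV -> R) (z w : rV) (t : R) :
  differentiable f (t *: w + z) ->
  is_derive t 1 (fun t => f (t *: w + z)) ('D_w f (t *: w + z)).
Proof.
move=> df; have [dw _] := derivableP (@diff_derivable _ _ _ _ _ w df).
pose g (t : R) := f (t *: w + z).
have E : (fun h : R => h^-1 *: ((g \o shift t) (h *: (1 : R)) - g t)) =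
         (fun h : R => h^-1 *: ((f \o shift (t *: w + z)) (h *: w) - f (t *: w + z))).
  apply/funext => h; congr (_ *: (f _ - _)).
  by rewrite /= [h *: (1 : R)]mulr1 scalerDl addrA.
by split; [rewrite /derivable E|rewrite /derive E].
Qed.

Lemma deriveE_pderiv (f : rV -> R) (a w : rV) : differentiable f a ->
  'D_w f a = \sum_l w ord0 l * pderiv l f a.
Proof.
move=> df; rewrite deriveE// {1}(row_sum_delta w) linear_sum.
apply: eq_bigr => l _; rewrite linearZ/= /pderiv deriveE//.
Qed.

(** Mean value theorem along the segment. Only its interior is tested, so [z] may lie on the
    boundary of the box where the derivatives are known. *)
Lemma zero_pderiv_segment (f : rV -> R) (z x : rV) : (forall y, differentiable f y) ->
  (forall t l, 0 < t < 1 -> pderiv l f (t *: (x - z) + z) = 0) -> f x = f z.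
Proof.
move=> df f0; have dg (t : R) := is_derive_along (df (t *: (x - z) + z)).
have [|c] := @MVT R (fun t => f (t *: (x - z) + z))
  (fun t => 'D_(x - z) f (t *: (x - z) + z)) 0 1 ltr01.
  apply: continuous_subspaceT => t; apply: differentiable_continuous.
  by apply/derivable1_diffP; have [] := dg t.
rewrite in_itv/= => c01; rewrite deriveE_pderiv// big1 => [|l _].
  by rewrite scale1r subrK scale0r add0r mul0r => /eqP; rewrite subr_eq0 => /eqP.
by rewrite f0// mulr0.
Qed.

Lemma obox_segment (a b : 'I_d -> R) (z x : rV) t : obox a b x ->
  (forall l, a l <= z ord0 l <= b l) -> 0 < t < 1 -> obox a b (t *: (x - z) + z).
Proof.
move=> abx abz /andP[t0 t1] l; have /andP[x1 x2] := abx l; have /andP[z1 z2] := abz l.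
by rewrite !mxE; apply/andP; split; nra.
Qed.

End segments.

Section vanishing.
Variables (R : realType) (d P : nat) (X : finType) (c : X -> R) (h : X -> 'I_d -> R -> R).
Hypothesis sh : forall s l, smooth1 (h s l).
Local Notation rV := 'rV[R]_d.

Definition dtens (b : 'I_d -> nat) : X -> 'I_d -> R -> R :=
  fun s l => derive1n (b l) (h s l).

Lemma smooth1_dtens b s l : smooth1 (dtens b s l).
Proof. exact: smooth1_derive1n. Qed.

Lemma pderiv_dtens b l : pderiv l (tsum c (dtens b)) =
  tsum c (dtens (fun k => b k + (k == l))%N).
Proof.
rewrite pderiv_tsum; last exact: smooth1_dtens.
congr tsum; apply/funext => s; apply/funext => k; rewrite /dtens.
by case: (k == l); rewrite ?addn1 ?addn0.
Qed.

Lemma differentiable_dtens b x : differentiable (tsum c (dtens b)) x.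
Proof. exact: (smooth_tsum c (smooth1_dtens b) [::]). Qed.

(** If all derivatives of order [P.+1] vanish on a box [Q] and the function
    itself vanishes on a box [Q'] whose closure shares a point [z] with that of
    [Q], then by descending induction on the order all its derivatives vanish
    on [Q], since they are constant there and vanish at [z]. *)
Lemma vanish_across (a b a' b' : 'I_d -> R) (z y : rV) :
  (forall l, a l <= z ord0 l <= b l) -> (forall l, a' l <= z ord0 l <= b' l) ->
  obox a' b' y ->
  (forall x, obox a' b' x -> tsum c h x = 0) ->
  (forall e : 'I_d -> nat, morder e = P.+1 ->
     forall x, obox a b x -> tsum c (dtens e) x = 0) ->
  forall x, obox a b x -> tsum c h x = 0.
Proof.
move=> abz abz' y' h0 hP.
have Q'0 e x : obox a' b' x -> tsum c (dtens e) x = 0.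
  move=> Q'x; rewrite /dtens -(mderiv_tsum c e sh).
  rewrite (mderiv_local (g := tsum (fun=> 0) h) e (@obox_open _ _ a' b'))//.
    by rewrite mderiv_tsum// /tsum big1// => s _; rewrite mul0r.
  by move=> w /h0 ->; rewrite /tsum big1// => s _; rewrite mul0r.
(* The segment from [z] to [y] runs inside the second box, where all derivatives vanish. *)
have z0 e : tsum c (dtens e) z = 0.
  rewrite -(@zero_pderiv_segment _ _ (tsum c (dtens e)) z y); first exact: Q'0.
    by move=> w; exact: differentiable_dtens.
  by move=> t l t01; rewrite pderiv_dtens; apply: Q'0; exact: obox_segment.
(* Here [k] counts the orders still missing to [P.+1]. *)
suff S k e : (morder e + k = P.+1)%N -> forall x, obox a b x -> tsum c (dtens e) x = 0.
  move=> x Qx; apply: (S P.+1 (fun=> 0%N)) Qx.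
  by rewrite /morder big1.
elim: k e => [|k IH] e; first by rewrite addn0; exact: hP.
move=> ek x Qx; rewrite -(z0 e); apply: zero_pderiv_segment => [w|t l t01].
  exact: differentiable_dtens.
rewrite pderiv_dtens; apply: IH; last exact: obox_segment.
rewrite -ek /morder big_split/= -addnA; congr addn.
by rewrite (bigD1 l)//= eqxx big1 => [|j /negbTE ->//]; lia.
Qed.

End vanishing.

(** * Uniform inequalities on the reference cell *)

Section reference_inequalities.
Variables (R : realType) (d P : nat).
Local Notation rV := 'rV[R]_d.
Local Notation leb := (lebesgue_rV R d).
Local Notation X := (win d * pidx d P)%type.
Local Notation bref := (@bref R d P).

Definition refcell (m : 'I_d -> R) : set rV := obox (fun l => m l) (fun l => m l + 1).

Lemma measurable_refcell m : measurable (refcell m).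
Proof. exact: measurable_obox. Qed.

Lemma leb_refcell m : (leb (refcell m) < +oo)%E.
Proof. exact: leb_obox_fin. Qed.

Lemma bmeas_refcell m (h : 'I_d -> R -> R) : (forall l, smooth1 (h l)) ->
  bmeas (refcell m) (tens h).
Proof.
move=> sh; apply: (@bmeas_tens _ _ _ (\sum_l (`|m l| + 1))) => [l|x mx l].
  exact: smooth1_continuous.
rewrite (bigD1 l)//= (@le_trans _ _ (`|m l| + 1))//; last by rewrite lerDl sumr_ge0.
have /andP[h1 h2] := mx l; have := ler_norm (m l); have := ler_norm (- m l).
by rewrite normrN ler_norml => h3 h4; apply/andP; split; lra.
Qed.

Lemma mindex_of (e : 'I_d -> nat) : morder e = P.+1 ->
  exists2 a : mindex d P.+1, mval a = e & morder (mval a) == P.+1.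
Proof.
move=> eP; have el l : (e l < P.+2)%N.
  by rewrite ltnS -eP /morder (bigD1 l)//= leq_addr.
exists [ffun l => inord (e l)]; last first.
  by apply/eqP; rewrite -[RHS]eP; apply: eq_bigr => l _; rewrite /mval ffunE inordK.
by apply/funext => l; rewrite /mval ffunE inordK.
Qed.

(** The neighbor sits at the position [m l - 1], one of -1, 0, 1, in each direction. By [gram_bound]
    only the inclusion of kernels is left, and that is [vanish_across]. *)
Lemma reference_stability (m : {ffun 'I_d -> 'I_3}) :
  exists2 C, 0 <= C & forall c : X -> R,
    sqint (refcell (fun=> 0)) (tsum c bref) <=
    C * (sqint (refcell (fun l => (m l : nat)%:R - 1)) (tsum c bref) +
         \sum_(a : mindex d P.+1 | morder (mval a) == P.+1)
            sqint (refcell (fun=> 0)) (tsum c (dtens bref (mval a)))).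
Proof.
pose Q0 := refcell (fun=> 0); pose Qm := refcell (fun l => (m l : nat)%:R - 1).
pose I := {a : mindex d P.+1 | morder (mval a) == P.+1}.
(* The right-hand side as one Gram form: an integral over the neighbor, and one over the cell for
   each derivative. *)
pose S1 (i : unit + I) := if i is inl _ then Qm else Q0.
pose g1 (i : unit + I) (x : X) : rV -> R :=
  if i is inr a then tens (dtens bref (mval (val a)) x) else tens (bref x).
have [|||||||C C0 hC] := @gram_bound R d X (unit + I)%type unit S1 g1
    (fun=> Q0) (fun _ x => tens (bref x)).
- by case=> i; exact: measurable_refcell.
- by case=> i; exact: leb_refcell.
- move=> [i|a] x; apply: bmeas_refcell => l; first exact: smooth1_bref.
  by apply: smooth1_dtens => s k; exact: smooth1_bref.
- by move=> _; exact: measurable_refcell.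
- by move=> _; exact: leb_refcell.
- by move=> _ x; apply: bmeas_refcell => l; exact: smooth1_bref.
- move=> c c0 _.
  have cont (h : X -> 'I_d -> R -> R) : (forall s l, smooth1 (h s l)) -> continuous (tsum c h).
    by move=> sh x; apply: differentiable_continuous; exact: (smooth_tsum c sh [::]).
  have van (k : 'I_d -> R) h : (forall s l, smooth1 (h s l)) ->
      sqint (refcell k) (tsum c h) = 0 -> forall x, refcell k x -> tsum c h x = 0.
    move=> sh; apply: sqint_eq0; [exact: obox_open|exact: leb_refcell| |exact: cont].
    by apply: bmeas_lincomb => x; apply: bmeas_refcell.
  suff v0 x : Q0 x -> tsum c bref x = 0.
    rewrite /sqint /Rintegral integral0_eq// => x Q0x /=.
    change ((tsum c bref x ^+ 2)%:E = 0%E).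
    by rewrite (v0 x Q0x) expr0n.
  (* The common node has coordinate 1 where the neighbor lies on the upper side and 0 otherwise; the
     last point is the center of the neighbor. *)
  apply: (@vanish_across R d P X c bref (@smooth1_bref R d P) _ _
    (fun l => (m l : nat)%:R - 1) (fun l => (m l : nat)%:R - 1 + 1)
    (\row_l (if m l == 2 :> nat then 1 else 0)) (\row_l ((m l : nat)%:R - 2^-1))).
  + by move=> l; rewrite mxE; case: ifP => _; apply/andP; split; lra.
  + move=> l; rewrite mxE; case: (m l) => -[|[|[|//]]] /= _; apply/andP; split; lra.
  + by move=> l; rewrite mxE; apply/andP; split; lra.
  + move=> y Qy; apply: van Qy; first exact: smooth1_bref.
    exact: (c0 (inl tt)).
  + move=> e /mindex_of[a <- ha] y Qy; apply: van Qy.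
      by move=> s k; apply: smooth1_dtens => s' k'; exact: smooth1_bref.
    exact: (c0 (inr (exist _ a ha))).
exists C => // c; have := hC c.
have U (F : unit -> R) : \sum_j F j = F tt by rewrite (big_pred1 tt)//; case.
rewrite U big_sumType U /=.
suff -> : \sum_(a : mindex d P.+1 | morder (mval a) == P.+1)
    sqint Q0 (tsum c (dtens bref (mval a))) =
    \sum_(a : I) sqint Q0 (tsum c (dtens bref (mval (val a)))) by [].
rewrite (reindex_omap (val : I -> mindex d P.+1) insub)/=; last first.
  by move=> a ha; rewrite insubT.
by apply: eq_bigl => a; rewrite valK eqxx (valP a).
Qed.

End reference_inequalities.

Section reference_inverse.
Variables (R : realType) (d P : nat).
Local Notation rV := 'rV[R]_d.
Local Notation X := (win d * pidx d P)%type.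
Local Notation bref := (@bref R d P).

Lemma derive1n_exp (k a : nat) : (a < k)%N ->
  derive1n k (fun t : R => t ^+ a) = fun=> 0.
Proof.
move=> ak; have -> : (fun t : R => t ^+ a) = horner 'X^a.
  by apply/funext => t; rewrite hornerXn.
have E (p : {poly R}) n : derive1n n (horner p) = horner (derivn n p).
  elim: n => [//|n IH]; rewrite /derive1n iterS -/(derive1n n _) IH.
  by rewrite -derivE derivnS.
rewrite E derivn_poly0 ?size_polyXn//.
by apply/funext => t; rewrite horner0.
Qed.

(** Only the nodes of the element itself, with offsets in [{0, 1}], carry a
    nonzero [phi] there. *)
Definition corner (n : win d) : bool := [forall l, (n l == 1%N :> nat) || (n l == 2%N :> nat)].

(** The value 1 stands for the offset 0, that is for the node [i] of the element [i]. *)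
Definition center_node : win d := [ffun=> inord 1].

Definition refpoly (c : X -> R) (n : win d) (y : rV) : R :=
  \sum_a c (n, a) * monom (mval (val a)) y.

Lemma hat_not_corner n (y : rV) : refcell (fun=> 0) y -> ~~ corner n ->
  \prod_l hat (y ord0 l - ((n l : nat)%:R - 1)) = 0.
Proof.
move=> Qy /forallPn[l nl]; rewrite (bigD1 l)//= hat_out ?mul0r//.
have /andP[y0 y1] := Qy l; move: nl; case: (n l) => -[|[|[|[|//]]]] //= _ _.
  by rewrite ler_normr; apply/orP; left; lra.
by rewrite ler_normr; apply/orP; right; lra.
Qed.

(** Distributivity reduces the sum to one direction, where only [hat y + hat (y - 1)] survives among
    the four offsets. *)
Lemma sum_hat (y : rV) : refcell (fun=> 0) y ->
  \sum_(n : win d) \prod_l hat (y ord0 l - ((n l : nat)%:R - 1)) = 1.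
Proof.
move=> Qy.
rewrite -(bigA_distr_bigA (fun l (k : 'I_4) => hat (y ord0 l - ((k : nat)%:R - 1)))).
apply: big1 => l _; have /andP[y0 y1] := Qy l.
rewrite !big_ord_recl big_ord0 /= /bump/= addr0.
rewrite (@hat_out _ (y ord0 l - (0 - 1))); last first.
  by rewrite ler_normr; apply/orP; left; lra.
rewrite (@hat_out _ (y ord0 l - (3 - 1))); last first.
  by rewrite ler_normr; apply/orP; right; lra.
rewrite add0r addr0 (_ : y ord0 l - (1 - 1) = y ord0 l); last lra.
rewrite (_ : y ord0 l - (2 - 1) = y ord0 l - 1); last lra.
by apply: hat_sum; apply/andP; split; lra.
Qed.

Lemma tsum_bref c y : tsum c bref y =
  \sum_(n : win d) (\prod_l hat (y ord0 l - ((n l : nat)%:R - 1))) * refpoly c n y.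
Proof.
rewrite /tsum; under [RHS]eq_bigr do rewrite mulr_sumr.
rewrite pair_bigA/=; apply: eq_bigr => -[n a] _ /=.
rewrite mulrCA /tens /bref/=; congr (_ * _).
by rewrite [LHS](big_split _ _ _ (fun l => hat (y ord0 l - ((n l : nat)%:R - 1)))).
Qed.

(** If all corner polynomials agree on the cell, the partition of unity reproduces their common
    value, a polynomial of degree at most [P], and derivatives of order [P.+1] kill it. This is the
    inclusion of kernels that [gram_bound] asks for. *)
Lemma reference_inverse :
  exists2 C, 0 <= C & forall c : X -> R,
    \sum_(a : mindex d P.+1 | morder (mval a) == P.+1)
      sqint (refcell (fun=> 0)) (tsum c (dtens bref (mval a))) <=
    C * \sum_(n | corner n)
      sqint (refcell (fun=> 0)) (fun y => refpoly c n y - refpoly c center_node y).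
Proof.
pose Q0 : set rV := refcell (fun=> 0).
pose A := {a : mindex d P.+1 | morder (mval a) == P.+1}.
pose I := {n : win d | corner n}.
(* The differences of polynomials, written as linear combinations with the same coefficient vector
   [c] as the left-hand side. *)
pose g1 (i : I) (x : X) : rV -> R := fun y =>
  ((x.1 == val i)%:R - (x.1 == center_node)%:R) * monom (mval (val x.2)) y.
have g1E c i y : lincomb (g1 i) c y = refpoly c (val i) y - refpoly c center_node y.
  have E m : refpoly c m y = \sum_(x : X) c x * ((x.1 == m)%:R * monom (mval (val x.2)) y).
    rewrite (eq_bigr (fun x => c (x.1, x.2) * ((x.1 == m)%:R * monom (mval (val x.2)) y))); last by case.
    rewrite -(pair_bigA _ (fun n a => c (n, a) * ((n == m)%:R * monom (mval (val a)) y)))/=.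
    rewrite (bigD1 m)//= [X in _ = _ + X]big1 ?addr0 => [|n /negbTE nm].
      by apply: eq_bigr => a _; rewrite eqxx mul1r.
    by rewrite big1// => a _; rewrite nm mul0r mulr0.
  by rewrite !E -sumrB; apply: eq_bigr => x _; rewrite /g1 mulrBl mulrBr.
have smon (a : pidx d P) l : smooth1 (fun t : R => t ^+ mval (val a) l) by exact: smooth1X.
have [|||||||C C0 hC] := @gram_bound R d X I A (fun=> Q0) g1
    (fun=> Q0) (fun a x => tens (dtens bref (mval (val a)) x)).
- by move=> _; exact: measurable_refcell.
- by move=> _; exact: leb_refcell.
- move=> i x; apply: bmeasM; first exact: bmeas_cst.
  exact: (bmeas_refcell (fun=> 0) (smon x.2)).
- by move=> _; exact: measurable_refcell.
- by move=> _; exact: leb_refcell.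
- move=> a x; apply: bmeas_refcell => l.
  by apply: smooth1_dtens => s k; exact: smooth1_bref.
- move=> c c0 a.
  have pE n y : Q0 y -> corner n -> refpoly c n y = refpoly c center_node y.
    move=> Qy cn; apply/eqP; rewrite -subr_eq0; apply/eqP.
    rewrite -(g1E c (exist _ n cn)); apply: (sqint_eq0 _ _ _ _ (c0 (exist _ n cn)) Qy).
    + exact: obox_open.
    + exact: leb_refcell.
    + apply: bmeas_lincomb => x; apply: bmeasM; first exact: bmeas_cst.
      exact: (bmeas_refcell (fun=> 0) (smon x.2)).
    + move=> x; apply: differentiable_continuous.
      rewrite (_ : lincomb _ c = tsum (fun x => c x * ((x.1 == n)%:R - (x.1 == center_node)%:R))
        (fun (x : X) l t => t ^+ mval (val x.2) l)).
        exact: (smooth_tsum _ _ [::]).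
      by apply/funext => z; apply: eq_bigr => s _; rewrite /g1/= mulrA.
  have vE y : Q0 y -> tsum c bref y =
      tsum (fun a : pidx d P => c (center_node, a)) (fun (a : pidx d P) l t => t ^+ mval (val a) l) y.
    move=> Qy; rewrite tsum_bref -[RHS]mul1r -[X in _ = X * _](sum_hat Qy) mulr_suml.
    apply: eq_bigr => n _; have [cn|cn] := boolP (corner n); last by rewrite (hat_not_corner Qy cn) !mul0r.
    by rewrite (pE _ _ Qy cn).
  rewrite /sqint /Rintegral integral0_eq// => y Qy /=.
  change ((tsum c (dtens bref (mval (val a))) y ^+ 2)%:E = 0%E).
  rewrite /dtens -(mderiv_tsum c _ (@smooth1_bref R d P)).
  rewrite (mderiv_local (mval (val a)) (@obox_open _ _ _ _) vE Qy) mderiv_tsum//.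
  rewrite /tsum big1 ?expr0n// => b _.
  (* The derivative has order [P.+1] and the monomial order at most [P], so some exponent is
     exceeded. *)
  have [l lb] : exists l, (mval (val b) l < mval (val a) l)%N.
    apply: contrapT => /forallNP nb; have := valP b; apply/negP; rewrite -ltnNge.
    have /eqP aP := valP a; rewrite -[X in (X <= _)%N]aP; apply: leq_sum => l _.
    by rewrite leqNgt; apply/negP.
  by rewrite /tens (bigD1 l)//= derive1n_exp// mul0r mulr0.
exists C => // c; have := hC c.
have -> : \sum_(a : mindex d P.+1 | morder (mval a) == P.+1)
    sqint Q0 (tsum c (dtens bref (mval a))) =
    \sum_(a : A) sqint Q0 (tsum c (dtens bref (mval (val a)))).
  rewrite (reindex_omap (val : A -> mindex d P.+1) insub)/=; last first.
    by move=> a ha; rewrite insubT.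
  by apply: eq_bigl => a; rewrite valK eqxx (valP a).
have -> : \sum_(n | corner n) sqint Q0 (fun y => refpoly c n y - refpoly c center_node y) =
    \sum_(n : I) sqint Q0 (lincomb (g1 n) c).
  rewrite (reindex_omap (val : I -> win d) insub)/=; last first.
    by move=> a ha; rewrite insubT.
  transitivity (\sum_(n : I) sqint Q0 (fun y => refpoly c (val n) y - refpoly c center_node y)).
    by apply: eq_bigl => a; rewrite valK eqxx (valP a).
  by apply: eq_bigr => n _; congr sqint; apply/funext => y; rewrite g1E.
by [].
Qed.

End reference_inverse.

(** * Scaling to the grid *)

Section local_inequalities.
Variables (R : realType) (d P : nat).
Local Notation rV := 'rV[R]_d.
Local Notation idx := 'rV[int]_d.
Local Notation leb := (lebesgue_rV R d).
Local Notation X := (win d * pidx d P)%type.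
Local Notation bref := (@bref R d P).

Lemma sqint_eq S (f g : rV -> R) : (forall x, S x -> f x = g x) -> sqint S f = sqint S g.
Proof. by move=> fg; apply: eq_Rintegral => x /[!inE] Sx; rewrite fg. Qed.

Lemma sqintZ S k (f : rV -> R) : measurable S -> (leb S < +oo)%E -> bmeas S f ->
  sqint S (fun x => k * f x) = k ^+ 2 * sqint S f.
Proof.
move=> mS Soo bf; rewrite /sqint -RintegralZl//.
  by apply: eq_Rintegral => x _; rewrite exprMn.
apply: bmeas_integrable => //.
by have := bmeasM bf bf; under eq_fun do rewrite -expr2.
Qed.

Lemma sqint_rescale s t A (f : rV -> R) : 0 < s -> measurable A -> measurable_fun A f ->
  sqint A f = s ^+ d * sqint (rescale s t @^-1` A) (f \o rescale s t).
Proof.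
move=> s0 mA mf; rewrite /sqint /Rintegral (ge0_integral_rescale t s0)//.
- set I := (\int[leb]_(x in _ @^-1` A) _)%E.
  have : (0 <= I)%E by apply: integral_ge0 => x _; rewrite lee_fin sqr_ge0.
  (* An infinite integral is read as 0 by [fine] on both sides. *)
  case: I => [r _|_|//]; first by rewrite fineM.
  by rewrite mulry gtr0_sg ?exprn_gt0// mul1e /= mulr0.
- apply/measurable_EFinP; have := measurable_funM mf mf.
  by apply: eq_measurable_fun => x _; rewrite expr2.
- by move=> x _; rewrite lee_fin sqr_ge0.
Qed.

Section scaled.
Variable sigma : R.
Hypothesis sigma_gt0 : 0 < sigma.

Lemma measurable_element i : measurable (element sigma i : set rV).
Proof. exact: measurable_obox. Qed.

Lemma leb_element i : (leb (element sigma i) < +oo)%E.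
Proof. exact: leb_obox_fin. Qed.

Lemma rescale_element (i j : idx) :
  rescale sigma (realrow R i) @^-1` element sigma j =
  refcell (fun l => (j ord0 l - i ord0 l)%:~R).
Proof.
rewrite elementE rescale_obox// /refcell; congr obox; apply/funext => l;
  rewrite !mxE mulfK ?gt_eqF// intrB//; ring.
Qed.

Lemma element_window (i j : idx) : (forall l, `|i ord0 l - j ord0 l| <= 1) ->
  element sigma j `<=` window sigma i.
Proof.
move=> ij x jx l; have /andP[h1 h2] := jx l.
have : - 1 <= i ord0 l - j ord0 l <= 1 by rewrite -ler_norml.
move=> /andP[h3 h4].
have h5 : ((i ord0 l)%:~R - 1 : R) <= (j ord0 l)%:~R.
  by rewrite -(intrB _ _ 1) ler_int; lia.
have h6 : ((j ord0 l)%:~R + 1 : R) <= (i ord0 l)%:~R + 2.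
  by rewrite -(intrD _ _ 1) -(intrD _ _ 2) ler_int; lia.
rewrite (le_lt_trans _ h1) ?ler_pM2r// (lt_le_trans h2)// ler_pM2r//.
Qed.

Lemma element_bounded (i : idx) : exists r : R, forall x : rV, element sigma i x ->
  forall l, `|x ord0 l| <= r.
Proof.
exists (\sum_l (`|(i ord0 l)%:~R| + 1) * sigma) => x ix l.
rewrite (bigD1 l)//= (@le_trans _ _ ((`|(i ord0 l)%:~R| + 1) * sigma))//; last first.
  by rewrite lerDl sumr_ge0// => k _; rewrite mulr_ge0// ltW.
have /andP[h1 h2] := ix l; set z : R := (i ord0 l)%:~R in h1 h2 *.
have := ler_norm z; have := ler_norm (- z); rewrite normrN ler_norml => h3 h4.
by apply/andP; split; nra.
Qed.

(** On the part of [O] lying in the window around [i], a member of the discrete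
    space is, in the coordinates [y = x / sigma - i], a fixed linear combination of
    the reference functions [bref]. *)
Lemma local_form_reference (O : set rV) p v i : open O -> (forall k, polyfun P (p k)) ->
  local_form sigma O p v ->
  exists c : X -> R, [/\
    forall n y, p (node_shift i n) (rescale sigma (realrow R i) y) = refpoly c n y,
    forall y, O (rescale sigma (realrow R i) y) ->
      window sigma i (rescale sigma (realrow R i) y) ->
      v (rescale sigma (realrow R i) y) = tsum c bref y &
    forall a y, O (rescale sigma (realrow R i) y) ->
      window sigma i (rescale sigma (realrow R i) y) ->
      mderiv a v (rescale sigma (realrow R i) y) =
      sigma^-1 ^+ morder a * tsum c (dtens bref a) y].
Proof.
move=> oO pp pv; have [c [pc vc]] := local_form_rescale sigma_gt0 i pp pv.
pose aff (s : X) l (t : R) := bref s l (t * sigma^-1 + - (i ord0 l)%:~R).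
have saff s l : smooth1 (aff s l).
  apply: (@smooth1_comp _ (bref s l) (fun t => t * sigma^-1 + - (i ord0 l)%:~R)).
    exact: smooth1_bref.
  exact: smooth1_affine.
have vE x : O x -> window sigma i x -> v x = tsum c aff x.
  move=> Ox wx; rewrite vc//; apply: eq_bigr => s _; congr (_ * _).
  by apply: eq_bigr => l _; rewrite mxE.
have yK y l : rescale sigma (realrow R i) y ord0 l * sigma^-1 + - (i ord0 l)%:~R = y ord0 l.
  by rewrite !mxE mulrAC divff ?gt_eqF// mul1r addrK.
exists c; split => //.
- move=> y Oy wy; rewrite vE//; apply: eq_bigr => s _; congr (_ * _).
  by apply: eq_bigr => l _; rewrite /aff yK.
- move=> a y Oy wy.
  have oOw : open (O `&` window sigma i) by apply: openI => //; exact: obox_open.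
  rewrite (mderiv_local (g := tsum c aff) a oOw)//; last by move=> x []; exact: vE.
  rewrite mderiv_tsum// /tsum mulr_sumr; apply: eq_bigr => s _.
  rewrite mulrCA; congr (_ * _); rewrite /tens /morder expr_sum -big_split/=.
  apply: eq_bigr => l _; rewrite /aff derive1n_affine; last exact: smooth1_bref.
  by rewrite yK.
Qed.

(** One global sum instead of one per window, for statements about sets that do not fit in a single
    window. *)
Lemma Vspace_tsum (O : set rV) v : Vspace sigma P O v ->
  exists (Y : finType) (c : Y -> R) h, (forall s l, smooth1 (h s l)) /\
    forall x, O x -> v x = tsum c h x.
Proof.
move=> [s [c vE]].
pose k0 : idx := 0.
exists ('I_(size s) * pidx d P)%type, (fun y : 'I_(size s) * pidx d P => c (nth k0 s y.1) (val y.2)),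
  (fun (y : 'I_(size s) * pidx d P) l t => hat (t * sigma^-1 + - ((nth k0 s y.1) ord0 l)%:~R) * t ^+ mval (val y.2) l).
split=> [y l|x Ox].
  have sh : smooth1 (fun t : R => hat (t * sigma^-1 + - ((nth k0 s y.1) ord0 l)%:~R)).
    exact: smooth1_comp (@smooth1_hat R) (smooth1_affine _ _).
  exact: smooth1M sh (smooth1X _ _).
rewrite vE// (big_nth k0) big_mkord.
under eq_bigr do rewrite (sum_pidx (fun a => c _ a * (_ * monom (mval a) x))).
rewrite pair_bigA/=; apply: eq_bigr => -[k a] _ /=; congr (_ * _).
rewrite phiE// /tens.
by rewrite [RHS](big_split _ _ _ (fun l => hat (x ord0 l / sigma - ((nth k0 s k) ord0 l)%:~R))).
Qed.

Lemma bmeas_Vspace (O S : set rV) v (r : R) a : open O -> Vspace sigma P O v -> S `<=` O ->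
  measurable S -> (forall x, S x -> forall l, `|x ord0 l| <= r) ->
  bmeas S (mderiv a v).
Proof.
move=> oO /Vspace_tsum[Y [c [h [sh vE]]]] SO mS Sr.
apply: (bmeas_eq (f := mderiv a (tsum c h))).
  by move=> x /SO Ox; apply/esym; exact: mderiv_local Ox.
rewrite mderiv_tsum//; have sh' s l := smooth1_derive1n (a l) (sh s l).
exact: (bmeas_tsum c sh' Sr).
Qed.

Lemma sqint_element_reference (O : set rV) (i j : idx) (f g : rV -> R) :
  element sigma j `<=` O -> (forall l, `|i ord0 l - j ord0 l| <= 1) ->
  measurable_fun (element sigma j) f ->
  (forall y, O (rescale sigma (realrow R i) y) ->
      window sigma i (rescale sigma (realrow R i) y) ->
      f (rescale sigma (realrow R i) y) = g y) ->
  sqint (element sigma j) f = sigma ^+ d * sqint (refcell (fun l => (j ord0 l - i ord0 l)%:~R)) g.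
Proof.
move=> jO ij mf fg.
rewrite (@sqint_rescale _ (realrow R i) _ _ sigma_gt0 (measurable_element j) mf).
rewrite rescale_element; congr (_ * _); apply: sqint_eq => y yj /=.
rewrite -rescale_element in yj; apply: fg; first exact: jO.
exact: (element_window ij).
Qed.

End scaled.

(** Scaling to the unit grid brings [sigma ^+ d] in every integral and [sigma^-1 ^+ (2 * P.+1)] from
    the squared derivatives; the weight of the stabilization cancels the latter. *)
Lemma stability_step : exists2 C, 0 <= C & forall sigma, 0 < sigma ->
  forall (O : set rV) v, open O -> Vspace sigma P O v ->
  forall i j : idx, element sigma i `<=` O -> element sigma j `<=` O ->
  (forall l, `|i ord0 l - j ord0 l| <= 1) ->
  sqint (element sigma i) v <= C * (sqint (element sigma j) v +
    sigma ^+ (2 * P.+1) * \sum_(a : mindex d P.+1 | morder (mval a) == P.+1)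
      sqint (element sigma i) (mderiv (mval a) v)).
Proof.
have /choice[K KP] : forall m : {ffun 'I_d -> 'I_3}, exists K : R, 0 <= K /\ forall c : X -> R,
    sqint (refcell (fun=> 0)) (tsum c bref) <=
    K * (sqint (refcell (fun l => (m l : nat)%:R - 1)) (tsum c bref) +
         \sum_(a : mindex d P.+1 | morder (mval a) == P.+1)
            sqint (refcell (fun=> 0)) (tsum c (dtens bref (mval a)))).
  by move=> m; have [K K0 hK] := @reference_stability R d P m; exists K.
(* There are finitely many positions [m] of the neighbor, and the sum dominates the constant of
   each. *)
exists (\sum_m K m); first by apply: sumr_ge0 => m _; have [] := KP m.
move=> sigma s0 O v oO vV i j iO jO ij.
have [p pp pv] := Vspace_local s0 vV.
have [c [_ vc dvc]] := local_form_reference s0 i oO pp pv.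
pose m : {ffun 'I_d -> 'I_3} := [ffun l => inord (absz (j ord0 l - i ord0 l + 1))].
have mE : (fun l => (j ord0 l - i ord0 l)%:~R) = (fun l => (m l : nat)%:R - 1) :> ('I_d -> R).
  apply/funext => l; have := ij l; rewrite ler_norml => /andP[h1 h2].
  have h3 : 0 <= j ord0 l - i ord0 l + 1 by lia.
  have -> : (m l : nat)%:R = (j ord0 l - i ord0 l + 1)%:~R :> R.
    rewrite ffunE inordK; last by rewrite -ltz_nat gez0_abs//; lia.
    by rewrite -[LHS]/((absz (j ord0 l - i ord0 l + 1)) %:Z%:~R) gez0_abs.
  by rewrite [(_ + 1)%:~R]intrD addrK.
have ii l : `|i ord0 l - i ord0 l| <= 1 by rewrite subrr normr0.
have mv k : element sigma k `<=` O -> forall a, bmeas (element sigma k) (mderiv a v).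
  move=> kO a; have [r kr] := element_bounded s0 k.
  by apply: (bmeas_Vspace s0 _ oO vV kO _ kr); exact: measurable_element.
have mv0 k : element sigma k `<=` O -> measurable_fun (element sigma k) v.
  by move=> /mv /(_ (fun=> 0%N)); rewrite mderiv0// => -[].
have r0 : (fun l => (i ord0 l - i ord0 l)%:~R) = (fun=> 0) :> ('I_d -> R).
  by apply/funext => l; rewrite subrr.
rewrite (sqint_element_reference s0 iO ii (mv0 _ iO) vc) r0.
rewrite (sqint_element_reference s0 jO ij (mv0 _ jO) vc) mE.
have dE (a : mindex d P.+1) : morder (mval a) == P.+1 ->
    sqint (element sigma i) (mderiv (mval a) v) =
    sigma ^+ d * (sigma^-1 ^+ (2 * P.+1) * sqint (refcell (fun=> 0)) (tsum c (dtens bref (mval a)))).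
  move=> /eqP aP; rewrite (sqint_element_reference s0 iO ii (mv _ iO (mval a)).1 (dvc _)) r0.
  rewrite aP sqintZ; first by rewrite -exprM (mulnC P.+1 2).
  - exact: measurable_refcell.
  - exact: leb_refcell.
  - apply: bmeas_lincomb => x; apply: bmeas_refcell => l.
    by apply: smooth1_dtens => s k; exact: smooth1_bref.
rewrite (eq_bigr _ dE) -!mulr_sumr [sigma ^+ (2 * _) * _]mulrCA.
rewrite [sigma ^+ (2 * _) * _]mulrA -exprMn divff ?gt_eqF// expr1n mul1r.
rewrite -mulrDr mulrCA ler_pM2l ?exprn_gt0//.
apply: (le_trans ((KP m).2 c)); apply: ler_wpM2r.
  by rewrite addr_ge0 ?sqint_ge0// sumr_ge0// => a _; exact: sqint_ge0.
by rewrite (bigD1 m)//= lerDl sumr_ge0// => k _; have [] := KP k.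
Qed.

(** Serves to bound the stabilization of the quasi-interpolant, with the same cancellation of the
    powers of [sigma]. *)
Lemma inverse_step : exists2 C, 0 <= C & forall sigma, 0 < sigma ->
  forall (O : set rV) v p, open O -> Vspace sigma P O v -> (forall k, polyfun P (p k)) ->
  local_form sigma O p v ->
  forall i : idx, element sigma i `<=` O ->
  sigma ^+ (2 * P.+1) * \sum_(a : mindex d P.+1 | morder (mval a) == P.+1)
      sqint (element sigma i) (mderiv (mval a) v) <=
  C * \sum_(n | corner n) sqint (element sigma i) (fun x => p (node_shift i n) x - p i x).
Proof.
have [C C0 hC] := reference_inverse R d P; exists C => //.
move=> sigma s0 O v p oO vV pp pv i iO.
have [c [pc _ dvc]] := local_form_reference s0 i oO pp pv.
have ii l : `|i ord0 l - i ord0 l| <= 1 by rewrite subrr normr0.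
have [r ir] := element_bounded s0 i.
have r0 : (fun l => (i ord0 l - i ord0 l)%:~R) = (fun=> 0) :> ('I_d -> R).
  by apply/funext => l; rewrite subrr.
have dE (a : mindex d P.+1) : morder (mval a) == P.+1 ->
    sqint (element sigma i) (mderiv (mval a) v) =
    sigma ^+ d * (sigma^-1 ^+ (2 * P.+1) * sqint (refcell (fun=> 0)) (tsum c (dtens bref (mval a)))).
  move=> /eqP aP.
  have [mdv _] := bmeas_Vspace s0 (mval a) oO vV iO (measurable_element sigma i) ir.
  rewrite (sqint_element_reference s0 iO ii mdv (dvc _)) r0.
  rewrite aP sqintZ; first by rewrite -exprM (mulnC P.+1 2).
  - exact: measurable_refcell.
  - exact: leb_refcell.
  - apply: bmeas_lincomb => x; apply: bmeas_refcell => l.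
    by apply: smooth1_dtens => s k; exact: smooth1_bref.
rewrite (eq_bigr _ dE) -!mulr_sumr [sigma ^+ (2 * _) * _]mulrCA.
rewrite [sigma ^+ (2 * _) * _]mulrA -exprMn divff ?gt_eqF// expr1n mul1r.
have ic : node_shift i (center_node d) = i.
  by apply/rowP => l; rewrite !mxE ffunE inordK// addrK.
have mp k : bmeas (element sigma i) (p k).
  have /polyfunP[c' ->] := pp k.
  exact: (@bmeas_tsum _ _ _ _ (pidx d P) c' (fun a l t => t ^+ mval (val a) l) (fun a l => smooth1X _ _) ir).
have pE (n : win d) : sqint (element sigma i) (fun x => p (node_shift i n) x - p i x) =
    sigma ^+ d * sqint (refcell (fun=> 0)) (fun y => refpoly c n y - refpoly c (center_node d) y).
  rewrite (sqint_element_reference (g := fun y => refpoly c n y - refpoly c (center_node d) y) s0 iO ii).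
  - by rewrite r0.
  - by apply: measurable_funB; [exact: (mp _).1|exact: (mp _).1].
  - by move=> y _ _; rewrite -!pc ic.
under [X in _ <= _ * X]eq_bigr do rewrite pE.
by rewrite -mulr_sumr mulrCA ler_pM2l ?exprn_gt0.
Qed.

End local_inequalities.

(** * Weak derivatives *)

Section density.
Context (R : realType) (dd : measure_display) (T : measurableType dd)
  (mu : {measure set T -> \bar R}).
Variable f : T -> \bar R.
Hypotheses (mf : measurable_fun setT f) (f0 : forall x, (0 <= f x)%E).

(** Turns a nonnegative function into a measure, so that integrals over boxes determine it through
    uniqueness of measures. *)
Definition density : set T -> \bar R := fun A => (\int[mu]_(x in A) f x)%E.

Let density0 : density set0 = 0%E.
Proof. exact: integral_set0. Qed.

Let density_ge0 A : (0 <= density A)%E.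
Proof. exact: integral_ge0. Qed.

Let density_sigma_additive : semi_sigma_additive density.
Proof. exact: semi_sigma_additive_nng_induced. Qed.

HB.instance Definition _ := isMeasure.Build _ _ _ density
  density0 density_ge0 density_sigma_additive.

Definition density_measure : {measure set T -> \bar R} := density.

End density.

(** * Functions determined by their integrals over boxes *)

Section variational_lemma.
Variables (R : realType) (d : nat).
Local Notation rV := 'rV[R]_d.
Local Notation leb := (lebesgue_rV R d).

(** The positive and negative parts are densities of two finite measures that agree on boxes, hence
    on all measurable sets. *)
Lemma obox_integral_eq0 (f : rV -> \bar R) : leb.-integrable setT f ->
  (forall a b, \int[leb]_(x in obox a b) f x = 0)%E ->
  ae_eq leb setT f (cst 0%E).
Proof.
move=> fi f0; have mf := measurable_int _ fi.
have mp : measurable_fun setT (f^\+)%E by exact: measurable_funepos.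
have mn : measurable_fun setT (f^\-)%E by exact: measurable_funeneg.
pose m1 := density_measure leb mp (funepos_ge0 f).
pose m2 := density_measure leb mn (funeneg_ge0 f).
have fin A : measurable A -> (\int[leb]_(x in A) f^\+ x)%E \is a fin_num /\
    (\int[leb]_(x in A) f^\- x)%E \is a fin_num.
  move=> mA; have fA : leb.-integrable A f by exact: integrableS fi.
  by split; apply: integrable_fin_num => //;
    [exact: integrable_funepos|exact: integrable_funeneg].
have m12 A : measurable A -> m1 A = m2 A.
  apply: rV_measure_unique => a b.
    have [fp fn] := fin _ (measurable_obox a b).
    have := f0 a b; rewrite integralE => /eqP.
    by rewrite sube_eq ?fin_num_adde_defl// add0e => /eqP.
  have [fp _] := fin _ (measurable_obox a b).
  by rewrite ltey_eq fp.
apply: (integral_ae_eq measurableT fi); first exact: measurable_cst.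
move=> E _ mE; rewrite integral0 integralE.
have -> : (\int[leb]_(x in E) f^\+ x = \int[leb]_(x in E) f^\- x)%E by exact: m12.
by rewrite subee//; have [] := fin _ mE.
Qed.

(** Smooth approximations from inside of the indicator of a box. *)
Definition step (t : R) : R := (@zeta_mass R)^-1 * zprim (t - 2^-1).

Lemma smooth1_step : smooth1 step.
Proof.
apply: smooth1M (smooth1_cst _) _.
apply: smooth1_comp (@smooth1_zprim R) _.
exact: smooth1B (@smooth1_id R) (smooth1_cst _).
Qed.

Lemma step_le0 t : t <= 0 -> step t = 0.
Proof. by move=> t0; rewrite /step zprim_le ?mulr0//; lra. Qed.

Lemma step_ge1 t : 1 <= t -> step t = 1.
Proof.
by move=> t1; rewrite /step zprim_ge ?mulVf// ?gt_eqF ?zeta_mass_gt0//; lra.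
Qed.

Lemma zprim_homo (x y : R) : x <= y -> zprim x <= zprim y.
Proof.
rewrite le_eqVlt => /predU1P[->//|xy]; rewrite -subr_ge0.
have [c -> c0] := zprimB xy; apply: mulr_ge0 => //; lra.
Qed.

Lemma step_bounds t : 0 <= step t <= 1.
Proof.
have m0 := zeta_mass_gt0 R.
have h1 : 0 <= zprim (t - 2^-1).
  have [t0|t0] := leP t 0; first by rewrite zprim_le//; lra.
  by rewrite -(@zprim_le R (- 2^-1)) ?zprim_homo//; lra.
have h2 : zprim (t - 2^-1) <= @zeta_mass R.
  have [t1|t1] := leP 1 t; first by rewrite zprim_ge//; lra.
  by rewrite -(@zprim_ge R 2^-1) ?zprim_homo//; lra.
rewrite /step mulr_ge0 ?invr_ge0 ?(ltW m0)//=.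
by rewrite ler_pdivrMl// mulr1.
Qed.

(** For [n > 0] each factor passes from 0 to 1 within distance [1/n] of its end of the interval. *)
Definition bump1 (a b : 'I_d -> R) (n : nat) (l : 'I_d) (t : R) : R :=
  step (n%:R * (t - a l)) * step (n%:R * (b l - t)).

Definition box_bump a b n : rV -> R :=
  tsum (fun=> 1) (fun (_ : unit) => bump1 a b n).

Lemma box_bumpE a b n x : box_bump a b n x = \prod_l bump1 a b n l (x ord0 l).
Proof. by rewrite /box_bump /tsum (big_pred1 tt) ?mul1r//; case. Qed.

Lemma smooth1_bump1 a b n l : smooth1 (bump1 a b n l).
Proof.
have h1 : smooth1 (fun t : R => step (n%:R * (t - a l))).
  apply: smooth1_comp smooth1_step _; apply: smooth1M (smooth1_cst _) _.
  exact: smooth1B (@smooth1_id R) (smooth1_cst _).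
have h2 : smooth1 (fun t : R => step (n%:R * (b l - t))).
  apply: smooth1_comp smooth1_step _; apply: smooth1M (smooth1_cst _) _.
  exact: smooth1B (smooth1_cst _) (@smooth1_id R).
exact: smooth1M h1 h2.
Qed.

Lemma box_bump_out a b n x : ~ obox a b x -> box_bump a b n x = 0.
Proof.
move=> /existsNP[l /negP]; rewrite negb_and -!leNgt box_bumpE (bigD1 l)//=.
case/orP => h; rewrite /bump1.
  by rewrite step_le0 ?mul0r// mulr_ge0_le0// subr_le0.
by rewrite [X in _ * X * _]step_le0 ?mulr0 ?mul0r// mulr_ge0_le0// subr_le0.
Qed.

Lemma box_bump_bounds a b n x : 0 <= box_bump a b n x <= 1.
Proof.
have h l : 0 <= bump1 a b n l (x ord0 l) <= 1.
  have /andP[h1 h2] := step_bounds (n%:R * (x ord0 l - a l)).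
  have /andP[h3 h4] := step_bounds (n%:R * (b l - x ord0 l)).
  by rewrite /bump1 mulr_ge0//= mulr_ile1.
rewrite box_bumpE prodr_ge0 => [|l _]; last by have /andP[] := h l.
by apply: prodr_ile1 => l _; exact: h.
Qed.

Lemma test_function_bump O a b n :
  [set x : rV | forall l, a l <= x ord0 l <= b l] `<=` O ->
  test_function O (box_bump a b n).
Proof.
move=> abO; split; first by apply: smooth_tsum => _ l; exact: smooth1_bump1.
exists [set x : rV | forall l, `[a l, b l]%classic (x ord0 l)]; split.
- by apply: (@rV_compact R d (fun l => `[a l, b l]%classic)) => l; exact: segment_compact.
- by move=> x /= h; apply: abO => l /=; have := h l; rewrite in_itv.
- move=> x h; apply: box_bump_out => abx; apply: h => l /=.
  by have /andP[/ltW h1 /ltW h2] := abx l; rewrite in_itv/= h1 h2.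
Qed.

Lemma box_bump_cvg a b x : obox a b x -> \forall n \near \oo, box_bump a b n x = 1.
Proof.
move=> abx.
pose N l := (Num.truncn (x ord0 l - a l)^-1 + Num.truncn (b l - x ord0 l)^-1).+2.
exists (\sum_l N l)%N => // n /= Nn; rewrite box_bumpE big1// => l _.
have /andP[h1 h2] := abx l.
have Nl : (N l <= n)%N by apply: leq_trans Nn; rewrite (bigD1 l)//= leq_addr.
have big (u : R) : 0 < u -> (Num.truncn u^-1 < n)%N -> 1 <= n%:R * u.
  move=> u0 un; rewrite -ler_pdivrMr// mul1r.
  apply: (le_trans (ltW (truncnS_gt u^-1))).
  by rewrite ler_nat.
by rewrite /bump1 !step_ge1 ?mulr1//; apply: big; rewrite ?subr_gt0//; apply: leq_trans Nl;
  rewrite /N; lia.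
Qed.

(** Extended-real companion of [sqint], faithful also when the integral is infinite. *)
Definition nsq (O : set rV) (f : rV -> R) : \bar R := (\int[leb]_(x in O) (f x ^+ 2)%:E)%E.

Lemma nsq_ge0 O f : (0 <= nsq O f)%E.
Proof. by apply: integral_ge0 => x _; rewrite lee_fin sqr_ge0. Qed.

Lemma L2normE O f : L2norm O f = (nsq O f `^ 2^-1)%E.
Proof.
rewrite /L2norm unlock /nsq [in RHS]integral_mkcond; congr (_ `^ _)%E.
apply: eq_integral => x _ /=.
transitivity (`|(f \_ O) x|%:E `^ 2)%E; first by [].
rewrite poweR_EFin powR_mulrn// real_normK ?num_real//.
by rewrite !patchE; case: ifP => //; rewrite expr0n.
Qed.

Lemma sqr_poweR2V (x : \bar R) : (0 <= x)%E -> ((x `^ 2^-1) ^+ 2 = x)%E.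
Proof.
case: x => [r|//|//]; last by rewrite poweRyr ?invr_neq0// expe2 mulyy.
rewrite lee_fin => r0; rewrite poweR_EFin -EFin_expe powR12_sqrt//.
by rewrite sqr_sqrtr.
Qed.

Lemma L2norm_sqr O f : (L2norm O f ^+ 2 = nsq O f)%E.
Proof. by rewrite L2normE sqr_poweR2V// nsq_ge0. Qed.

Lemma L2P O f : measurable O ->
  L2 O f <-> measurable_fun O f /\ (nsq O f < +oo)%E.
Proof.
move=> mO.
have E : (L2norm O f < +oo)%E <-> (nsq O f < +oo)%E.
  rewrite L2normE; split; last exact: poweR_lty.
  rewrite !ltey => /eqP h; apply/eqP => h'; apply: h.
  by rewrite h' poweRyr ?invr_neq0.
split.
  move=> /andP[/set_mem mf /set_mem fO]; split; last exact/E.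
  exact/(measurable_restrictT _ mO).
move=> [mf fO]; apply/andP; split; apply/mem_set; last exact/E.
exact/(measurable_restrictT _ mO).
Qed.

(** On a set of finite measure, [|f| <= 1 + f ^+ 2] has an integrable right-hand side. *)
Lemma L2_integrable O B f : measurable O -> L2 O f -> measurable B -> B `<=` O ->
  (leb B < +oo)%E -> leb.-integrable B (EFin \o f).
Proof.
move=> mO /(L2P _ mO)[mf foo] mB BO Boo.
have mfB : measurable_fun B f by exact: measurable_funS mf.
have mf2 : measurable_fun O (fun x => (f x ^+ 2)%:E).
  apply/measurable_EFinP; have := measurable_funM mf mf.
  by apply: eq_measurable_fun => x _; rewrite expr2.
have i2 : leb.-integrable B (fun x => (1 + f x ^+ 2)%:E).
  apply/integrableP; split.
    apply/measurable_EFinP; apply: measurable_funD => //.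
    by apply/measurable_EFinP; exact: measurable_funS mf2.
  under eq_integral => x _.
    rewrite gee0_abs; last by rewrite lee_fin addr_ge0// sqr_ge0.
    rewrite EFinD; over.
  rewrite ge0_integralD//.
  - rewrite integral_cst// mul1e lte_add_pinfty//; apply: le_lt_trans foo.
    by apply: ge0_subset_integral => // x _; rewrite lee_fin sqr_ge0.
  - by move=> x _; rewrite lee_fin sqr_ge0.
  - exact: measurable_funS mf2.
apply: le_integrable i2 => //; first exact/measurable_EFinP.
move=> x Bx; rewrite /= lee_fin [leRHS]ger0_norm; last by rewrite addr_ge0// sqr_ge0.
rewrite -[f x ^+ 2]real_normK ?num_real//; have := normr_ge0 (f x); nra.
Qed.

Lemma L2S (O O' : set rV) f : measurable O -> measurable O' -> O' `<=` O -> L2 O f -> L2 O' f.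
Proof.
move=> mO mO' OO' /(L2P _ mO)[mf foo]; apply/(L2P _ mO'); split.
  exact: measurable_funS mf.
apply: le_lt_trans foo; apply: ge0_subset_integral => //.
- apply/measurable_EFinP; have := measurable_funM mf mf.
  by apply: eq_measurable_fun => x _; rewrite expr2.
- by move=> x _; rewrite lee_fin sqr_ge0.
Qed.

End variational_lemma.

(** * Uniqueness and restriction of weak derivatives *)

Section weak_derivatives.
Variables (R : realType) (d : nat).
Local Notation rV := 'rV[R]_d.
Local Notation leb := (lebesgue_rV R d).
Implicit Types (O : set rV) (f g : rV -> R).

Lemma measurable_bump a b n : measurable_fun [set: rV] (box_bump a b n).
Proof.
rewrite (_ : box_bump a b n = fun x => \prod_l bump1 a b n l (x ord0 l)); last first.
  by apply/funext => x; exact: box_bumpE.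
apply: measurable_prod => l _.
have mh := continuous_measurableT (smooth1_continuous (smooth1_bump1 a b n l)).
exact: measurableT_comp mh (@measurable_coord R d l).
Qed.

Lemma bump_integral_cvg O f a b : measurable O -> L2 O f ->
  [set x : rV | forall l, a l <= x ord0 l <= b l] `<=` O ->
  (\int[leb]_(x in obox a b) (f x * box_bump a b n x)%:E @[n --> \oo] -->
   \int[leb]_(x in obox a b) (f x)%:E)%E.
Proof.
move=> mO fO abO; have mB := measurable_obox a b.
have BO : obox a b `<=` O.
  by move=> x abx; apply: abO => l; have /andP[/ltW -> /ltW ->] := abx l.
have fi := L2_integrable mO fO mB BO (leb_obox_fin a b).
have mf : measurable_fun (obox a b) f by apply/measurable_EFinP; exact: measurable_int fi.
have [] := @dominated_convergence _ _ _ leb (obox a b) mB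
  (fun n x => (f x * box_bump a b n x)%:E) (EFin \o f) (fun x => `|f x|%:E).
- move=> n; apply/measurable_EFinP; apply: measurable_funM => //.
  by apply: measurable_funS (measurable_bump a b n).
- exact/measurable_EFinP.
- apply: aeW => x abx; apply: cvg_near_cst.
  have := box_bump_cvg abx; apply: filterS => n ->; by rewrite mulr1.
- exact: eq_integrable (integrable_abse fi).
- apply: aeW => x n abx; rewrite /= lee_fin normrM ler_piMr//.
  by have /andP[h0 h1] := box_bump_bounds a b n x; rewrite ger0_norm.
by move=> _ _; exact.
Qed.

Lemma bump_Rintegral O f a b n : measurable O -> L2 O f ->
  [set x : rV | forall l, a l <= x ord0 l <= b l] `<=` O ->
  (\int[leb]_(x in obox a b) (f x * box_bump a b n x)%:E)%E =
  (\int[leb]_(x in O) (f x * box_bump a b n x))%:E.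
Proof.
move=> mO fO abO; have mB := measurable_obox a b.
have BO : obox a b `<=` O.
  by move=> x abx; apply: abO => l; have /andP[/ltW -> /ltW ->] := abx l.
have fi := L2_integrable mO fO mB BO (leb_obox_fin a b).
have mf : measurable_fun (obox a b) f by apply/measurable_EFinP; exact: measurable_int fi.
have fbi : leb.-integrable (obox a b) (fun x => (f x * box_bump a b n x)%:E).
  apply: le_integrable fi => //.
    apply/measurable_EFinP; apply: measurable_funM => //.
    by apply: measurable_funS (measurable_bump a b n).
  move=> x abx; rewrite /= lee_fin normrM ler_piMr//.
  by have /andP[h0 h1] := box_bump_bounds a b n x; rewrite ger0_norm.
rewrite -(fineK (integrable_fin_num mB fbi)); congr EFin.
rewrite -/(Rintegral leb (obox a b) (fun x => f x * box_bump a b n x)).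
rewrite Rintegral_mkcond [RHS]Rintegral_mkcond; apply: eq_Rintegral => x _.
rewrite !patchE; case: ifPn => [/set_mem /BO Ox|/negP xB]; first by rewrite mem_set.
by case: ifPn => // _; rewrite box_bump_out ?mulr0// => abx; apply: xB; rewrite inE.
Qed.

(** Fundamental lemma of the calculus of variations. Dominated convergence replaces the bumps by
    indicators of boxes with closed hull in [O], and countably many such boxes cover [O]. *)
Lemma test_function_unique O f g : open O -> L2 O f -> L2 O g ->
  (forall psi, test_function O psi ->
     \int[leb]_(x in O) (f x * psi x) = \int[leb]_(x in O) (g x * psi x)) ->
  {ae leb, forall x, O x -> f x = g x}.
Proof.
move=> oO fO gO fg; have mO := open_measurable_rV oO.
have box_eq a b : [set x : rV | forall l, a l <= x ord0 l <= b l] `<=` O ->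
    (\int[leb]_(x in obox a b) (f x)%:E = \int[leb]_(x in obox a b) (g x)%:E)%E.
  move=> abO; have cf := bump_integral_cvg mO fO abO; have cg := bump_integral_cvg mO gO abO.
  apply: (cvg_unique _ cf) => //.
  rewrite (_ : (fun n => _) = (fun n => \int[leb]_(x in obox a b) (g x * box_bump a b n x)%:E)%E)//.
  apply/funext => n; rewrite (bump_Rintegral n mO fO abO) (bump_Rintegral n mO gO abO).
  by rewrite fg//; exact: test_function_bump.
have [D [a [b [abO OE]]]] := open_bigcup_obox oO.
have : leb.-negligible (\bigcup_k [set x | D k /\ obox (a k) (b k) x /\ f x <> g x]).
  apply: negligible_bigcup => k.
  have [Dk|nDk] := pselect (D k); last first.
    by apply: negligibleS (negligible_set0 leb) => x [].
  pose B := obox (a k) (b k); have mB : measurable B := measurable_obox _ _.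
  have BO : B `<=` O by move=> x Bx; rewrite OE; exists k.
  have fi := L2_integrable mO fO mB BO (leb_obox_fin _ _).
  have gi := L2_integrable mO gO mB BO (leb_obox_fin _ _).
  pose h x := (((f x)%:E - (g x)%:E))%E.
  have hi : leb.-integrable B h by exact: integrableB.
  (* Extended by 0 outside [B], the difference has integral 0 over every box, because the
     intersection of two boxes is a box. *)
  have h0 : ae_eq leb setT (h \_ B) (cst 0%E).
    apply: obox_integral_eq0; first exact/(integrable_mkcond _ mB).1.
    move=> a' b'; rewrite -integral_mkcondl setIC setI_obox.
    set C := obox _ _; have mC : measurable C by exact: measurable_obox.
    have CB : C `<=` B.
      move=> x Cx l; have := Cx l; rewrite gt_max lt_min.
      by move=> /andP[/andP[? ?] /andP[? ?]]; apply/andP; split.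
    have fC := integrableS mB mC CB fi; have gC := integrableS mB mC CB gi.
    rewrite integralB//= box_eq.
      by rewrite subee//; exact: integrable_fin_num.
    move=> x xab; apply: (abO _ Dk) => l; have := xab l.
    by rewrite ge_max le_min => /andP[/andP[_ ->] /andP[_ ->]].
  apply: negligibleS h0 => x /= [_ [Bx fgx]] hx; apply: fgx.
  have := hx I; rewrite /h patchE mem_set//= => /eqP.
  by rewrite -EFinB eqe subr_eq0 => /eqP.
apply: negligibleS => x /= /not_implyP[Ox fgx].
by move: (Ox); rewrite OE => -[k Dk Bx]; exists k.
Qed.

Lemma is_wderiv_unique O e f g1 g2 : open O -> is_wderiv O e f g1 -> is_wderiv O e f g2 ->
  {ae leb, forall x, O x -> g1 x = g2 x}.
Proof.
move=> oO [L1 h1] [L2' h2]; apply: test_function_unique => // psi tpsi.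
have := h1 _ tpsi; rewrite h2// => /(@mulfI _ _ _) <-//.
by rewrite signr_eq0.
Qed.

Lemma pderiv_outside (K : set rV) f l : closed K -> (forall x, ~ K x -> f x = 0) ->
  forall x, ~ K x -> pderiv l f x = 0.
Proof.
move=> cK f0 x Kx; rewrite (@pderiv_local _ _ (~` K) l f (fun=> 0))//.
  by rewrite /pderiv -/(cst 0) derive_cst.
exact: closed_openC.
Qed.

Lemma mderiv_outside (K : set rV) f a : closed K -> (forall x, ~ K x -> f x = 0) ->
  forall x, ~ K x -> mderiv a f x = 0.
Proof.
move=> cK f0; rewrite /mderiv; elim: (enum 'I_d) => [//|l s IH] /=.
elim: (a l) => [|n IHn]; first exact: IH.
by rewrite iterS; exact: pderiv_outside.
Qed.

(** A test function on [O'] is one on [O], and the integrals only see its compact support. *)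
Lemma is_wderiv_restrict O O' e f g : measurable O -> measurable O' -> O' `<=` O ->
  is_wderiv O e f g -> is_wderiv O' e f g.
Proof.
move=> mO mO' OO' [gL h]; split; first exact: L2S gL.
move=> psi [spsi [K [cK KO' psi0]]].
have clK : closed K by apply: compact_closed => //; exact: norm_hausdorff.
have tO : test_function O psi by split=> //; exists K; split => // x /KO'/OO'.
have E (u v : rV -> R) : (forall x, ~ K x -> v x = 0) ->
    \int[leb]_(x in O') (u x * v x) = \int[leb]_(x in O) (u x * v x).
  move=> v0; rewrite Rintegral_mkcond [RHS]Rintegral_mkcond; apply: eq_Rintegral => x _.
  rewrite !patchE; have [Kx|Kx] := pselect (K x).
    by rewrite !mem_set//; [apply: OO'|]; exact: KO'.
  by rewrite v0// mulr0 !if_same.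
rewrite E; last exact: mderiv_outside.
by rewrite E// h.
Qed.

Lemma wderivP O e f : (exists g, is_wderiv O e f g) -> is_wderiv O e f (wderiv O e f).
Proof. by move=> [g hg]; rewrite /wderiv; exact: (xgetPex (fun=> 0) (ex_intro _ g hg)). Qed.

Lemma sobolev_restrict O O' k f : measurable O -> measurable O' -> O' `<=` O ->
  sobolev O k f -> sobolev O' k f.
Proof.
move=> mO mO' OO' [fL h]; split; first exact: L2S fL.
by move=> a /h[g hg]; exists g; exact: is_wderiv_restrict hg.
Qed.

Lemma ae_eq_nsq O f g : {ae leb, forall x, O x -> f x = g x} ->
  measurable O -> measurable_fun O f -> measurable_fun O g -> nsq O f = nsq O g.
Proof.
have msq (u : rV -> R) : measurable_fun O u -> measurable_fun O (fun x => (u x ^+ 2)%:E).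
  move=> mu; apply/measurable_EFinP; have := measurable_funM mu mu.
  by apply: eq_measurable_fun => x _; rewrite expr2.
move=> fg mO mf mg; apply: ae_eq_integral => //; try exact: msq.
by apply: filterS fg => x fg Ox; rewrite fg.
Qed.

Lemma L2_measurable O f : measurable O -> L2 O f -> measurable_fun O f.
Proof. by move=> mO /(L2P _ mO)[]. Qed.

(** The representatives chosen by [wderiv] on [O] and on [O'] are unrelated, but uniqueness makes
    them agree almost everywhere on [O']. *)
Lemma nsq_wderiv_restrict O O' k e f : open O -> open O' -> O' `<=` O ->
  sobolev O k f -> (morder e <= k)%N ->
  nsq O' (wderiv O' e f) = nsq O' (wderiv O e f).
Proof.
move=> oO oO' OO' [fL h] ek.
have mO := open_measurable_rV oO; have mO' := open_measurable_rV oO'.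
have w := wderivP (h e ek).
have w2 := is_wderiv_restrict mO mO' OO' w.
have w1 := wderivP (ex_intro _ _ w2).
apply: ae_eq_nsq => //.
- exact: is_wderiv_unique w1 w2.
- by apply: L2_measurable => //; case: w1.
- by apply: L2_measurable => //; case: w2.
Qed.

Lemma seminorm_sqr O k f : (sobolev_seminorm O k f ^+ 2 =
  \sum_(a : mindex d k | morder (mval a) == k) nsq O (wderiv O (mval a) f))%E.
Proof.
rewrite /sobolev_seminorm sqr_poweR2V.
  by apply: eq_bigr => a _; rewrite L2norm_sqr.
by apply: sume_ge0 => a _; rewrite L2norm_sqr nsq_ge0.
Qed.

Lemma seminorm_ge0 O k f : (0 <= sobolev_seminorm O k f)%E.
Proof. exact: poweR_ge0. Qed.

(** The function is a weak derivative of order 0 of itself, so the chosen representative agrees with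
    it almost everywhere. *)
Lemma nsq_le_seminorm0 O f : open O -> L2 O f ->
  (nsq O f <= sobolev_seminorm O 0 f ^+ 2)%E.
Proof.
move=> oO fL; have mO := open_measurable_rV oO.
rewrite seminorm_sqr (bigD1 [ffun=> ord0])/=; last first.
  by rewrite /morder big1// => l _; rewrite /mval ffunE.
set e := mval _; have e0 l : e l = 0%N by rewrite /e /mval ffunE.
have me : morder e = 0%N by rewrite /morder big1.
have w2 : is_wderiv O e f f.
  by split => // psi _; rewrite mderiv0// me expr0 mul1r.
have w1 := wderivP (ex_intro _ _ w2).
rewrite (@ae_eq_nsq O f (wderiv O e f))//.
- by rewrite leeDl// sume_ge0// => a _; exact: nsq_ge0.
- exact: is_wderiv_unique w2 w1.
- exact: L2_measurable.
- by apply: L2_measurable => //; case: w1.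
Qed.

(** The approximation constant [CBH] comes without a sign, hence the detour through [|k|]. *)
Lemma lee_sqr_scale (k : R) (x y : \bar R) : (0 <= x)%E -> (0 <= y)%E ->
  (x <= k%:E * y)%E -> (x ^+ 2 <= (k ^+ 2)%:E * y ^+ 2)%E.
Proof.
move=> x0 y0 xky.
have xy : (x <= `|k|%:E * y)%E.
  by apply: (le_trans xky); rewrite lee_wpmul2r// lee_fin ler_norm.
have -> : ((k ^+ 2)%:E * y ^+ 2 = (`|k|%:E * y) * (`|k|%:E * y))%E.
  rewrite -[k ^+ 2]real_normK ?num_real// expe2 EFin_expe expe2.
  by rewrite muleACA.
by rewrite expe2 lee_pmul.
Qed.

End weak_derivatives.

(** * Grid geometry *)

Section grid_geometry.
Variables (R : realType) (d : nat) (sigma : R).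
Hypothesis sigma_gt0 : 0 < sigma.
Local Notation rV := 'rV[R]_d.
Local Notation idx := 'rV[int]_d.
Local Notation leb := (lebesgue_rV R d).
Local Notation element := (@element R d sigma).
Local Notation fictitious := (@fictitious R d sigma).

(** A small move from [y] toward the center of the box enters the open box. *)
Lemma closed_hull_closure (a b : 'I_d -> R) (y : rV) : (forall l, a l < b l) ->
  (forall l, a l <= y ord0 l <= b l) -> closure (obox a b) y.
Proof.
move=> ab yab B /nbhs_ballP[e /= e0 eB].
pose c : rV := \row_l ((a l + b l) / 2).
have abc : obox a b c by move=> l; rewrite mxE; have abl := ab l; apply/andP; split; lra.
pose M := \sum_l `|c ord0 l - y ord0 l|; have M0 : 0 <= M by rewrite sumr_ge0.
pose t := Num.min 2^-1 (e / (M + 1)).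
have t0 : 0 < t by rewrite lt_min; apply/andP; split; [lra|rewrite divr_gt0//; lra].
have t1 : t < 1 by rewrite gt_min; apply/orP; left; lra.
have te : t * (M + 1) <= e by rewrite -ler_pdivlMr ?ge_min ?lexx ?orbT//; lra.
exists (t *: (c - y) + y); split; first by apply: obox_segment; rewrite ?t0.
apply: eB; rewrite ball_obox// => l; rewrite !mxE.
have : `|t * ((a l + b l) / 2 - y ord0 l)| < e.
  rewrite normrM (gtr0_norm t0); apply: lt_le_trans te; rewrite ltr_pM2l//.
  apply: (@le_lt_trans _ _ M); last lra.
  by rewrite /M (bigD1 l)//= mxE lerDl sumr_ge0.
by rewrite ltr_norml => /andP[h1 h2]; apply/andP; split; lra.
Qed.

Lemma closure_closed_hull (a b : 'I_d -> R) (y : rV) : closure (obox a b) y ->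
  forall l, a l <= y ord0 l <= b l.
Proof.
move=> cy l; apply/andP; split; rewrite leNgt; apply/negP => h.
  have /cy[z [abz]] : nbhs y (ball y (a l - y ord0 l)).
    by apply: nbhsx_ballx; rewrite subr_gt0.
  rewrite ball_obox ?subr_gt0// => /(_ l) /andP[_ h2].
  by have /andP[h3 _] := abz l; lra.
have /cy[z [abz]] : nbhs y (ball y (y ord0 l - b l)).
  by apply: nbhsx_ballx; rewrite subr_gt0.
rewrite ball_obox ?subr_gt0// => /(_ l) /andP[h2 _].
by have /andP[_ h3] := abz l; lra.
Qed.

Lemma element_open i : open (element i).
Proof. exact: obox_open. Qed.

Lemma element_inj i j x : element i x -> element j x -> i = j.
Proof.
move=> ix jx; apply/rowP => l; suff : i ord0 l = j ord0 l by [].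
have /andP[h1 h2] := ix l; have /andP[h3 h4] := jx l.
have := lt_trans h1 h4; have := lt_trans h3 h2.
rewrite !ltr_pM2r// -!(intrD _ _ 1) !ltr_int; lia.
Qed.

Lemma element_lt (i : idx) (l : 'I_d) : (i ord0 l)%:~R * sigma < ((i ord0 l)%:~R + 1) * sigma.
Proof. by rewrite ltr_pM2r// ltrDl. Qed.

Lemma element_neq0 i : element i !=set0.
Proof.
exists (\row_l (((i ord0 l)%:~R + 2^-1) * sigma)) => l; rewrite mxE !ltr_pM2r//.
by apply/andP; split; lra.
Qed.

Lemma elements_domain_open (I : set idx) : open (elements_domain sigma I).
Proof. exact: open_interior. Qed.

(** A closed element through [x] meets the open element [i], and distinct elements are disjoint. So
    passing to the interior of a union of closed elements adds no element. *)
Lemma elements_domain_in (I : set idx) i x :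
  elements_domain sigma I x -> element i x -> I i.
Proof.
move=> Ix ix; have [j Ij] := interior_subset Ix.
move=> /(_ (element i)) [|z [jz iz]]; first by apply: open_nbhs_nbhs; split; [exact: element_open|].
by rewrite (element_inj iz jz).
Qed.

Lemma element_elements_domain (I : set idx) i :
  element i `<=` elements_domain sigma I <-> I i.
Proof.
split=> [iI|Ii].
  by have [x ix] := element_neq0 i; exact: elements_domain_in (iI _ ix) ix.
rewrite -open_subsetE; last exact: element_open.
by move=> x ix; exists i => //; exact: subset_closure.
Qed.

Lemma elements_domain_sub (I : set idx) i x :
  elements_domain sigma I x -> element i x -> element i `<=` elements_domain sigma I.
Proof. by move=> Ix ix; apply/element_elements_domain; exact: elements_domain_in ix. Qed.

Lemma fictitious_open Omega : open (fictitious Omega).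
Proof. exact: elements_domain_open. Qed.

Lemma element_fictitious Omega i :
  element i `<=` fictitious Omega <-> (0 < leb (element i `&` Omega))%E.
Proof. exact: element_elements_domain. Qed.

(** Any point near [x] is in the closure of an element; this element meets a box inside [Omega] in a
    nonempty open set, hence in positive measure. *)
Lemma sub_fictitious Omega : open Omega -> Omega `<=` fictitious Omega.
Proof.
move=> oO x Ox; have [e e0 eO] := open_obox_nbhs oO Ox.
set B := obox _ _ in eO.
have oB : open B by exact: obox_open.
have : B x by move=> l; apply/andP; split; lra.
suff : B `<=` (fictitious Omega) by apply.
rewrite -open_subsetE// => y By.
pose j : idx := \row_l Num.floor (y ord0 l / sigma).
have cy : closure (element j) y.
  apply: closed_hull_closure => l; first exact: element_lt.
  rewrite mxE; have /andP[h1 h2] := floor_itv (y ord0 l / sigma).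
  rewrite ler_pdivlMr// in h1; rewrite ltr_pdivrMr// intrD in h2.
  by rewrite h1 ltW.
exists j => //=.
have [z [jz Bz]] : (element j `&` B) !=set0 by apply: cy; exact: open_nbhs_nbhs.
have oI : open (element j `&` B) by apply: openI => //; exact: element_open.
have [r r0 rI] := open_obox_nbhs oI (conj jz Bz).
set C := obox _ _ in rI.
apply: (@lt_le_trans _ _ (leb C)); first by apply: leb_obox_gt0 => l; lra.
apply: le_measure; rewrite ?inE.
- exact: measurable_obox.
- by apply: measurableI; [exact: measurable_element|exact: open_measurable_rV].
- by move=> w /rI[jw Bw]; split => //; exact: eO.
Qed.

Lemma neighbors_dist (i j : idx) : neighbors sigma i j ->
  forall l, `|i ord0 l - j ord0 l| <= 1.
Proof.
move=> [n [ci cj]] l.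
have := closure_closed_hull ci l; have := closure_closed_hull cj l.
rewrite !mxE !ler_pM2r// -!(intrD _ _ 1) !ler_int ler_norml.
by move=> /andP[? ?] /andP[? ?]; apply/andP; split; lia.
Qed.

Lemma bounded_coord Omega : bounded_set Omega ->
  exists r : R, forall x : rV, Omega x -> forall l, `|x ord0 l| <= r.
Proof.
move=> [M [_ hM]]; exists (`|M| + 2) => x Ox l.
have h : `|x| <= `|M| + 1 by apply: hM => //; rewrite (le_lt_trans (ler_norm M))// ltrDl.
have M2 : 0 < `|M| + 2 by rewrite ltr_wpDl.
have : ball (0 : rV) (`|M| + 2) x.
  rewrite mx_norm_ball /ball_/= sub0r normrN; apply: (le_lt_trans h); lra.
rewrite ball_obox// => /(_ l); rewrite mxE ler_norml => /andP[? ?].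
by apply/andP; split; lra.
Qed.

(** An element of the fictitious domain meets [Omega], which bounds its index by about
    [r / sigma]. *)
Lemma finite_elements Omega : bounded_set Omega ->
  exists t : seq idx, uniq t /\ forall i, (i \in t) <-> element i `<=` fictitious Omega.
Proof.
move=> /bounded_coord[r hr].
pose N := (Num.truncn (`|r| / sigma)).+2.
pose f (n : {ffun 'I_d -> 'I_(2 * N).+1}) : idx := \row_l ((n l : nat)%:Z - N%:Z).
pose t := [seq i <- undup [seq f n | n <- enum {ffun 'I_d -> 'I_(2 * N).+1}] |
  `[< element i `<=` fictitious Omega >]].
exists t; split; first by rewrite filter_uniq// undup_uniq.
move=> i; rewrite mem_filter mem_undup; split => [/andP[/asboolP]//|iF].
apply/andP; split; first exact/asboolP.
have [x [ix Ox]] : (element i `&` Omega) !=set0.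
  apply/set0P; apply/eqP => i0; move: iF => /element_fictitious.
  by rewrite i0 measure0 ltxx.
have iN l : - N%:Z <= i ord0 l <= N%:Z.
  have /andP[h1 h2] := ix l; have := hr x Ox l.
  have hN : `|r| / sigma < N%:R - 1.
    have := truncnS_gt (`|r| / sigma); rewrite /N -[X in _ < X - 1]natr1 addrK.
    by [].
  rewrite ltr_pdivrMr// in hN; rewrite ler_norml => /andP[h3 h4].
  have h5 := ler_norm r.
  have h6 : (i ord0 l)%:~R < (N%:R : R) by rewrite -(ltr_pM2r sigma_gt0); nra.
  have h7 : - (N%:R : R) < (i ord0 l)%:~R by rewrite -(ltr_pM2r sigma_gt0); nra.
  have h8 : (i ord0 l)%:~R < ((N%:Z)%:~R : R) by exact: h6.
  have h9 : ((- N%:Z)%:~R : R) < (i ord0 l)%:~R by rewrite intrN; exact: h7.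
  by rewrite !ltr_int in h8 h9; lia.
pose n : {ffun 'I_d -> 'I_(2 * N).+1} := [ffun l => inord (absz (i ord0 l + N%:Z))].
apply/mapP; exists n; first by rewrite mem_enum.
apply/rowP => l; have /andP[h1 h2] := iN l; rewrite !mxE ffunE.
have h0 : 0 <= i ord0 l + N%:Z by lia.
rewrite inordK; last by rewrite -ltz_nat gez0_abs//; lia.
by rewrite gez0_abs//; ring.
Qed.

Lemma nsq_sum_le (S : set rV) (s : seq idx) (f : rV -> R) : measurable S ->
  measurable_fun S f -> uniq s ->
  (\sum_(i <- s) nsq (element i `&` S) f <= nsq S f)%E.
Proof.
move=> mS mf us; rewrite /nsq.
have mf2 : measurable_fun S (fun x => (f x ^+ 2)%:E).
  apply/measurable_EFinP; have := measurable_funM mf mf.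
  by apply: eq_measurable_fun => x _; rewrite expr2.
have mF i : measurable (element i `&` S).
  by apply: measurableI => //; exact: measurable_element.
have sub : \big[setU/set0]_(i <- s) (element i `&` S) `<=` S.
  by rewrite -bigcup_seq => x [i _ []].
have mU : measurable (\big[setU/set0]_(i <- s) (element i `&` S)).
  by apply: bigsetU_measurable.
rewrite -ge0_integral_bigsetU//; first last.
- by move=> x _; rewrite lee_fin sqr_ge0.
- exact: measurable_funS mf2.
- move=> i j _ _ [x [[ix _] [jx _]]]; exact: element_inj ix jx.
by apply: ge0_subset_integral => // x _; rewrite lee_fin sqr_ge0.
Qed.

(** The interfaces between elements are negligible by [ae_element]. *)
Lemma nsq_le_sum (S : set rV) (s : seq idx) (f : rV -> R) : measurable S ->
  measurable_fun S f -> uniq s ->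
  (forall x i, S x -> element i x -> i \in s) ->
  (nsq S f <= \sum_(i <- s) nsq (element i `&` S) f)%E.
Proof.
move=> mS mf us cov; rewrite /nsq.
have mf2 : measurable_fun S (fun x => (f x ^+ 2)%:E).
  apply/measurable_EFinP; have := measurable_funM mf mf.
  by apply: eq_measurable_fun => x _; rewrite expr2.
have mF i : measurable (element i `&` S).
  by apply: measurableI => //; exact: measurable_element.
set U := \big[setU/set0]_(i <- s) (element i `&` S).
have sub : U `<=` S by rewrite /U -bigcup_seq => x [i _ []].
have mU : measurable U by exact: bigsetU_measurable.
rewrite -ge0_integral_bigsetU//; first last.
- by move=> x _; rewrite lee_fin sqr_ge0.
- exact: measurable_funS mf2.
- move=> i j _ _ [x [[ix _] [jx _]]]; exact: element_inj ix jx.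
rewrite -/U.
have -> : (\int[leb]_(x in S) (f x ^+ 2)%:E =
    \int[leb]_(x in S) (((fun x => (f x ^+ 2)%:E) \_ U) x))%E.
  apply: ge0_ae_eq_integral => //.
  - apply/(measurable_restrict _ mU mS); rewrite (setIidr sub).
    exact: measurable_funS mf2.
  - by move=> x _; rewrite lee_fin sqr_ge0.
  - by move=> x _; apply: erestrict_ge0 => y _; rewrite lee_fin sqr_ge0.
  apply: filterS (ae_element d sigma_gt0) => x [i ix] Sx.
  by rewrite patchE mem_set// /U -bigcup_seq; exists i => //=; exact: cov ix.
by rewrite -[X in (X <= _)%E]integral_mkcondr (setIidr sub).
Qed.

End grid_geometry.

(** * Energy estimate *)

Section galerkin.
Variables (R : realType) (d P : nat) (sigma : R).
Hypothesis sigma_gt0 : 0 < sigma.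
Local Notation rV := 'rV[R]_d.
Local Notation idx := 'rV[int]_d.
Local Notation leb := (lebesgue_rV R d).
Local Notation element := (@element R d sigma).
Local Notation fictitious := (@fictitious R d sigma).
Local Notation Vspace := (@Vspace R d sigma P).

Lemma sum_count_mem (V : zmodType) (I : eqType) (s r : seq I) (F : I -> V) :
  uniq r -> {subset s <= r} ->
  \sum_(i <- s) F i = \sum_(i <- r) F i *+ count_mem i s.
Proof.
move=> ur; elim: s => [_|x s IH sr]; first by rewrite big_nil big1// => i _; rewrite mulr0n.
rewrite big_cons IH => [|y ys]; last by apply: sr; rewrite in_cons ys orbT.
have -> : F x = \sum_(i <- r) F i *+ (x == i).
  rewrite (bigD1_seq x)//=; last by apply: sr; rewrite mem_head.
  by rewrite eqxx mulr1n big1 ?addr0// => i; rewrite eq_sym => /negbTE ->; rewrite mulr0n.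
by rewrite -big_split/=; apply: eq_bigr => i _; rewrite mulrnDr.
Qed.

(** The lists may repeat nodes; on their duplicate-free union every coefficient is multiplied by its
    number of occurrences. *)
Lemma VspaceB (O : set rV) v w : Vspace O v -> Vspace O w -> Vspace O (v \- w).
Proof.
move=> [s [c vE]] [s' [c' wE]]; pose r := undup (s ++ s').
have ur : uniq r := undup_uniq _.
have sr : {subset s <= r} by move=> x xs; rewrite mem_undup mem_cat xs.
have sr' : {subset s' <= r} by move=> x xs; rewrite mem_undup mem_cat xs orbT.
exists r, (fun i a => c i a *+ count_mem i s - c' i a *+ count_mem i s') => x Ox.
rewrite /= vE// wE// (sum_count_mem _ ur sr) (sum_count_mem _ ur sr') -sumrB.
apply: eq_bigr => i _; rewrite -!sumrMnl -sumrB; apply: eq_bigr => a _.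
by rewrite mulrBl !mulrnAl.
Qed.

Lemma mderivB_Vspace (O : set rV) v w a x : open O -> Vspace O v -> Vspace O w -> O x ->
  mderiv a (v \- w) x = mderiv a v x - mderiv a w x.
Proof.
move=> oO /(Vspace_tsum sigma_gt0)[Y [c [h [sh vE]]]].
move=> /(Vspace_tsum sigma_gt0)[Y' [c' [h' [sh' wE]]]] Ox.
pose c2 (y : Y + Y') : R := match y with inl y => c y | inr y => - c' y end.
pose h2 (y : Y + Y') := match y with inl y => h y | inr y => h' y end.
have sh2 s l : smooth1 (h2 s l) by case: s => s /=; [exact: sh|exact: sh'].
rewrite (mderiv_local (g := tsum c2 h2) a oO)//; last first.
  move=> y Oy; rewrite /= vE// wE// /tsum big_sumType/= -sumrN; congr (_ + _).
  by apply: eq_bigr => s _; rewrite mulNr.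
rewrite (mderiv_local (g := tsum c h) a oO vE Ox) (mderiv_local (g := tsum c' h') a oO wE Ox).
rewrite !mderiv_tsum// /tsum big_sumType/= -sumrN; congr (_ + _).
by apply: eq_bigr => s _; rewrite mulNr.
Qed.

Lemma element_cut Omega M i : element i `<=` cut_part sigma Omega M <->
  element i `<=` fictitious Omega /\ (~ (element i `<=` Omega) \/ M i).
Proof. exact: element_elements_domain. Qed.

Lemma element_uncut Omega M i : element i `<=` uncut_part sigma Omega M <->
  [/\ element i `<=` fictitious Omega, element i `<=` Omega & ~ M i].
Proof. exact: element_elements_domain. Qed.

(** The contribution of a cut element [i] to [j(v, v)]. *)
Definition dsq (v : rV -> R) (i : idx) : R :=
  sigma ^+ (2 * P.+1) * \sum_(a : mindex d P.+1 | morder (mval a) == P.+1)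
    sqint (element i) (mderiv (mval a) v).

Lemma dsq_ge0 v i : 0 <= dsq v i.
Proof.
by rewrite mulr_ge0 ?exprn_ge0 ?(ltW sigma_gt0)// sumr_ge0// => a _; exact: sqint_ge0.
Qed.

Section energy.
Variables (Omega : set rV) (M : set idx) (eps : R) (tc : seq idx).
Hypotheses (oOmega : open Omega) (bOmega : bounded_set Omega) (eps_gt0 : 0 < eps).
Hypotheses (utc : uniq tc)
  (tcP : forall i, (i \in tc) <-> element i `<=` cut_part sigma Omega M).
Variables (u us wh : rV -> R).
Local Notation O := (fictitious Omega).
Hypotheses (uL2 : L2 O u) (usV : Vspace O us) (whV : Vspace O wh).
Let e := us \- wh.

Let oO : open O := @fictitious_open R d sigma Omega.
Let OmegaO : Omega `<=` O := sub_fictitious sigma_gt0 oOmega.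
Let mOmega : measurable Omega := open_measurable_rV oOmega.

Lemma leb_bounded : (leb Omega < +oo)%E.
Proof.
have [r hr] := bounded_coord bOmega.
apply: (@le_lt_trans _ _ (leb (obox (fun=> - (`|r| + 1)) (fun=> `|r| + 1)))); last exact: leb_obox_fin.
apply: le_measure; rewrite ?inE//; first exact: measurable_obox.
by move=> x Ox l; rewrite -ltr_norml (le_lt_trans (hr x Ox l))// (le_lt_trans (ler_norm r))// ltrDl.
Qed.

Let bV v : Vspace O v -> bmeas Omega v.
Proof.
move=> vV; have [r hr] := bounded_coord bOmega.
have := bmeas_Vspace sigma_gt0 (fun=> 0%N) oO vV OmegaO mOmega hr.
by rewrite mderiv0.
Qed.

Let eV : Vspace O e. Proof. exact: VspaceB. Qed.

Let bQ v i a : Vspace O v -> i \in tc -> bmeas (element i) (mderiv a v).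
Proof.
move=> vV /tcP/element_cut[iO _]; have [r hr] := element_bounded sigma_gt0 i.
exact: (bmeas_Vspace sigma_gt0 a oO vV iO (measurable_element sigma i) hr).
Qed.

Lemma stab_formE v w : stab_form sigma Omega P M v w =
  sigma ^+ (2 * P.+1) * \sum_(i <- tc) \sum_(a : mindex d P.+1 | morder (mval a) == P.+1)
      \int[leb]_(x in element i) (mderiv (mval a) v x * mderiv (mval a) w x).
Proof.
rewrite /stab_form; congr (_ * _).
rewrite (_ : [set i | _] = [set` tc]); first by rewrite -fsbig_seq.
by apply/seteqP; split => i /= /tcP.
Qed.

(** With [p], [q] the derivatives of [us], [wh], one has [2 p (p - q) - ((p - q)^2 - q^2) = p^2],
    nonnegative. *)
Let le_energy_cut :
  \sum_(i <- tc) dsq e i - \sum_(i <- tc) dsq wh i <= 2 * stab_form sigma Omega P M us e.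
Proof.
rewrite stab_formE -sumrB mulr_sumr mulr_sumr big_seq [leRHS]big_seq.
apply: ler_sum => i itc; rewrite /dsq -mulrBr mulrCA ler_wpM2l ?exprn_ge0 ?(ltW sigma_gt0)//.
rewrite -sumrB mulr_sumr; apply: ler_sum => a _.
have [be bw bu] := And3 (bQ (mval a) eV itc) (bQ (mval a) whV itc) (bQ (mval a) usV itc).
have mQ := @measurable_element R d sigma i; have Qoo := @leb_element R d sigma i.
have int f : bmeas (element i) f -> leb.-integrable (element i) (EFin \o f).
  exact: bmeas_integrable.
have be2 := bmeasM be be; have bw2 := bmeasM bw bw; have bue := bmeasM bu be.
rewrite /sqint -RintegralB//; last 2 first.
- by apply: int; under eq_fun do rewrite expr2.
- by apply: int; under eq_fun do rewrite expr2.
rewrite -RintegralZl//; last exact: int.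
apply: le_Rintegral => //.
- apply: int; under eq_fun do rewrite !expr2 -mulN1r.
  by apply: bmeasD => //; apply: bmeasM bw2; exact: bmeas_cst.
- by apply: int; apply: bmeasM bue; exact: bmeas_cst.
- move=> x ix; have /tcP/element_cut[iO _] := itc.
  have Ox := iO _ ix.
  rewrite (mderivB_Vspace _ oO usV whV Ox).
  set p := mderiv _ us x; set q := mderiv _ wh x.
  by rewrite -subr_ge0 (_ : _ - _ = p ^+ 2); [exact: sqr_ge0|ring].
Qed.

Let uwh_int : leb.-integrable Omega (EFin \o (fun x => (u x - wh x) ^+ 2)).
Proof.
have mO := open_measurable_rV oO.
have /(L2P _ mOmega)[mu uoo] := L2S mO mOmega OmegaO uL2.
have [mw _] := bV whV.
have mdiff : measurable_fun Omega (fun x => (u x - wh x) ^+ 2).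
  by apply: measurable_funX; exact: measurable_funB.
have bw2 := bmeasM (bV whV) (bV whV).
have iw := bmeas_integrable mOmega leb_bounded bw2.
have iu : leb.-integrable Omega (EFin \o (fun x => u x ^+ 2)).
  apply/integrableP; split; first by apply/measurable_EFinP; exact: measurable_funX.
  under eq_integral do rewrite /= ger0_norm ?sqr_ge0//; exact: uoo.
apply: (@le_integrable _ _ _ leb _ mOmega _ (EFin \o (fun x => 2 * u x ^+ 2 + 2 * (wh x * wh x)))).
- exact/measurable_EFinP.
- move=> x _ /=; rewrite lee_fin !ger0_norm ?sqr_ge0//.
    by rewrite -subr_ge0 (_ : _ - _ = (u x + wh x) ^+ 2); [exact: sqr_ge0|ring].
  by rewrite -expr2 addr_ge0// mulr_ge0// sqr_ge0.
- apply: (@eq_integrable _ _ _ leb _ mOmega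
    (fun x => (2%:E * (u x ^+ 2)%:E + 2%:E * (wh x * wh x)%:E)%E)).
    by move=> x _ /=; rewrite EFinD !EFinM.
  apply: integrableD => //; exact: integrableZl.
Qed.

(** The identity [2 (u - us) e = (u - wh)^2 - e^2 - (u - us)^2] on [Omega] and [le_energy_cut] on
    the cut elements turn the variational equation for [e] into the bound. *)
Lemma galerkin_energy :
  form_A sigma Omega P M eps us e = \int[leb]_(x in Omega) (u x * e x) ->
  sqint Omega e + eps * \sum_(i <- tc) dsq e i <=
  sqint Omega (fun x => u x - wh x) + eps * \sum_(i <- tc) dsq wh i.
Proof.
rewrite /form_A => hsol.
have mO := open_measurable_rV oO.
have /(L2P _ mOmega)[mu uoo] := L2S mO mOmega OmegaO uL2.
have be := bV eV; have bu := bV usV; have bw := bV whV.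
have int f : bmeas Omega f -> leb.-integrable Omega (EFin \o f).
  by apply: bmeas_integrable => //; exact: leb_bounded.
have iue : leb.-integrable Omega (EFin \o (fun x => u x * e x)).
  have [me [B hB]] := be.
  have iu := L2_integrable mO uL2 mOmega OmegaO leb_bounded.
  apply: (@le_integrable _ _ _ leb _ mOmega _ (fun x => (B%:E * (u x)%:E)%E)).
  - by apply/measurable_EFinP; exact: measurable_funM.
  - move=> x Ox; rewrite /= lee_fin !normrM mulrC ler_wpM2r//.
    exact: le_trans (hB _ Ox) (ler_norm _).
  - exact: integrableZl.
have iuse := int _ (bmeasM bu be).
have h1 : 2 * (\int[leb]_(x in Omega) (u x * e x) - \int[leb]_(x in Omega) (us x * e x)) <=
    sqint Omega (fun x => u x - wh x) - sqint Omega e.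
  have ie2 : leb.-integrable Omega (EFin \o (fun x => e x ^+ 2)).
    by apply: int; have := bmeasM be be; under [X in _ -> bmeas _ X]eq_fun do rewrite expr2.
  rewrite /sqint -RintegralB// -RintegralB// -RintegralZl//; last first.
    by have := integrableB mOmega iue iuse; apply: eq_integrable.
  apply: le_Rintegral => //.
  - have := integrableB mOmega iue iuse => /integrableZl => /(_ mOmega 2); apply: eq_integrable => //.
  - by have := integrableB mOmega uwh_int ie2; apply: eq_integrable.
  - move=> x Ox; rewrite /e/=.
    by rewrite -subr_ge0 [leRHS](_ : _ = (u x - us x) ^+ 2); [exact: sqr_ge0|ring].
have h2 := le_energy_cut.
have h3 := ler_wpM2l (ltW eps_gt0) h2.
move: h3; rewrite mulrBr mulrCA; lra.
Qed.

End energy.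
End galerkin.

(** * Square integrals over elements *)

Section square_integrals.
Variables (R : realType) (d : nat).
Local Notation rV := 'rV[R]_d.
Local Notation leb := (lebesgue_rV R d).
Implicit Types (S : set rV) (f g : rV -> R).

Lemma measurable_sqr S f : measurable_fun S f ->
  measurable_fun S (fun x => (f x ^+ 2)%:E).
Proof. by move=> mf; apply/measurable_EFinP; exact: measurable_funX. Qed.

Lemma nsq_sqint S f : measurable S -> L2 S f -> nsq S f = (sqint S f)%:E.
Proof.
move=> mS /(L2P _ mS)[mf foo]; rewrite /sqint /Rintegral -/(nsq S f) fineK//.
by rewrite ge0_fin_numE ?nsq_ge0.
Qed.

Lemma sqint_le_comb (I : finType) S (c : I -> R) f (g : I -> rV -> R) :
  measurable S -> measurable_fun S f -> (forall i, 0 <= c i) ->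
  (forall i, c i != 0 -> L2 S (g i)) ->
  (forall x, S x -> f x ^+ 2 <= \sum_i c i * g i x ^+ 2) ->
  L2 S f /\ sqint S f <= \sum_i c i * sqint S (g i).
Proof.
move=> mS mf c0 gL fg.
pose h i x : \bar R := (c i * g i x ^+ 2)%:E.
have mh i : measurable_fun S (h i).
  have [ci|ci] := eqVneq (c i) 0.
    rewrite (_ : h i = cst 0%E); first exact: measurable_cst.
    by apply/funext => x; rewrite /h ci mul0r.
  apply/measurable_EFinP; apply: measurable_funM; first exact: measurable_cst.
  by apply: measurable_funX; apply: L2_measurable => //; exact: gL.
have h0 i x : S x -> (0 <= h i x)%E by move=> _; rewrite lee_fin mulr_ge0 ?sqr_ge0.
have hE i : (\int[leb]_(x in S) h i x = (c i * sqint S (g i))%:E)%E.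
  have [ci|ci] := eqVneq (c i) 0.
    by rewrite ci mul0r integral0_eq// => x _; rewrite /h ci mul0r.
  rewrite EFinM -nsq_sqint//; last exact: gL.
  rewrite /h; under eq_integral do rewrite EFinM.
  rewrite ge0_integralZl//.
  - by apply: measurable_sqr; apply: L2_measurable => //; exact: gL.
  - by move=> x _; rewrite lee_fin sqr_ge0.
  - by rewrite lee_fin.
have le : (nsq S f <= (\sum_i c i * sqint S (g i))%:E)%E.
  apply: (@le_trans _ _ (\int[leb]_(x in S) \sum_(i <- index_enum I) h i x)%E).
    apply: ge0_le_integral => //.
    - by move=> x _; rewrite lee_fin sqr_ge0.
    - exact: measurable_sqr.
    - by apply: emeasurable_sum => i.
    - by move=> x Sx; rewrite sumEFin lee_fin; exact: fg.
  rewrite ge0_integral_sum//= -sumEFin; apply: lee_sum => i _.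
  by rewrite hE.
have fL : L2 S f by apply/(L2P _ mS); split => //; exact: (le_lt_trans le (ltry _)).
by split => //; rewrite -lee_fin -nsq_sqint.
Qed.

Lemma L2_bmeas S f : measurable S -> (leb S < +oo)%E -> bmeas S f -> L2 S f.
Proof.
move=> mS Soo bf; apply/(L2P _ mS); split; first by case: bf.
have := bmeas_integrable mS Soo (bmeasM bf bf) => /integrableP[_].
under eq_integral => x _ do rewrite /= -expr2 ger0_norm ?sqr_ge0//.
by [].
Qed.

Lemma sqint_sub_le S f g : measurable S -> L2 S f -> L2 S g ->
  L2 S (fun x => f x - g x) /\
  sqint S (fun x => f x - g x) <= 2 * sqint S f + 2 * sqint S g.
Proof.
move=> mS fL gL.
have [||||h1 h2] := @sqint_le_comb bool S (fun=> 2) (fun x => f x - g x)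
  (fun b => if b then f else g) mS.
- by apply: measurable_funB; exact: L2_measurable.
- by [].
- by case.
- move=> x _; rewrite big_bool /= -subr_ge0 [leRHS](_ : _ = (f x + g x) ^+ 2).
    exact: sqr_ge0.
  by ring.
by split => //; rewrite big_bool in h2.
Qed.

Lemma sqint_mono S S' f : measurable S -> measurable S' -> S' `<=` S -> L2 S f ->
  sqint S' f <= sqint S f.
Proof.
move=> mS mS' SS' fL; rewrite -lee_fin -!nsq_sqint//; last exact: L2S fL.
apply: ge0_subset_integral => //.
  by apply: measurable_sqr; exact: L2_measurable.
by move=> x _; rewrite lee_fin sqr_ge0.
Qed.

Variable sigma : R.
Hypothesis sigma_gt0 : 0 < sigma.
Local Notation idx := 'rV[int]_d.
Local Notation element := (@element R d sigma).

Let mEI i S : measurable S -> measurable (element i `&` S).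
Proof. by move=> mS; apply: measurableI => //; exact: measurable_element. Qed.

Lemma sqint_sum_le S (s : seq idx) f : measurable S -> L2 S f -> uniq s ->
  \sum_(i <- s) sqint (element i `&` S) f <= sqint S f.
Proof.
move=> mS fL us; rewrite -lee_fin -sumEFin -nsq_sqint//.
apply: le_trans (nsq_sum_le sigma_gt0 mS (L2_measurable mS fL) us).
rewrite le_eqVlt; apply/orP; left; apply/eqP; apply: eq_bigr => i _.
by rewrite nsq_sqint//; [exact: mEI|apply: L2S fL => //; exact: mEI].
Qed.

Lemma sqint_le_sum S (s : seq idx) f : measurable S -> L2 S f -> uniq s ->
  (forall x i, S x -> element i x -> i \in s) ->
  sqint S f <= \sum_(i <- s) sqint (element i `&` S) f.
Proof.
move=> mS fL us cov; rewrite -lee_fin -sumEFin -nsq_sqint//.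
apply: (le_trans (nsq_le_sum sigma_gt0 mS (L2_measurable mS fL) us cov)).
rewrite le_eqVlt; apply/orP; left; apply/eqP; apply: eq_bigr => i _.
by rewrite nsq_sqint//; [exact: mEI|apply: L2S fL => //; exact: mEI].
Qed.

End square_integrals.

(** Charges a translated list of indices, which may stick out of [r], to the sum over [r]. *)
Lemma sum_uniq_le (R : realType) (I : eqType) (s r : seq I) (F : I -> R) : uniq s -> uniq r ->
  (forall i, i \in r -> 0 <= F i) ->
  \sum_(i <- s) (if i \in r then F i else 0) <= \sum_(i <- r) F i.
Proof.
move=> us ur F0; rewrite -big_mkcond /= -big_filter.
have sub : {subset [seq i <- s | i \in r] <= r} by move=> i; rewrite mem_filter => /andP[].
have pe : perm_eq [seq i <- s | i \in r] [seq i <- r | i \in s].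
  apply: uniq_perm; rewrite ?filter_uniq// => i.
  by rewrite !mem_filter andbC.
rewrite (perm_big _ pe)/= big_filter big_mkcond/= big_seq [leRHS]big_seq.
by apply: ler_sum => i ir; case: ifP => // _; exact: F0.
Qed.

Lemma sum_support (V : nmodType) (I : eqType) (s r : seq I) (F : I -> V) : uniq s -> uniq r ->
  (forall i, F i != 0 -> (i \in s) = (i \in r)) ->
  \sum_(i <- s) F i = \sum_(i <- r) F i.
Proof.
move=> us ur sr.
have E (t : seq I) : \sum_(i <- t) F i = \sum_(i <- [seq i <- t | F i != 0]) F i.
  rewrite big_filter [RHS]big_mkcond/=; apply: eq_bigr => i _.
  by case: ifPn => // /negPn/eqP.
rewrite E [RHS]E; apply: perm_big; apply: uniq_perm; rewrite ?filter_uniq// => i.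
by rewrite !mem_filter; case: (boolP (F i != 0)) => //= /sr.
Qed.

(** * Quasi-interpolation *)

Section patches.
Variables (R : realType) (d : nat) (sigma : R).
Hypothesis sigma_gt0 : 0 < sigma.
Local Notation rV := 'rV[R]_d.
Local Notation idx := 'rV[int]_d.
Local Notation element := (@element R d sigma).
Local Notation patch := (@Defs.patch R d sigma).

Lemma patch_open k : open (patch k).
Proof. exact: obox_open. Qed.

Lemma patch_bounded k : exists r : R, forall x : rV, patch k x -> forall l, `|x ord0 l| <= r.
Proof.
exists (\sum_l (`|(k ord0 l)%:~R| + 1) * sigma) => x kx l.
rewrite (bigD1 l)//= (@le_trans _ _ ((`|(k ord0 l)%:~R| + 1) * sigma))//; last first.
  by rewrite lerDl sumr_ge0// => j _; rewrite mulr_ge0// ltW.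
have /andP[h1 h2] := kx l; set z : R := (k ord0 l)%:~R in h1 h2 *.
have := ler_norm z; have := ler_norm (- z); rewrite normrN ler_norml => h3 h4.
by apply/andP; split; nra.
Qed.

(** The element that sees the node [k] with offset [m]: [node_shift (node_unshift k m) m] is [k]. *)
Definition node_unshift (k : idx) (m : win d) : idx := \row_l (k ord0 l - (m l : nat)%:Z + 1).

Lemma node_unshift_inj k : injective (node_unshift k).
Proof.
move=> n m /rowP h; apply/ffunP => l; apply/val_inj.
by have := h l; rewrite !mxE /=; clear; lia.
Qed.

Lemma element_patch_corner i n : corner n -> element i `<=` patch (node_shift i n).
Proof.
move=> /forallP cn x ix l; have /andP[h1 h2] := ix l; set k := node_shift i n.
have kil : i ord0 l <= k ord0 l <= i ord0 l + 1.
  by rewrite mxE; case/orP: (cn l) => /eqP ->; apply/andP; split; lia.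
have /andP[k1 k2] := kil.
have k3 : ((k ord0 l)%:~R - 1 : R) <= (i ord0 l)%:~R by rewrite -(intrB _ _ 1) ler_int; lia.
have k4 : (i ord0 l)%:~R + 1 <= ((k ord0 l)%:~R + 1 : R) by rewrite lerD2r ler_int.
by rewrite (le_lt_trans _ h1) ?ler_pM2r// (lt_le_trans h2)// ler_pM2r.
Qed.

Lemma element_patch_unshift j k x : element j x -> patch k x ->
  exists m, j = node_unshift k m.
Proof.
move=> jx kx.
have h l : 0 <= k ord0 l - j ord0 l <= 1.
  have /andP[h1 h2] := jx l; have /andP[h3 h4] := kx l.
  have := lt_trans h1 h4; have := lt_trans h3 h2; rewrite !ltr_pM2r// -!(intrD _ _ 1) -(intrB _ _ 1) !ltr_int; lia.
exists [ffun l => inord (absz (k ord0 l - j ord0 l + 1))].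
apply/rowP => l; have /andP[h1 h2] := h l; rewrite !mxE ffunE.
have h3 : 0 <= k ord0 l - j ord0 l + 1 by lia.
rewrite inordK; last by rewrite -ltz_nat gez0_abs//; lia.
by rewrite gez0_abs//; ring.
Qed.

End patches.

Section interpolation.
Variables (R : realType) (d P : nat) (sigma : R).
Hypothesis sigma_gt0 : 0 < sigma.
Local Notation rV := 'rV[R]_d.
Local Notation idx := 'rV[int]_d.
Local Notation leb := (lebesgue_rV R d).
Local Notation element := (@element R d sigma).
Local Notation patch := (@Defs.patch R d sigma).
Variables (Omega : set rV) (CBH : R) (t : seq idx) (u : rV -> R).
Local Notation O := (fictitious sigma Omega).
Hypotheses (ut : uniq t) (tP : forall i, (i \in t) <-> element i `<=` O).
Hypothesis happrox : local_approximation sigma Omega P CBH.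
Hypothesis hu : sobolev O P.+1 u.

Let oO : open O := @fictitious_open R d sigma Omega.
Let mO : measurable O := open_measurable_rV oO.

Let mOp k : measurable (O `&` patch k).
Proof. by apply: measurableI; [exact: mO|exact: open_measurable_rV (@patch_open R d sigma k)]. Qed.

Lemma leb_Ipatch k : (leb (O `&` patch k) < +oo)%E.
Proof.
apply: (@le_lt_trans _ _ (leb (patch k))); last exact: leb_obox_fin.
apply: le_measure; rewrite ?inE; first exact: mOp.
  exact: open_measurable_rV (@patch_open R d sigma k).
by move=> x [].
Qed.

Lemma bmeas_polyfun (S : set rV) (q : rV -> R) (r : R) : polyfun P q ->
  (forall x, S x -> forall l, `|x ord0 l| <= r) -> bmeas S q.
Proof.
move=> /polyfunP[c ->] Sr.
exact: (@bmeas_tsum _ _ S r (pidx d P) c (fun a l t => t ^+ mval (val a) l)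
  (fun a l => smooth1X _ _) Sr).
Qed.

(** The derivatives are those taken on the whole domain even when [S] is a patch, so that
    contributions of patches can be added. *)
Definition highsq (S : set rV) : R :=
  \sum_(a : mindex d P.+1 | morder (mval a) == P.+1) sqint S (wderiv O (mval a) u).

Lemma wderiv_L2 (a : mindex d P.+1) : morder (mval a) == P.+1 -> L2 O (wderiv O (mval a) u).
Proof.
move=> /eqP aP; have [_ h] := hu.
by have [] := wderivP (h (mval a) _); rewrite ?aP.
Qed.

Lemma local_polynomials : exists q : idx -> rV -> R, (forall k, polyfun P (q k)) /\
  forall k, patch k `&` O !=set0 ->
  sqint (O `&` patch k) (fun x => u x - q k x) <=
  CBH ^+ 2 * sigma ^+ (2 * P.+1) * highsq (O `&` patch k).
Proof.
suff h k : exists q : rV -> R, polyfun P q /\ (patch k `&` O !=set0 ->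
    sqint (O `&` patch k) (fun x => u x - q x) <=
    CBH ^+ 2 * sigma ^+ (2 * P.+1) * highsq (O `&` patch k)).
  have /choice[q hq] := h; exists q; split => k; first by have [] := hq k.
  by have [] := hq k.
have [ne|ne] := pselect (patch k `&` O !=set0); last first.
  (* Patches that miss the domain get the polynomial 0. *)
  by exists (fun=> 0); split => //; exact: polyfun0.
have oOp : open (O `&` patch k) by apply: openI => //; exact: (@patch_open R d sigma).
have sub : O `&` patch k `<=` O by move=> x [].
have hu' := sobolev_restrict mO (mOp k) sub hu.
have [q pq hq] := happrox ne hu'; exists q; split => // _.
have [r hr] := patch_bounded sigma_gt0 k.
have bq : bmeas (O `&` patch k) q by apply: (bmeas_polyfun (r := r) pq) => x [_]; exact: hr.
have uL : L2 (O `&` patch k) u by case: hu'.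
have qL : L2 (O `&` patch k) q by apply: L2_bmeas => //; exact: leb_Ipatch.
have [uqL _] := sqint_sub_le (mOp k) uL qL.
rewrite -lee_fin -nsq_sqint//.
apply: (le_trans (nsq_le_seminorm0 oOp uqL)).
have := lee_sqr_scale (seminorm_ge0 _ _ _) (seminorm_ge0 _ _ _) (hq 0%N isT).
move=> /le_trans; apply; rewrite subn0 seminorm_sqr exprMn -exprM (mulnC P.+1 2) [leRHS]EFinM.
apply: lee_wpmul2l.
  by rewrite lee_fin mulr_ge0 ?sqr_ge0 ?exprn_ge0 ?(ltW sigma_gt0).
rewrite /highsq -sumEFin; apply: lee_sum => a aP.
(* The approximation hypothesis speaks of weak derivatives on the patch, which are exchanged here
   for those on the domain. *)
rewrite (nsq_wderiv_restrict oO oOp sub hu) ?(eqP aP)//.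
by rewrite nsq_sqint; [|exact: mOp|exact: L2S mO (mOp k) sub (wderiv_L2 aP)].
Qed.

(** Finite overlap: the elements [node_unshift k m] cover the patch of [k] up to a null set. For
    fixed [n] and [m] the resulting index is a translate of [i], so each of the [#|win d| ^ 2] sums
    counts an element at most once. *)
Lemma sum_patches_le g : L2 O g ->
  \sum_(i <- t) \sum_(n | corner n) sqint (O `&` patch (node_shift i n)) g <=
  (#|win d|%:R) ^+ 2 * sqint O g.
Proof.
move=> gL.
have le1 k : sqint (O `&` patch k) g <=
    \sum_(m : win d) sqint (element (node_unshift k m) `&` O) g.
  pose s := [seq node_unshift k m | m <- enum (win d)].
  have us : uniq s by rewrite map_inj_uniq ?enum_uniq//; exact: node_unshift_inj.
  have gL' : L2 (O `&` patch k) g by apply: (L2S mO (mOp k) _ gL) => x [].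
  apply: (le_trans (@sqint_le_sum _ _ _ sigma_gt0 _ s _ (mOp k) gL' us _)).
    move=> x j [_ kx] jx; have [m ->] := element_patch_unshift sigma_gt0 jx kx.
    by apply: map_f; rewrite mem_enum.
  rewrite big_map big_enum; apply: ler_sum => m _; apply: sqint_mono.
  - by apply: measurableI => //; exact: measurable_element.
  - by apply: measurableI => //; exact: measurable_element.
  - by move=> x [? []].
  - apply: (L2S mO _ _ gL) => [|x []//].
    by apply: measurableI => //; exact: measurable_element.
apply: (@le_trans _ _ (\sum_(n : win d) \sum_(m : win d) sqint O g)); last first.
  rewrite !sumr_const -[leLHS]mulr_natl -[X in _ * X <= _]mulr_natl mulrA expr2.
  exact: lexx.
apply: (@le_trans _ _ (\sum_(i <- t) \sum_(n : win d) \sum_(m : win d)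
    sqint (element (node_unshift (node_shift i n) m) `&` O) g)).
  apply: ler_sum => i _; pose G n := \sum_(m : win d)
    sqint (element (node_unshift (node_shift i n) m) `&` O) g.
  have G0 n : 0 <= G n by apply: sumr_ge0 => m _; exact: sqint_ge0.
  apply: (@le_trans _ _ (\sum_(n | corner n) G n)).
    by apply: ler_sum => n _; exact: le1.
  rewrite [leRHS](bigID (@corner d))/= lerDl; apply: sumr_ge0 => n _; exact: G0.
rewrite exchange_big/=; apply: ler_sum => n _.
rewrite exchange_big/=; apply: ler_sum => m _.
rewrite -(big_map (fun i => node_unshift (node_shift i n) m) xpredT (fun j => sqint (element j `&` O) g)).
apply: sqint_sum_le => //; rewrite map_inj_uniq// => i j /rowP ij.
apply/rowP => l; suff : i ord0 l = j ord0 l by [].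
by have := ij l; rewrite !mxE => /addIr/addIr/addIr/addIr.
Qed.

Variable q : idx -> rV -> R.
Hypothesis pq : forall k, polyfun P (q k).
Hypothesis hq : forall k, patch k `&` O !=set0 ->
  sqint (O `&` patch k) (fun x => u x - q k x) <=
  CBH ^+ 2 * sigma ^+ (2 * P.+1) * highsq (O `&` patch k).

(** Bounds both the error of the quasi-interpolant and its stabilization. *)
Definition interp_error : R :=
  \sum_(i <- t) \sum_(n | corner n) sqint (element i) (fun x => u x - q (node_shift i n) x).

Let mE i : measurable (element i) := @measurable_element R d sigma i.

Lemma q_L2 i k : L2 (element i) (q k).
Proof.
have [r hr] := element_bounded sigma_gt0 i.
apply: L2_bmeas => //; first exact: leb_element.
exact: bmeas_polyfun hr.
Qed.

Lemma interp_error_le : interp_error <=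
  CBH ^+ 2 * (#|win d|%:R) ^+ 2 * sigma ^+ (2 * P.+1) * highsq O.
Proof.
apply: (@le_trans _ _ (\sum_(i <- t) \sum_(n | corner n)
    CBH ^+ 2 * sigma ^+ (2 * P.+1) * highsq (O `&` patch (node_shift i n)))).
  rewrite /interp_error big_seq [leRHS]big_seq; apply: ler_sum => i it; apply: ler_sum => n cn.
  have ine : patch (node_shift i n) `&` O !=set0.
    have [x ix] := element_neq0 sigma_gt0 i; exists x; split.
      exact: (element_patch_corner sigma_gt0 cn ix).
    by move/tP: it; apply.
  apply: le_trans (hq ine); apply: sqint_mono => //.
    by move=> x ix; split; [move/tP: it; apply|exact: (element_patch_corner sigma_gt0 cn ix)].
  have sub : O `&` patch (node_shift i n) `<=` O by move=> x [].
  have [r hr] := patch_bounded sigma_gt0 (node_shift i n).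
  have qL : L2 (O `&` patch (node_shift i n)) (q (node_shift i n)).
    apply: L2_bmeas => //; first exact: leb_Ipatch.
    by apply: (bmeas_polyfun (r := r) (pq _)) => x [_]; exact: hr.
  have uL : L2 (O `&` patch (node_shift i n)) u by apply: (L2S mO (mOp _) sub); case: hu.
  by have [] := sqint_sub_le (mOp _) uL qL.
have H : \sum_(i <- t) \sum_(n | corner n) highsq (O `&` patch (node_shift i n)) <=
    (#|win d|%:R) ^+ 2 * highsq O.
  rewrite /highsq mulr_sumr.
  under eq_bigr do rewrite exchange_big/=.
  rewrite exchange_big/=; apply: ler_sum => a aP.
  by apply: sum_patches_le; exact: wderiv_L2.
under eq_bigr do rewrite -mulr_sumr.
rewrite -mulr_sumr.
have -> : CBH ^+ 2 * (#|win d|%:R) ^+ 2 * sigma ^+ (2 * P.+1) * highsq O =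
    CBH ^+ 2 * sigma ^+ (2 * P.+1) * ((#|win d|%:R) ^+ 2 * highsq O) by ring.
apply: ler_wpM2l H.
by rewrite mulr_ge0 ?sqr_ge0 ?exprn_ge0 ?(ltW sigma_gt0).
Qed.

End interpolation.

(** The variance about the weighted mean [m] is nonnegative. *)
Lemma sqr_convex_le (R : realType) (I : finType) (w a : I -> R) :
  (forall i, 0 <= w i) -> \sum_i w i = 1 ->
  (\sum_i w i * a i) ^+ 2 <= \sum_i w i * a i ^+ 2.
Proof.
move=> w0 w1; have [m mE] : exists m, m = \sum_i w i * a i by eexists.
have : 0 <= \sum_i w i * (a i - m) ^+ 2.
  by apply: sumr_ge0 => i _; rewrite mulr_ge0// sqr_ge0.
have -> : \sum_i w i * (a i - m) ^+ 2 =
    \sum_i w i * a i ^+ 2 - 2 * m * (\sum_i w i * a i) + m ^+ 2 * (\sum_i w i).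
  rewrite !mulr_sumr -sumrB -big_split/=; apply: eq_bigr => i _; ring.
by rewrite w1 -mE; lra.
Qed.

(** * The quasi-interpolant and its two error bounds *)

Section quasi_interpolant.
Variables (R : realType) (d P : nat) (sigma : R).
Hypothesis sigma_gt0 : 0 < sigma.
Local Notation rV := 'rV[R]_d.
Local Notation idx := 'rV[int]_d.
Local Notation leb := (lebesgue_rV R d).
Local Notation element := (@element R d sigma).
Local Notation patch := (@Defs.patch R d sigma).
Variables (Omega : set rV) (t : seq idx) (u : rV -> R) (q : idx -> rV -> R).
Local Notation O := (fictitious sigma Omega).
Hypotheses (ut : uniq t) (tP : forall i, (i \in t) <-> element i `<=` O).
Hypotheses (uL2 : L2 O u) (pq : forall k, polyfun P (q k)).

Let oO : open O := @fictitious_open R d sigma Omega.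
Let mO : measurable O := open_measurable_rV oO.
Let mE i : measurable (element i) := @measurable_element R d sigma i.

Lemma fictitious_closure x : O x -> exists2 j, j \in t & closure (element j) x.
Proof.
move=> Ox; have [j jO cx] := interior_subset Ox.
by exists j => //; apply/tP/element_fictitious.
Qed.

Lemma fictitious_bounded : exists r : R, forall x, O x -> forall l, `|x ord0 l| <= r.
Proof.
pose b (j : idx) l : R := (`|(j ord0 l)%:~R| + 1) * sigma.
have b0 j l : 0 <= b j l by rewrite mulr_ge0// ltW.
exists (\sum_(j <- t) \sum_l b j l) => x /fictitious_closure[j jt jx] l.
rewrite (bigD1_seq j)//= (bigD1 l)//=.
apply: (@le_trans _ _ (b j l)); last first.
  rewrite -addrA lerDl addr_ge0// sumr_ge0// => i _; exact: sumr_ge0.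
have /andP[h1 h2] := closure_closed_hull jx l; rewrite /b; set z : R := (j ord0 l)%:~R in h1 h2 *.
have := ler_norm z; have := ler_norm (- z); rewrite normrN ler_norml => h3 h4.
by apply/andP; split; nra.
Qed.

Lemma leb_fictitious : (leb O < +oo)%E.
Proof.
have [r hr] := fictitious_bounded.
apply: (@le_lt_trans _ _ (leb (obox (fun=> - (`|r| + 1)) (fun=> `|r| + 1)))); last exact: leb_obox_fin.
apply: le_measure; rewrite ?inE//; first exact: measurable_obox.
by move=> x Ox l; rewrite -ltr_norml (le_lt_trans (hr x Ox l))// (le_lt_trans (ler_norm r))// ltrDl.
Qed.

Lemma Vspace_L2 v : Vspace sigma P O v -> L2 O v.
Proof.
move=> vV; have [r hr] := fictitious_bounded.
apply: L2_bmeas => //; first exact: leb_fictitious.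
have := bmeas_Vspace sigma_gt0 (fun=> 0%N) oO vV (@subset_refl _ O) mO hr.
by rewrite mderiv0.
Qed.

(** Membership in the discrete space asks for a finite list of nodes; this one contains all nodes
    whose [phi] is nonzero somewhere on the domain. *)
Definition active_nodes : seq idx :=
  undup [seq node_shift i n | i <- t, n <- enum (win d)].

Definition quasi_interpolant (x : rV) : R :=
  \sum_(k <- active_nodes) phi sigma k x * q k x.

Lemma Vspace_quasi_interpolant : Vspace sigma P O quasi_interpolant.
Proof.
have /choice[c cE] : forall k, exists c : mindex d P -> R,
    q k = fun x => \sum_(a | (morder (mval a) <= P)%N) c a * monom (mval a) x by exact: pq.
exists active_nodes, c => x _; apply: eq_bigr => k _.
by rewrite cE mulr_sumr; apply: eq_bigr => a _; rewrite mulrCA.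
Qed.

Lemma phi_neq0_patch k x : phi sigma k x != 0 -> patch k x.
Proof.
move=> phi0 l.
have : `|x ord0 l / sigma - (k ord0 l)%:~R| < 1.
  by rewrite ltNge; apply/negP => /(phi_out sigma_gt0) h; rewrite h eqxx in phi0.
rewrite ltr_norml -(ltr_pdivlMr _ _ sigma_gt0) -(ltr_pdivrMr _ _ sigma_gt0).
by move=> /andP[h1 h2]; apply/andP; split; lra.
Qed.

(** The point [x] may lie on an interface; the open patch of [k] still meets an element whose
    closure contains [x]. *)
Lemma active_nodesP k x : O x -> phi sigma k x != 0 -> k \in active_nodes.
Proof.
move=> /fictitious_closure[j jt jx] /phi_neq0_patch kx.
have [|y [jy ky]] := jx (patch k); first by apply: open_nbhs_nbhs; split => //; exact: obox_open.
have [m jE] := element_patch_unshift sigma_gt0 jy ky.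
rewrite mem_undup; apply/allpairsP; exists (j, m); split => //=; first by rewrite mem_enum.
by rewrite jE; apply/rowP => l; rewrite !mxE; ring.
Qed.

Lemma local_form_quasi_interpolant : local_form sigma O q quasi_interpolant.
Proof.
move=> i x Ox wx.
rewrite -(big_map (node_shift i) xpredT (fun k => phi sigma k x * q k x)).
apply: sum_support.
- exact: undup_uniq.
- by rewrite map_inj_uniq ?index_enum_uniq//; exact: node_shift_inj.
move=> k; rewrite mulf_eq0 negb_or => /andP[phi0 _].
rewrite (active_nodesP Ox phi0); apply/esym.
have [n ->] := phi_window sigma_gt0 wx phi0.
by apply: map_f; rewrite mem_index_enum.
Qed.

(** The error is the average of the errors [u - q k] with weights [phi], and the square is
    convex. *)
Lemma quasi_interpolant_element i : i \in t ->
  sqint (element i) (fun x => u x - quasi_interpolant x) <=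
  \sum_(n | corner n) sqint (element i) (fun x => u x - q (node_shift i n) x).
Proof.
move=> it; have iO : element i `<=` O by exact/tP.
have qL k := q_L2 sigma_gt0 pq i k.
have uL : L2 (element i) u := L2S mO (mE i) iO uL2.
have wL : L2 (element i) quasi_interpolant.
  exact: (L2S mO (mE i) iO (Vspace_L2 Vspace_quasi_interpolant)).
have ii l : `|i ord0 l - i ord0 l| <= 1 by rewrite subrr normr0.
(* The weights [phi] are at most 1 and vanish off the corners, so they are replaced by the indicator
   of the corners. *)
have [||||_] := @sqint_le_comb R d (win d) (element i) (fun n => (corner n)%:R)
  (fun x => u x - quasi_interpolant x) (fun n x => u x - q (node_shift i n) x) (mE i).
- by apply: measurable_funB; exact: L2_measurable.
- by move=> n; exact: ler0n.
- by move=> n _; have [] := sqint_sub_le (mE i) uL (qL (node_shift i n)).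
- move=> x ix.
  pose y : rV := \row_l (x ord0 l / sigma - (i ord0 l)%:~R).
  have xE : x = rescale sigma (realrow R i) y.
    by apply/rowP => l; rewrite !mxE subrK mulrCA divff ?mulr1// gt_eqF.
  have Qy : refcell (fun=> 0) y.
    move: ix; rewrite xE => ix; have : (rescale sigma (realrow R i) @^-1` element i) y by [].
    rewrite rescale_element// => h l; have := h l.
    by rewrite subrr.
  pose w (n : win d) := phi sigma (node_shift i n) x.
  have wE n : w n = \prod_l hat (y ord0 l - ((n l : nat)%:R - 1)).
    by rewrite /w xE phi_node_shift.
  have w0 n : 0 <= w n by rewrite wE; apply: prodr_ge0 => l _; exact: hat_ge0.
  have w1 n : w n <= 1.
    rewrite wE; apply: prodr_ile1 => l _; by rewrite hat_ge0 hat_le1.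
  have ws : \sum_n w n = 1 by under eq_bigr do rewrite wE; exact: sum_hat.
  rewrite (local_form_quasi_interpolant (iO _ ix) (element_window sigma_gt0 ii ix)).
  have -> : u x - \sum_n phi sigma (node_shift i n) x * q (node_shift i n) x =
      \sum_n w n * (u x - q (node_shift i n) x).
    under [RHS]eq_bigr do rewrite mulrBr.
    by rewrite sumrB -mulr_suml ws mul1r.
  apply: (le_trans (sqr_convex_le _ w0 ws)); apply: ler_sum => n _.
  case: (boolP (corner n)) => [_|cn]; first by rewrite ler_wpM2r// sqr_ge0.
  by rewrite wE (hat_not_corner Qy cn) !mul0r.
by rewrite [X in _ -> _ <= X]big_mkcond/=; congr (_ <= _); apply: eq_bigr => n _; case: ifP => _; rewrite ?mul1r ?mul0r.
Qed.

Lemma quasi_interpolant_error :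
  sqint O (fun x => u x - quasi_interpolant x) <= interp_error sigma t u q.
Proof.
have [dL _] := sqint_sub_le mO uL2 (Vspace_L2 Vspace_quasi_interpolant).
apply: (le_trans (sqint_le_sum sigma_gt0 mO dL ut _)).
  move=> x i Ox ix; apply/tP; exact: (elements_domain_sub sigma_gt0 Ox ix).
rewrite /interp_error big_seq [leRHS]big_seq; apply: ler_sum => i it.
rewrite setIidl; last exact/tP.
exact: quasi_interpolant_element.
Qed.

(** Each difference of polynomials is a difference of two errors, [(u - q i) - (u - q k)]. The
    second error contributes the constant 2 and the first, repeated for at most [#|win d|] corners,
    the rest. *)
Lemma quasi_interpolant_stab (C : R) (tc : seq idx) : 0 <= C ->
  (forall i, element i `<=` O -> dsq P sigma quasi_interpolant i <=
     C * \sum_(n | corner n) sqint (element i) (fun x => q (node_shift i n) x - q i x)) ->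
  uniq tc -> {subset tc <= t} ->
  \sum_(i <- tc) dsq P sigma quasi_interpolant i <=
  C * (2 + 2 * #|win d|%:R) * interp_error sigma t u q.
Proof.
move=> C0 hC utc tct.
pose E i := \sum_(n | corner n) sqint (element i) (fun x => u x - q (node_shift i n) x).
have E0 i : 0 <= E i by apply: sumr_ge0 => n _; exact: sqint_ge0.
apply: (@le_trans _ _ (\sum_(i <- tc) C * (2 + 2 * #|win d|%:R) * E i)); last first.
  rewrite -mulr_sumr ler_wpM2l ?mulr_ge0 ?addr_ge0 ?mulr_ge0//.
  apply: le_trans (sum_uniq_le utc ut (fun i _ => E0 i)).
  by rewrite big_seq [leRHS]big_seq; apply: ler_sum => i /tct ->.
rewrite big_seq [leRHS]big_seq; apply: ler_sum => i itc; have it := tct _ itc.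
apply: (le_trans (hC i _)); first exact/tP.
rewrite -mulrA ler_wpM2l//.
have iO : element i `<=` O by exact/tP.
have uL : L2 (element i) u := L2S mO (mE i) iO uL2.
have dL k : L2 (element i) (fun x => u x - q k x).
  by have [] := sqint_sub_le (mE i) uL (q_L2 sigma_gt0 pq i k).
have ci : corner (center_node d) by apply/forallP => l; rewrite ffunE inordK.
have iE : node_shift i (center_node d) = i.
  by apply/rowP => l; rewrite !mxE ffunE inordK// addrK.
have Ei : sqint (element i) (fun x => u x - q i x) <= E i.
  rewrite /E (bigD1 (center_node d))//= iE lerDl sumr_ge0// => n _; exact: sqint_ge0.
apply: (@le_trans _ _ (\sum_(n : win d | corner n)
    (2 * sqint (element i) (fun x => u x - q (node_shift i n) x) + 2 * E i))).
  apply: ler_sum => n _.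
  have [_ h] := sqint_sub_le (mE i) (dL i) (dL (node_shift i n)).
  rewrite (@sqint_eq _ _ _ _ (fun x => (u x - q i x) - (u x - q (node_shift i n) x))).
    by apply: (le_trans h); lra.
  by move=> x _; ring.
rewrite big_split/= -mulr_sumr sumr_const -[X in _ + X]mulr_natl [leRHS]mulrDl.
apply: lerD; first by [].
rewrite mulrCA -[leRHS]mulrA ler_wpM2l//.
by rewrite ler_wpM2r// ler_nat max_card.
Qed.

End quasi_interpolant.

(** * Chains of elements *)

Section chains.
Variables (R : realType) (d K : nat).
Local Notation idx := 'rV[int]_d.

Definition near_idx (i j : idx) : Prop := forall l, `|i ord0 l - j ord0 l| <= 1.

(** Displacements between [-K] and [K] in every direction, which cover whatever a chain of length
    [K] can reach. *)
Definition cube : finType := {ffun 'I_d -> 'I_(2 * K).+1}.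

Definition cube_shift (i : idx) (w : cube) : idx := \row_l (i ord0 l + (w l : nat)%:Z - K%:Z).

Lemma cube_shift_inj w : injective (cube_shift^~ w).
Proof.
move=> i j /rowP ij; apply/rowP => l; suff : i ord0 l = j ord0 l by [].
by have := ij l; rewrite !mxE => /addIr/addIr.
Qed.

Lemma cube_shiftP (i j : idx) : (forall l, `|i ord0 l - j ord0 l| <= K%:Z) ->
  exists w, j = cube_shift i w.
Proof.
move=> ij; exists [ffun l => inord (absz (j ord0 l - i ord0 l + K%:Z))].
apply/rowP => l; rewrite !mxE ffunE.
have := ij l; rewrite ler_norml => /andP[h1 h2].
have h3 : 0 <= j ord0 l - i ord0 l + K%:Z by lia.
rewrite inordK; last by rewrite -ltz_nat gez0_abs//; lia.
by rewrite gez0_abs//; ring.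
Qed.

Lemma path_dist (e : rel idx) i s : (forall j k, e j k -> near_idx j k) -> path e i s ->
  forall j, j \in i :: s -> forall l, `|i ord0 l - j ord0 l| <= (size s)%:Z.
Proof.
move=> en; elim: s i => [|x s IH] i /=.
  by move=> _ j; rewrite inE => /eqP -> l; rewrite subrr normr0.
move=> /andP[ix xs] j; rewrite in_cons => /orP[/eqP -> l|js l].
  by rewrite subrr normr0.
rewrite -[i ord0 l](subrK (x ord0 l)) -addrA intS.
apply: (le_trans (ler_normD _ _)); apply: lerD; first exact: en ix l.
exact: IH xs j js l.
Qed.

Variables (B D : idx -> R) (C : R) (cut unc : pred idx).
Hypotheses (C1 : 1 <= C) (B0 : forall i, 0 <= B i) (D0 : forall i, 0 <= D i).
Hypothesis step : forall i j, cut i -> cut j || unc j -> near_idx i j -> B i <= C * (B j + D i).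

(** Iteration of [step]; because [1 <= C], every term can be charged the full power of [C]. *)
Lemma chain_le (e : rel idx) i s m : (forall j k, e j k -> near_idx j k) ->
  all cut (i :: s) -> path e i s -> unc m -> near_idx (last i s) m ->
  B i <= C ^+ (size s).+1 * (B m + \sum_(j <- i :: s) D j).
Proof.
move=> en; have C0 : 0 <= C by apply: le_trans C1.
elim: s i => [|x s IH] i /=.
  move=> /andP[ci _] _ um im; rewrite expr1 big_seq1.
  by apply: step; rewrite ?um ?orbT.
move=> /and3P[ci cx cs] /andP[ix xs] um lm.
have := IH x _ xs um lm; rewrite /= cx cs => /(_ isT) h1.
have h2 := step ci _ (en _ _ ix); rewrite cx in h2; have {}h2 := h2 isT.
apply: (le_trans h2); rewrite exprS -mulrA ler_wpM2l//.
rewrite big_cons (addrC (D i)) addrA mulrDr lerD//.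
by rewrite ler_peMl// exprn_ege1.
Qed.

(** Each index is reached by at most [#|cube|] chains of length at most [K], so
    that summing [chain_le] over all starting points costs a bounded factor. *)
Lemma chain_sum (e : rel idx) (tc tu : seq idx) : uniq tc -> uniq tu ->
  (forall i, (i \in tc) = cut i) -> (forall i, (i \in tu) = unc i) ->
  (forall j k, e j k -> near_idx j k) ->
  (forall i, cut i -> exists s m, [/\ (size (i :: s) <= K)%N, all cut (i :: s), path e i s,
     unc m & near_idx (last i s) m]) ->
  \sum_(i <- tc) B i <= C ^+ K * (#|cube|%:R * (\sum_(i <- tu) B i + K%:R * \sum_(i <- tc) D i)).
Proof.
move=> utc utu tcE tuE en chain; have C0 : 0 <= C by apply: le_trans C1.
(* Extension by 0 outside the lists, so that all displacements in the cube can be summed over,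
   including those that leave the domain. *)
pose B' k := if k \in tu then B k else 0.
pose D' k := if k \in tc then D k else 0.
have B'0 k : 0 <= B' k by rewrite /B'; case: ifP.
have D'0 k : 0 <= D' k by rewrite /D'; case: ifP.
have dom (F : idx -> R) i w : (forall k, 0 <= F k) ->
    F (cube_shift i w) <= \sum_(v : cube) F (cube_shift i v).
  by move=> F0; rewrite (bigD1 w)//= lerDl sumr_ge0.
have one i : i \in tc -> B i <= C ^+ K * \sum_(w : cube) (B' (cube_shift i w) + K%:R * D' (cube_shift i w)).
  rewrite tcE => /chain[s [m [sK cs ps um lm]]].
  apply: (le_trans (chain_le en cs ps um lm)).
  apply: ler_pM; rewrite ?exprn_ge0 ?addr_ge0 ?sumr_ge0//.
    by rewrite ler_weXn2l.
  have dist j : j \in i :: s -> forall l, `|i ord0 l - j ord0 l| <= K%:Z.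
    move=> js l; apply: le_trans (path_dist en ps js l) _.
    by rewrite lez_nat; apply: ltnW.
  rewrite big_split/=; apply: lerD.
    have -> : B m = B' m by rewrite /B' tuE um.
    have [l|w ->] := @cube_shiftP i m; last exact: dom.
    rewrite -[i ord0 l](subrK ((last i s) ord0 l)) -addrA.
    apply: (le_trans (ler_normD _ _)).
    (* The move to the uncut element comes on top of the [size s] moves of the chain; as [K] bounds
       the size of [i :: s], it stays in the cube. *)
    apply: (@le_trans _ _ ((size s)%:Z + 1)); last by rewrite addrC -intS lez_nat.
    apply: lerD; last exact: lm.
    by have := path_dist en ps (mem_last i s) l.
  rewrite -mulr_sumr.
  apply: (@le_trans _ _ (\sum_(j <- i :: s) \sum_(w : cube) D' (cube_shift i w))).
    rewrite big_seq [leRHS]big_seq; apply: ler_sum => j js.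
    have -> : D j = D' j by rewrite /D' tcE (allP cs _ js).
    by have [w ->] := cube_shiftP (dist _ js); exact: dom.
  rewrite big_const_seq count_predT iter_addr_0 -[leLHS]mulr_natl ler_wpM2r ?sumr_ge0//.
  by rewrite ler_nat.
apply: (@le_trans _ _ (\sum_(i <- tc) C ^+ K * \sum_(w : cube) (B' (cube_shift i w) + K%:R * D' (cube_shift i w)))).
  by rewrite big_seq [leRHS]big_seq; apply: ler_sum => i; exact: one.
rewrite -mulr_sumr ler_wpM2l ?exprn_ge0//.
rewrite exchange_big/=.
apply: (@le_trans _ _ (\sum_(w : cube) (\sum_(i <- tu) B i + K%:R * \sum_(i <- tc) D i))); last first.
  by rewrite sumr_const -[leLHS]mulr_natl.
apply: ler_sum => w _; rewrite big_split/= -mulr_sumr.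
have us : uniq [seq cube_shift i w | i <- tc] by rewrite map_inj_uniq//; exact: cube_shift_inj.
rewrite -(big_map (cube_shift^~ w) xpredT B') -(big_map (cube_shift^~ w) xpredT D').
by apply: lerD; [|apply: ler_wpM2l => //]; apply: sum_uniq_le.
Qed.

End chains.

(** * Error estimate *)

Section error_bound.
Variables (R : realType) (d P K : nat) (eps : R).
Hypothesis eps_gt0 : 0 < eps.
Local Notation rV := 'rV[R]_d.
Local Notation idx := 'rV[int]_d.
Local Notation leb := (lebesgue_rV R d).

Variables Cs Ci : R.
Hypotheses (Cs0 : 0 <= Cs) (Ci0 : 0 <= Ci).
Hypothesis stability : forall sigma, 0 < sigma -> forall (O : set rV) v, open O ->
  Vspace sigma P O v -> forall i j, element sigma i `<=` O -> element sigma j `<=` O ->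
  near_idx i j -> sqint (element sigma i) v <= Cs * (sqint (element sigma j) v + dsq P sigma v i).
Hypothesis inverse : forall sigma, 0 < sigma -> forall (O : set rV) v (p : idx -> rV -> R), open O ->
  Vspace sigma P O v -> (forall k, polyfun P (p k)) -> local_form sigma O p v ->
  forall i, element sigma i `<=` O -> dsq P sigma v i <=
  Ci * \sum_(n | corner n) sqint (element sigma i) (fun x => p (node_shift i n) x - p i x).

(** The leading 1 is for the uncut elements and the rest is the cost of the chains. The base
    [1 + Cs] meets the condition that the chain factor be at least 1. *)
Definition reach_const : R := 1 + (1 + Cs) ^+ K * (#|cube d K|%:R * (1 + K%:R)).

(** The 1 is for the error of the quasi-interpolant on [Omega], the other term for its
    stabilization, weighted by [eps]. *)
Definition energy_const : R := 1 + eps * (Ci * (2 + 2 * #|win d|%:R)).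

(** The factors 2 come from splitting [us - u] into [e] and [u - wh]; [1 + eps^-1] removes the
    weight [eps] in front of the stabilization. *)
Definition error_const : R := 2 * (reach_const * ((1 + eps^-1) * energy_const)) + 2.

Lemma reach_const_ge0 : 0 <= reach_const.
Proof. by rewrite addr_ge0// mulr_ge0 ?exprn_ge0 ?addr_ge0// mulr_ge0// addr_ge0. Qed.

Lemma energy_const_ge0 : 0 <= energy_const.
Proof.
by rewrite addr_ge0// mulr_ge0 ?(ltW eps_gt0)// mulr_ge0// addr_ge0// mulr_ge0.
Qed.

Lemma error_const_ge0 : 0 <= error_const.
Proof.
have := ltW eps_gt0; rewrite -invr_ge0 => e0.
by rewrite addr_ge0// mulr_ge0// mulr_ge0 ?reach_const_ge0// mulr_ge0 ?energy_const_ge0// addr_ge0.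
Qed.

Variable sigma : R.
Hypothesis sigma_gt0 : 0 < sigma.
Local Notation element := (@element R d sigma).
Variables (Omega : set rV) (M : set idx).
Hypotheses (oOmega : open Omega) (bOmega : bounded_set Omega).
Hypothesis hchain : chain_condition sigma Omega K M.
Local Notation O := (fictitious sigma Omega).

Let oO : open O := @fictitious_open R d sigma Omega.
Let mO : measurable O := open_measurable_rV oO.
Let OmegaO : Omega `<=` O := sub_fictitious sigma_gt0 oOmega.
Let mOmega : measurable Omega := open_measurable_rV oOmega.

Variable t : seq idx.
Hypotheses (ut : uniq t) (tP : forall i, (i \in t) <-> element i `<=` O).

Definition cut_elements := [seq i <- t | `[< ~ (element i `<=` Omega) \/ M i >]].
Definition uncut_elements := [seq i <- t | ~~ `[< ~ (element i `<=` Omega) \/ M i >]].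
Local Notation tc := cut_elements.
Local Notation tu := uncut_elements.

Lemma cut_elementsP i : i \in tc <-> element i `<=` cut_part sigma Omega M.
Proof.
rewrite mem_filter; apply: iff_trans (iff_sym (element_cut sigma_gt0 _ _ _)).
split=> [/andP[/asboolP h /tP]|[/tP -> h]] //.
by rewrite andbT; apply/asboolP.
Qed.

Lemma uncut_elementsP i : i \in tu <-> element i `<=` uncut_part sigma Omega M.
Proof.
rewrite mem_filter; apply: iff_trans (iff_sym (element_uncut sigma_gt0 _ _ _)).
split=> [/andP[/asboolPn /not_orP[/contrapT h1 h2] /tP h]|[/tP -> h1 h2]]; first by [].
by rewrite andbT; apply/asboolPn => -[].
Qed.

(** The norm on the cut elements is controlled through the chains. *)
Lemma norm_reach v : Vspace sigma P O v ->
  sqint O v <= reach_const * (sqint Omega v + \sum_(i <- tc) dsq P sigma v i).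
Proof.
move=> vV; have vL := Vspace_L2 sigma_gt0 ut tP vV.
have vLO := L2S mO mOmega OmegaO vL.
set D := \sum_(i <- tc) _; pose B i := sqint (element i) v.
have D0 : 0 <= D by apply: sumr_ge0 => i _; exact: dsq_ge0.
have tcO i : i \in tc -> element i `<=` O.
  by rewrite mem_filter => /andP[_ /tP].
have tuO i : i \in tu -> element i `<=` O.
  by rewrite mem_filter => /andP[_ /tP].
(* Uncut elements are disjoint subsets of [Omega]. *)
have hu : \sum_(i <- tu) B i <= sqint Omega v.
  apply: le_trans (sqint_sum_le sigma_gt0 mOmega vLO (filter_uniq _ ut)).
  rewrite le_eqVlt; apply/orP; left; apply/eqP.
  rewrite big_seq [RHS]big_seq; apply: eq_bigr => i /uncut_elementsP.
  by move=> /(element_uncut sigma_gt0)[_ iO _]; rewrite setIidl.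
have hc : \sum_(i <- tc) B i <= (1 + Cs) ^+ K *
    (#|cube d K|%:R * (\sum_(i <- tu) B i + K%:R * D)).
  apply: (@chain_sum R d K B (dsq P sigma v) (1 + Cs) (mem tc) (mem tu) _ _ _ _
    (fun j k => `[< neighbors sigma j k >])).
  - by rewrite lerDl.
  - by move=> i; exact: sqint_ge0.
  - by move=> i; exact: dsq_ge0.
  - move=> i j ic jcu ij; have jO : element j `<=` O by case/orP: jcu => [/tcO|/tuO].
    apply: (le_trans (stability sigma_gt0 oO vV (tcO _ ic) jO ij)).
    by rewrite ler_wpM2r ?addr_ge0 ?sqint_ge0 ?dsq_ge0// lerDr.
  - exact: filter_uniq.
  - exact: filter_uniq.
  - by [].
  - by [].
  - by move=> j k /asboolP; exact: neighbors_dist.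
  - move=> i /cut_elementsP/hchain[s [sK sc ps [m um nm]]]; exists s, m; split=> //.
    + by apply/allP => j js; apply/cut_elementsP; exact: sc.
    + exact/uncut_elementsP.
    + exact: (neighbors_dist sigma_gt0 nm).
apply: (@le_trans _ _ (\sum_(i <- t) B i)).
  apply: (le_trans (sqint_le_sum sigma_gt0 mO vL ut _)).
    move=> x i Ox ix; apply/tP; exact: (elements_domain_sub sigma_gt0 Ox ix).
  rewrite big_seq [leRHS]big_seq; apply: ler_sum => i it.
  by rewrite setIidl//; exact/tP.
rewrite (bigID (fun i => `[< ~ (element i `<=` Omega) \/ M i >]))/= -big_filter -[X in _ + X]big_filter -/tc -/tu.
apply: (le_trans (lerD hc hu)); rewrite addrC /reach_const mulrDl mul1r; apply: lerD.
  by rewrite lerDl.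
rewrite -!mulrA ler_wpM2l ?exprn_ge0 ?addr_ge0// ler_wpM2l// mulrDl mul1r.
have K0 : 0 <= K%:R :> R by [].
have S0 : 0 <= sqint Omega v by exact: sqint_ge0.
rewrite mulrDr addrACA; apply: lerD; last by rewrite lerDr.
by apply: (le_trans hu); rewrite lerDl mulr_ge0.
Qed.

Variables (CBH : R) (u us : rV -> R).
Hypothesis happrox : local_approximation sigma Omega P CBH.
Hypothesis hu : sobolev O P.+1 u.
Hypothesis hus : Vspace sigma P O us.
Hypothesis hsol : forall v, Vspace sigma P O v ->
  form_A sigma Omega P M eps us v = \int[leb]_(x in Omega) (u x * v x).

Lemma error_bound : sqint O (us \- u) <=
  error_const * (CBH ^+ 2 * #|win d|%:R ^+ 2) * sigma ^+ (2 * P.+1) * highsq P sigma Omega u O.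
Proof.
have uL : L2 O u by case: hu.
have [q [pq hq]] := local_polynomials sigma_gt0 happrox hu.
set wh := quasi_interpolant sigma t q.
have whV : Vspace sigma P O wh by exact: Vspace_quasi_interpolant.
have eV := VspaceB hus whV.
set T0 := interp_error sigma t u q.
have T0le : T0 <= _ := interp_error_le sigma_gt0 ut tP hu pq hq.
have uw : sqint O (fun x => u x - wh x) <= T0 := quasi_interpolant_error sigma_gt0 ut tP uL pq.
have T00 : 0 <= T0 by apply: le_trans uw; exact: sqint_ge0.
have uwL : L2 O (fun x => u x - wh x).
  by have [] := sqint_sub_le mO uL (Vspace_L2 sigma_gt0 ut tP whV).
have utc : uniq tc := filter_uniq _ ut.
have whD : \sum_(i <- tc) dsq P sigma wh i <= Ci * (2 + 2 * #|win d|%:R) * T0.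
  apply: (quasi_interpolant_stab sigma_gt0 ut tP uL pq Ci0 _ utc) => [i iO|].
    apply: (inverse sigma_gt0 oO whV pq _ iO).
    exact: (local_form_quasi_interpolant sigma_gt0 q tP).
  by move=> i; rewrite mem_filter => /andP[].
have := galerkin_energy sigma_gt0 oOmega bOmega eps_gt0 utc cut_elementsP uL hus whV (hsol eV).
set S := sqint Omega (us \- wh); set D := \sum_(i <- tc) dsq P sigma (us \- wh) i => hE.
have S0 : 0 <= S by exact: sqint_ge0.
have D0 : 0 <= D by apply: sumr_ge0 => i _; exact: dsq_ge0.
have hE' : S + eps * D <= energy_const * T0.
  apply: (le_trans hE); rewrite /energy_const mulrDl mul1r -mulrA.
  apply: lerD; last by rewrite ler_wpM2l ?(ltW eps_gt0).
  by apply: le_trans uw; exact: sqint_mono.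
(* Expanding [(1 + eps^-1) * (S + eps * D)] gives [S + D] plus nonnegative terms. *)
have hSD : S + D <= (1 + eps^-1) * (energy_const * T0).
  apply: (@le_trans _ _ ((1 + eps^-1) * (S + eps * D))).
    have -> : (1 + eps^-1) * (S + eps * D) = S + D + (eps^-1 * S + eps * D).
      by field; rewrite gt_eqF.
    by rewrite lerDl addr_ge0// mulr_ge0// ?invr_ge0 ltW.
  by rewrite ler_wpM2l// addr_ge0// invr_ge0 ltW.
have he := norm_reach eV; rewrite -/S -/D in he.
have hT : sqint O (us \- u) <= error_const * T0.
  have [_] := sqint_sub_le mO (Vspace_L2 sigma_gt0 ut tP eV) uwL.
  have -> : (fun x => (us \- wh) x - (u x - wh x)) = us \- u.
    by apply/funext => x /=; ring.
  move=> h; apply: (le_trans h); rewrite /error_const [leRHS]mulrDl; apply: lerD; last first.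
    by rewrite ler_pM2l.
  rewrite -!mulrA ler_pM2l//; apply: (le_trans he).
  by rewrite ler_wpM2l ?reach_const_ge0.
apply: (le_trans hT); apply: (le_trans (ler_wpM2l error_const_ge0 T0le)).
by rewrite !(mulrA error_const).
Qed.

End error_bound.

Section norms.
Variables (R : realType) (d P : nat) (sigma : R) (Omega : set 'rV[R]_d) (u : 'rV[R]_d -> R).
Local Notation O := (fictitious sigma Omega).
Hypothesis hu : sobolev O P.+1 u.

Let mO : measurable O := open_measurable_rV (@fictitious_open R d sigma Omega).

Lemma highsq_le : ((highsq P sigma Omega u O)%:E <= sobolev_norm O P.+1 u ^+ 2)%E.
Proof.
have s0 (j : 'I_P.+2) : (0 <= sobolev_seminorm O j u ^+ 2)%E.
  by rewrite expe2 mule_ge0// seminorm_ge0.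
rewrite /sobolev_norm sqr_poweR2V; last by apply: sume_ge0 => j _.
rewrite (bigD1 ord_max)// -[leLHS]adde0; apply: leeD; last exact: sume_ge0.
rewrite seminorm_sqr /highsq -sumEFin; apply: lee_sum => a aP.
by rewrite nsq_sqint//; exact: wderiv_L2.
Qed.

End norms.

Theorem theorem3p3 (R : realType) (d P K : nat) (hd : (0 < d)%N) (CBH eps : R)
    (heps : 0 < eps) :
  exists C : R,
  forall (sigma : R) (hsigma : 0 < sigma) (Omega : set 'rV[R]_d)
    (hOmega : bounded_domain Omega) (hstein : stein_extension Omega)
    (M : set 'rV[int]_d) (hM : movable sigma Omega M)
    (hchain : chain_condition sigma Omega K M)
    (happrox : local_approximation sigma Omega P CBH)
    (u : 'rV[R]_d -> R) (hu : sobolev (fictitious sigma Omega) P.+1 u)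
    (us : 'rV[R]_d -> R) (hus : Vspace sigma P (fictitious sigma Omega) us)
    (hsol : forall v, Vspace sigma P (fictitious sigma Omega) v ->
       form_A sigma Omega P M eps us v = \int[lebesgue_rV R d]_(x in Omega) (u x * v x)),
  (L2norm (fictitious sigma Omega) (us \- u)%R <=
   (C * sigma ^+ P.+1)%:E * sobolev_norm (fictitious sigma Omega) P.+1 u)%E.
Proof.
(* Both local constants depend only on [d] and [P]. They are fixed before [sigma], [Omega], [M] and
   [u] enter, which is where the claimed independence comes from. *)
have [Cs Cs0 stability] := @stability_step R d P.
have [Ci Ci0 inverse] := @inverse_step R d P.
pose C2 := error_const d K eps Cs Ci * (CBH ^+ 2 * #|win d|%:R ^+ 2).
have C20 : 0 <= C2 by rewrite mulr_ge0 ?error_const_ge0// mulr_ge0 ?sqr_ge0.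
(* [C2] is the constant for the squared norms. *)
exists (Num.sqrt C2) => sigma sigma0 Omega [oO _ _ bO] _ M _ hchain happrox u hu us hus hsol.
set O := fictitious sigma Omega.
have mO : measurable O := open_measurable_rV (@fictitious_open R d sigma Omega).
have [t [ut tP]] := finite_elements sigma0 bO.
have uL : L2 O u by case: hu.
have /(nsq_sqint mO) nE : L2 O (us \- u).
  by have [] := sqint_sub_le mO (Vspace_L2 sigma0 ut tP hus) uL.
have N0 : (0 <= sobolev_norm O P.+1 u)%E by exact: poweR_ge0.
have s0 : 0 <= Num.sqrt C2 * sigma ^+ P.+1.
  by rewrite mulr_ge0 ?sqrtr_ge0 ?exprn_ge0 ?ltW.
apply: lee_sqrE; first by rewrite mule_ge0// lee_fin.
have -> : (((Num.sqrt C2 * sigma ^+ P.+1)%:E * sobolev_norm O P.+1 u) ^+ 2 =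
    (C2 * sigma ^+ (2 * P.+1))%:E * sobolev_norm O P.+1 u ^+ 2)%E.
  rewrite !expe2 muleACA -EFinM; congr (_%:E * _)%E.
  by rewrite -expr2 exprMn sqr_sqrtr// -exprM mulnC.
rewrite L2norm_sqr nE; apply: (@le_trans _ _ (C2 * sigma ^+ (2 * P.+1) * highsq P sigma Omega u O)%:E).
  rewrite lee_fin; have bound := error_bound heps Cs0 Ci0 stability inverse sigma0 oO bO.
  exact: bound hchain _ ut tP _ _ _ happrox hu hus hsol.
by rewrite EFinM lee_wpmul2l ?highsq_le// lee_fin mulr_ge0// exprn_ge0// ltW.
Qed.
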